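(* Let $\mathsf k$ be a field and let $E$ and $F$ be small graphs. Then the following are equivalent: (1) the Leavitt path algebras $L_{\mathsf k}(E)$ and $L_{\mathsf k}(F)$ are graded isomorphic; (2) there is a pointed order-preserving $\mathbb Z[x,x^{-1}]$-module isomorphism $K_0^{\mathrm{gr}}(L_{\mathsf k}(E))\to K_0^{\mathrm{gr}}(L_{\mathsf k}(F))$.
   Context: Graphs are directed, $E=(E^0,E^1,r,s)$ with range and source maps $r,s:E^1\to E^0$. The adjacency matrix $A_E$ has $(v,w)$ entry the number of edges from $v$ to $w$. A subset $H\subseteq E^0$ is hereditary if $s(e)\in H$ implies $r(e)\in H$, and saturated if every non-sink $v$ with $r(s^{-1}(v))\subseteq H$ lies in $H$. Small graphs. A small graph is a connected graph with exactly three vertices, no parallel edges, no sinks, whose only hereditary and saturated subsets are $\emptyset$ and $E^0$, and whose Leavitt path algebra is purely infinite simple (equivalently, here, every cycle has an exit). Up to isomorphism these are exactly 34 graphs, with the following adjacency matrices (rows separated by semicolons): $E^1_1$: [0 1 0; 0 0 1; 1 0 1]. $E^1_2$: [1 1 0; 0 0 1; 1 0 1]. $E^1_3$: [1 1 0; 0 1 1; 1 0 1]. $E^1_4$: [0 1 0; 0 0 1; 1 1 0]. $E^1_5$: [1 1 0; 0 0 1; 1 1 0]. $E^1_6$: [1 1 0; 0 0 1; 1 1 1]. $E^1_7$: [1 1 0; 0 1 1; 1 1 0]. $E^1_8$: [1 1 0; 1 0 1; 1 1 1]. $E^1_9$: [1 1 0; 1 1 1; 1 1 1]. $E^1_{10}$: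 [0 1 1; 1 0 0; 1 0 0]. $E^1_{11}$: [0 1 1; 1 0 0; 1 0 1]. $E^1_{12}$: [1 1 1; 1 0 0; 1 0 1]. $E^1_{13}$: [0 0 1; 1 0 0; 1 0 1]. $E^1_{14}$: [1 0 1; 1 0 0; 1 0 0]. $E^1_{15}$: [1 0 1; 1 0 0; 1 0 1]. $E^1_{16}$: [0 1 1; 0 0 1; 0 1 1]. $E^1_{17}$: [0 1 1; 0 1 1; 0 1 1]. $E^1_{18}$: [1 1 0; 0 1 1; 1 1 1]. $E^2_1$: [0 1 0; 0 1 1; 1 1 1]. $E^2_2$: [0 1 0; 1 0 1; 1 1 0]. $E^2_3$: [0 1 0; 1 0 1; 1 1 1]. $E^2_4$: [1 1 0; 1 0 1; 1 1 0]. $E^2_5$: [0 1 0; 0 1 1; 1 1 0]. $E^2_6$: [1 1 0; 1 1 1; 1 1 0]. $E^3_1$: [0 1 0; 0 0 1; 1 1 1]. $E^3_2$: [0 1 0; 1 1 1; 1 1 1]. $E^3_3$: [1 1 1; 1 1 1; 1 1 1]. $E^3_4$: [1 1 1; 1 0 0; 1 0 0]. $E^4_1$: [0 1 0; 1 1 1; 1 1 0]. $E^4_2$: [1 1 1; 1 1 1; 1 1 0]. $E^5_1$: [1 1 1; 1 0 1; 1 1 0]. $E^6_1$: [0 1 1; 1 0 1; 1 1 0]. $E^7_1$: [0 1 1; 1 1 0; 1 0 1]. $E^7_2$: [1 1 1; 1 1 0; 1 0 1]. Leavitt path algebras. $L_{\mathsf k}(E)$ is the universal $\mathsf k$-algebra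 generated by $\{v: v\in E^0\}\cup\{e,e^*: e\in E^1\}$ subject to: $v^2=v$ and $vw=0$ for $v\ne w$ in $E^0$; $s(e)e=er(e)=e$ and $r(e)e^*=e^*s(e)=e^*$; $e^*e=r(e)$, and $e^*f=0$ for $e\neq f$ in $E^1$; $v=\sum_{s(e)=v}ee^*$ for every non-sink $v$. It is $\mathbb Z$-graded by $\deg v=0$, $\deg e=1$, $\deg e^*=-1$. Graded notions. Graded isomorphic means isomorphic via a ring isomorphism carrying each homogeneous component $R_n$ onto $S_n$. For a unital $\mathbb Z$-graded ring $R$, $M(n)$ denotes the shift of a graded right module, $M(n)_i=M_{n+i}$. $K_0^{\mathrm{gr}}(R)$ is the group completion of the monoid of graded isomorphism classes of finitely generated graded projective right $R$-modules under $\oplus$, a $\mathbb Z[x,x^{-1}]$-module via $x\cdot[P]=[P(1)]$; its positive cone $K_0^{\mathrm{gr}}(R)^+$ consists of the classes $[P]$. An order-preserving isomorphism is one mapping positive cone onto positive cone. A homomorphism $K_0^{\mathrm{gr}}(R)\to K_0^{\mathrm{gr}}(S)$ is pointed if it sends $[R]$ to $[S]$. *)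

(* Defs.v *)
From HB Require Import structures.
From mathcomp Require Import all_boot all_order all_algebra.
From mathcomp Require Import boolp classical_sets.
From mathcomp Require Import finmap.

Set Implicit Arguments.
Unset Strict Implicit.
Unset Printing Implicit Defensive.

Import GRing.Theory.
Local Open Scope quotient_scope.
Local Open Scope ring_scope.

(* Finite graphs suffice: three vertices without parallel edges span at most
   nine edges. *)
Record graph := Graph {
  vertex : finType;
  edge : finType;
  src : edge -> vertex;
  rng : edge -> vertex
}.

Section SmallGraphs.
Variable E : graph.
Implicit Types (v w : vertex E) (e f : edge E) (H : {set vertex E}).

Definition is_sink v := [forall e : edge E, src e != v].

Definition adjacent : rel (vertex E) :=
  [rel v w | [exists e : edge E, ((src e == v) && (rng e == w))
                              || ((src e == w) && (rng e == v))]].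

Definition connected_graph := forall v w, connect adjacent v w.

Definition no_parallel_edges :=
  forall e f, src e = src f -> rng e = rng f -> e = f.

Definition hereditary H := forall e, src e \in H -> rng e \in H.

Definition saturated H :=
  forall v, ~~ is_sink v -> (forall e, src e = v -> rng e \in H) -> v \in H.

Definition is_cycle (c : seq (edge E)) :=
  [&& c != [::], cycle (fun e f => rng e == src f) c & uniq (map (@src E) c)].

Definition has_exit (c : seq (edge E)) :=
  exists e f, [/\ e \in c, src f = src e & f != e].

Record small_graph : Prop := SmallGraph {
  small_connected : connected_graph;
  small_card : #|vertex E| = 3%N;
  small_no_parallel : no_parallel_edges;
  small_no_sink : forall v, ~~ is_sink v;
  small_hersat : forall H, hereditary H -> saturated H ->
    H = finset.set0 \/ H = [set: vertex E]%SET;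
  small_exit : forall c, is_cycle c -> has_exit c
}.

End SmallGraphs.

Definition is_grading (V : zmodType) (C : int -> set V) : Prop :=
  [/\ forall n, C n 0,
      forall n x y, C n x -> C n y -> C n (x - y),
      forall x, exists s : seq int, exists2 c : int -> V,
        forall n, C n (c n) & x = \sum_(n <- s) c n
    & forall (s : seq int) (c : int -> V), uniq s -> (forall n, C n (c n)) ->
        \sum_(n <- s) c n = 0 -> forall n, n \in s -> c n = 0].

Lemma grading_decomp (V : zmodType) (C : int -> set V) (z : V) s c :
  is_grading C -> (forall n, C n (c n)) -> z = \sum_(n <- s) c n ->
  exists2 d : int -> V, (forall n, C n (d n)) &
    forall t, uniq t -> {subset s <= t} -> z = \sum_(n <- t) d n.
Proof.
move=> [C0 CB _ _] cC ->.
have CD n u v : C n u -> C n v -> C n (u + v).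
  move=> Cu Cv; rewrite -[v]opprK -[- v]add0r.
  by apply: (CB) => //; apply: CB.
exists (fun n => \sum_(m <- s | m == n) c m) => [n|t ut st].
  apply: (big_ind (C n)) => // [|m /eqP ->]; [exact: CD|exact: cC].
rewrite (exchange_big_dep xpredT) //=.
rewrite !big_seq; apply: eq_bigr => m ms.
rewrite big_mkcond (bigD1_seq m) ?st //= eqxx big1 ?addr0 // => n.
by rewrite eq_sym => /negPf ->.
Qed.

Record grRing := GrRing {
  gr_ring :> pzRingType;
  gr_comp : int -> set gr_ring;
  gr_grading : is_grading gr_comp;
  gr_one : gr_comp 0 1;
  gr_mul : forall m n x y, gr_comp m x -> gr_comp n y -> gr_comp (m + n) (x * y)
}.

Arguments gr_comp R n : clear implicits, rename.

Definition graded_isomorphic (R S : grRing) : Prop :=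
  exists f : {rmorphism R -> S},
    bijective f /\ forall n, (f @` gr_comp R n = gr_comp S n)%classic.

(* A right R-module is a left module over the converse ring R^c; the right
   action of r on x is [(r : R^c) *: x]. *)
Record grModule (R : grRing) := GrModule {
  gm_mod :> lmodType R^c;
  gm_comp : int -> set gm_mod;
  gm_grading : is_grading gm_comp;
  gm_scale : forall m n (x : gm_mod) (r : R),
    gm_comp m x -> gr_comp R n r -> gm_comp (m + n) ((r : R^c) *: x)
}.
Arguments gm_comp {R} M n : rename.

Section GradedModules.
Variable R : grRing.
Implicit Types M N P Q : grModule R.

Definition graded_hom M N (f : {linear M -> N}) : Prop :=
  forall n x, gm_comp M n x -> gm_comp N n (f x).

Definition graded_iso M N : Prop :=
  exists2 f : {linear M -> N}, bijective f &
    forall n, (f @` gm_comp M n = gm_comp N n)%classic.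

Definition finitely_generated M : Prop :=
  exists s : seq M, forall x : M, exists c : nat -> R,
    x = \sum_(i < size s) (c i : R^c) *: s`_i.

(* Projective object of the category of graded right R-modules. *)
Definition graded_projective M : Prop :=
  forall (A B : grModule R) (g : {linear A -> B}) (f : {linear M -> B}),
    graded_hom g -> graded_hom f -> (forall b, exists a, g a = b) ->
    exists2 h : {linear M -> A}, graded_hom h & forall x, g (h x) = f x.

Lemma shift_grading M (n : int) : is_grading (fun i => gm_comp M (n + i)).
Proof.
case: (gm_grading M) => C0 CB Cex Cun; split=> [i|i|x|s c us cC s0 i si].
- exact: C0.
- exact: CB.
- have [s [c cC ->]] := Cex x.
  exists [seq i - n | i <- s]; exists (fun i => c (n + i)) => [i|]; first exact: cC.
  by rewrite big_map; apply: eq_bigr => i _; rewrite addrC subrK.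
- have := @Cun [seq n + i | i <- s] (fun i => c (i - n)).
  rewrite map_inj_uniq ?us; last exact: addrI.
  have cC' j : gm_comp M j (c (j - n)) by have := cC (j - n); rewrite addrC subrK.
  rewrite big_map; under eq_bigr do rewrite addrC addKr.
  move=> /(_ isT cC' s0 (n + i)); rewrite [n + i - n]addrC addKr; apply.
  exact: map_f.
Qed.

Lemma shift_scale M (n : int) i j (x : M) (r : R) :
  gm_comp M (n + i) x -> gr_comp R j r -> gm_comp M (n + (i + j)) ((r : R^c) *: x).
Proof. by rewrite addrA; apply: gm_scale. Qed.

Definition gshift M (n : int) : grModule R :=
  GrModule (shift_grading M n) (@shift_scale M n).

Lemma sum_grading M N :
  is_grading (fun n => [set p : M * N | gm_comp M n p.1 /\ gm_comp N n p.2])%classic.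
Proof.
have fstD s (c : int -> M * N) :
    \sum_(n <- s) c n = (\sum_(n <- s) (c n).1, \sum_(n <- s) (c n).2).
  by elim: s => [|n s IH]; rewrite ?big_nil // !big_cons IH; case: (c n).
case: (gm_grading M) => M0 MB Mex Mun; case: (gm_grading N) => N0 NB Nex Nun.
split=> [n|n x y [? ?] [? ?]|[x y]|s c us cC].
- by split.
- by split; [apply: MB|apply: NB].
- have [s [c cC cE]] := Mex x; have [t [d dC dE]] := Nex y.
  have [c' cC' cE'] := grading_decomp (gm_grading M) cC cE.
  have [d' dC' dE'] := grading_decomp (gm_grading N) dC dE.
  exists (undup (s ++ t)), (fun n => (c' n, d' n)) => [n|]; first by split.
  by rewrite fstD /= -cE' -?dE' ?undup_uniq // => n ns;
     rewrite mem_undup mem_cat ns ?orbT.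
- rewrite fstD => -[/Mun Ms /Nun Ns] n ns.
  have := Ms us (fun n => (cC n).1) n ns; have := Ns us (fun n => (cC n).2) n ns.
  by case: (c n) => /= ? ? -> ->.
Qed.

Lemma sum_scale M N m n (p : M * N) (r : R) :
  gm_comp M m p.1 /\ gm_comp N m p.2 -> gr_comp R n r ->
  gm_comp M (m + n) ((r : R^c) *: p).1 /\ gm_comp N (m + n) ((r : R^c) *: p).2.
Proof. by move=> [? ?] ?; split; apply: gm_scale. Qed.

Definition gsum M N : grModule R :=
  GrModule (sum_grading M N) (@sum_scale M N).

Definition greg : grModule R :=
  @GrModule R (R^c)^o (gr_comp R) (gr_grading R) (@gr_mul R).

Lemma zero_grading : is_grading (fun _ : int => [set: 'rV[R^c]_0])%classic.
Proof.
split=> // [x|s c _ _ _ n _]; last by rewrite thinmx0.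
by exists [::], (fun=> 0) => //; rewrite big_nil thinmx0.
Qed.

Definition gzero : grModule R :=
  @GrModule R 'rV[R^c]_0 _ zero_grading (fun _ _ _ _ _ _ => I).

Lemma graded_isoP M N (f : {linear M -> N}) (g : N -> M) :
  cancel f g -> cancel g f ->
  (forall n x, gm_comp M n x -> gm_comp N n (f x)) ->
  (forall n y, gm_comp N n y -> gm_comp M n (g y)) -> graded_iso M N.
Proof.
move=> fK gK fC gC; exists f; first by exists g.
move=> n; apply/seteqP; split=> [_ [x Cx <-]|y Cy]; first exact: fC.
by exists (g y); [apply: gC|apply: gK].
Qed.

Lemma graded_isoE M N : graded_iso M N ->
  exists (f : {linear M -> N}) (g : {linear N -> M}),
    [/\ cancel f g, cancel g f,
        forall n x, gm_comp M n x -> gm_comp N n (f x)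
      & forall n y, gm_comp N n y -> gm_comp M n (g y)].
Proof.
move=> [f [g fK gK] fC].
have glin : linear g.
  by move=> r x y; apply: (can_inj fK); rewrite linearP !gK.
exists f, (HB.pack g (GRing.isLinear.Build _ _ _ _ g glin) : {linear N -> M}).
split=> // n x; first by rewrite -fC => Cx; exists x.
by rewrite -fC => -[y Cy <-] /=; rewrite fK.
Qed.

Lemma graded_iso_refl M : graded_iso M M.
Proof. exact: (@graded_isoP M M idfun idfun). Qed.

Lemma graded_iso_sym M N : graded_iso M N -> graded_iso N M.
Proof. by move=> /graded_isoE [f [g [fK gK fC gC]]]; apply: graded_isoP gC fC. Qed.

Lemma graded_iso_trans M N P :
  graded_iso M N -> graded_iso N P -> graded_iso M P.
Proof.
move=> /graded_isoE [f [g [fK gK fC gC]]] /graded_isoE [f' [g' [fK' gK' fC' gC']]].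
apply: (@graded_isoP M P (f' \o f) (g \o g')) => [x|x|n x /fC/fC'|n x /gC'/gC] //=.
  by rewrite fK' fK.
by rewrite gK gK'.
Qed.

Lemma graded_iso_sum M M' N N' :
  graded_iso M M' -> graded_iso N N' -> graded_iso (gsum M N) (gsum M' N').
Proof.
move=> /graded_isoE [f [g [fK gK fC gC]]] /graded_isoE [f' [g' [fK' gK' fC' gC']]].
pose h (p : gsum M N) : gsum M' N' := (f p.1, f' p.2).
have hlin : linear h by move=> r x y; rewrite /h /= !linearP.
pose hL : {linear gsum M N -> gsum M' N'} :=
  HB.pack h (GRing.isLinear.Build _ _ _ _ h hlin).
apply: (@graded_isoP _ _ hL (fun p => (g p.1, g' p.2))) => [[x y]|[x y]|n [x y]|n [x y]].
- by rewrite /= /h /= fK fK'.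
- by rewrite /= /h /= gK gK'.
- by move=> [/fC ? /fC' ?].
- by move=> [/gC ? /gC' ?].
Qed.

Lemma graded_iso_sumC M N : graded_iso (gsum M N) (gsum N M).
Proof.
pose h (p : gsum M N) : gsum N M := (p.2, p.1).
have hlin : linear h by [].
pose hL : {linear gsum M N -> gsum N M} :=
  HB.pack h (GRing.isLinear.Build _ _ _ _ h hlin).
by apply: (@graded_isoP _ _ hL (fun p => (p.2, p.1))) => [[x y]|[x y]|n [x y] []|n [x y] []].
Qed.

Lemma graded_iso_sumA M N P :
  graded_iso (gsum M (gsum N P)) (gsum (gsum M N) P).
Proof.
pose h (p : gsum M (gsum N P)) : gsum (gsum M N) P := (p.1, p.2.1, p.2.2).
have hlin : linear h by [].
pose hL : {linear gsum M (gsum N P) -> gsum (gsum M N) P} :=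
  HB.pack h (GRing.isLinear.Build _ _ _ _ h hlin).
apply: (@graded_isoP _ _ hL (fun p => (p.1.1, (p.1.2, p.2)))) =>
  [[x [y z]]|[[x y] z]|n [x [y z]] /= [? []]|n [[x y] z] /= [[]]] //.
Qed.

Lemma graded_iso_shift M N n : graded_iso M N -> graded_iso (gshift M n) (gshift N n).
Proof. by move=> [f fb fC]; exists f => // i; apply: fC. Qed.

Lemma fg_zero : finitely_generated gzero.
Proof. by exists [::] => x; exists (fun=> 0); rewrite thinmx0 [RHS]thinmx0. Qed.

Lemma projective_zero : graded_projective gzero.
Proof.
move=> A B g f _ _ _; exists (\0 : {linear gzero -> A}); last first.
  by move=> x; rewrite thinmx0 !linear0.
move=> n x _; case: (gm_grading A) => A0 _ _ _; exact: A0.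
Qed.

Lemma fg_reg : finitely_generated greg.
Proof.
exists [:: (1 : R)] => x; exists (fun=> x).
by rewrite big_ord1 /= /GRing.scale /= /GRing.mul /= mul1r.
Qed.

Lemma projective_reg : graded_projective greg.
Proof.
move=> A B g f gC fC gsurj; have [a ga] := gsurj (f 1).
case: (gm_grading A) => A0 AB Aex Aun; case: (gm_grading B) => B0 BB Bex Bun.
have [s [c cC cE]] := Aex a.
have [d dC dE] := grading_decomp (gm_grading A) cC cE.
pose t : seq int := undup (0 :: s).
have ut : uniq t by apply: undup_uniq.
have t0 : 0 \in t by rewrite mem_undup mem_head.
have {}dE : a = \sum_(n <- t) d n.
  by apply: dE => // n ns; rewrite mem_undup in_cons ns orbT.
have gd0 : g (d 0) = f 1.
  apply/eqP; rewrite -subr_eq0; apply/eqP.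
  have := Bun t (fun n => g (d n) - (if n == 0 then f 1 else 0)) ut.
  rewrite sumrB -linear_sum -dE ga -big_mkcond -big_filter filter_pred1_uniq //.
  rewrite big_seq1 subrr => H; have := H _ erefl 0 t0; rewrite eqxx; apply=> n.
  apply: BB; first exact: gC.
  by case: eqP => [->|_]; [apply: fC; apply: gr_one|apply: B0].
pose h (r : greg) : A := (r : R^c) *: d 0.
have hlin : linear h by move=> r x y; rewrite /h scalerDl -scalerA.
pose hL : {linear greg -> A} := HB.pack h (GRing.isLinear.Build _ _ _ _ h hlin).
exists hL => [n r rC|r].
  by rewrite -[n]add0r; apply: gm_scale.
rewrite /= /h linearZ /= gd0 -linearZ; congr (f _).
by rewrite /GRing.scale /= mulr1.
Qed.

Lemma fg_sum M N : finitely_generated M -> finitely_generated N ->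
  finitely_generated (gsum M N).
Proof.
move=> [s sM] [t tN].
exists ([seq (x, 0) | x <- s] ++ [seq (0, y) | y <- t]) => -[x y].
have [c cE] := sM x; have [d dE] := tN y.
exists (fun i => if (i < size s)%N then c i else d (i - size s)%N).
have pairE (I : Type) (r : seq I) (u : I -> M) (v : I -> N) :
    \sum_(i <- r) ((u i, v i) : gsum M N) = (\sum_(i <- r) u i, \sum_(i <- r) v i).
  by elim: r => [|i r IH]; rewrite ?big_nil // !big_cons IH.
rewrite size_cat !size_map big_split_ord /=.
rewrite (eq_bigr (fun i : 'I_(size s) => ((c i : R^c) *: s`_i, 0))); last first.
  move=> i _; rewrite ltn_ord nth_cat size_map ltn_ord (nth_map 0) ?ltn_ord //.
  by congr (_, _); rewrite /= scaler0.
rewrite [X in _ + X](eq_bigr (fun i : 'I_(size t) => (0, (d i : R^c) *: t`_i))); last first.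
  move=> i _; rewrite ltnNge leq_addr /= addKn nth_cat size_map ltnNge leq_addr /=.
  rewrite addKn (nth_map 0) ?ltn_ord //.
  by congr (_, _); rewrite /= scaler0.
rewrite !pairE !big1_eq -cE -dE.
by congr (_, _); rewrite /= ?addr0 ?add0r.
Qed.

Lemma projective_sum M N : graded_projective M -> graded_projective N ->
  graded_projective (gsum M N).
Proof.
move=> pM pN A B g f gC fC gs.
pose j1 (x : M) : gsum M N := (x, 0); pose j2 (y : N) : gsum M N := (0, y).
have j1lin : linear j1 by move=> r x y; congr (_, _); rewrite /= scaler0 addr0.
have j2lin : linear j2 by move=> r x y; congr (_, _); rewrite /= scaler0 addr0.
pose i1 : {linear M -> gsum M N} :=
  HB.pack j1 (GRing.isLinear.Build _ _ _ _ j1 j1lin).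
pose i2 : {linear N -> gsum M N} :=
  HB.pack j2 (GRing.isLinear.Build _ _ _ _ j2 j2lin).
case: (gm_grading M) => M0 _ _ _; case: (gm_grading N) => N0 _ _ _.
have [|h1 h1C h1E] := pM A B g (f \o i1) gC _ gs.
  by move=> n x xC; apply: fC; split.
have [|h2 h2C h2E] := pN A B g (f \o i2) gC _ gs.
  by move=> n x xC; apply: fC; split.
pose h (p : gsum M N) := h1 p.1 + h2 p.2.
have hlin : linear h.
  by move=> r x y; rewrite /h !linearP scalerDr addrACA.
exists (HB.pack h (GRing.isLinear.Build _ _ _ _ h hlin) : {linear gsum M N -> A}).
  move=> n p [pC1 pC2] /=; rewrite /h; case: (gm_grading A) => A0 AB _ _.
  rewrite -[h2 _]opprK -[- h2 _]add0r.
  by apply: (AB); [apply: h1C|apply: (AB) => //; apply: h2C].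
move=> [x y]; rewrite /= /h linearD h1E h2E /= -linearD; congr (f _).
by congr (_, _); rewrite /= ?addr0 ?add0r.
Qed.

Lemma projective_shift M n : graded_projective M -> graded_projective (gshift M n).
Proof.
move=> pM A B g f gC fC gs.
have [||h hC hE] := pM (gshift A (- n)) (gshift B (- n)) g f _ _ gs.
- by move=> i x; apply: gC.
- by move=> i x xC; apply: fC; rewrite /= addrA subrr add0r.
by exists h => // i x /= /hC /=; rewrite addrA addNr add0r.
Qed.

Record fgProjective := FgProjective {
  fp_mod :> grModule R;
  fp_fg : finitely_generated fp_mod;
  fp_projective : graded_projective fp_mod
}.

Definition fp_sum (P Q : fgProjective) : fgProjective :=
  FgProjective (fg_sum (fp_fg P) (fp_fg Q))
               (projective_sum (@fp_projective P) (@fp_projective Q)).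

Definition fp_zero : fgProjective := FgProjective fg_zero projective_zero.

Definition fp_reg : fgProjective := FgProjective fg_reg projective_reg.

Definition fp_shift (n : int) (P : fgProjective) : fgProjective :=
  FgProjective (fp_fg P : finitely_generated (gshift P n))
               (@projective_shift P n (@fp_projective P)).

End GradedModules.

Record commutative_congruence T (eqv : T -> T -> Prop) (add : T -> T -> T) := {
  ccg_refl : forall x, eqv x x;
  ccg_sym : forall x y, eqv x y -> eqv y x;
  ccg_trans : forall x y z, eqv x y -> eqv y z -> eqv x z;
  ccg_add : forall x x' y y', eqv x x' -> eqv y y' -> eqv (add x y) (add x' y');
  ccg_addA : forall x y z, eqv (add x (add y z)) (add (add x y) z);
  ccg_addC : forall x y, eqv (add x y) (add y x)
}.

(* Group completion of the commutative monoid T / eqv: its elements are the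
   classes of formal differences p.1 - p.2. When T is a type of modules, the
   completion lies in a universe above that of all MathComp structures and
   cannot be a [zmodType]; its operations are therefore given explicitly, on
   chosen representatives (see [gc_addE], [gc_oppE], [gc_mapE]). *)
Section GroupCompletion.
Variables (T : Type) (eqv : T -> T -> Prop) (add : T -> T -> T) (zero : T).

Definition diff_eq (p q : T * T) : Prop :=
  exists t, eqv (add (add p.1 q.2) t) (add (add q.1 p.2) t).

Definition completion : Type :=
  {C : T * T -> Prop | exists p, C = diff_eq p}.

Definition gc_class (p : T * T) : completion :=
  exist _ (diff_eq p) (ex_intro _ p erefl).

Lemma completion_inj (a b : completion) : sval a = sval b -> a = b.
Proof.
case: a b => [C hC] [D hD] /= E; case: D / E hD => hD.
by rewrite (Prop_irrelevance hC hD).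
Qed.

Definition gc_repr (a : completion) : T * T := projT1 (cid (proj2_sig a)).

Definition gc_add (a b : completion) : completion :=
  let p := gc_repr a in let q := gc_repr b in
  gc_class (add p.1 q.1, add p.2 q.2).

Definition gc_opp (a : completion) : completion :=
  let p := gc_repr a in gc_class (p.2, p.1).

Definition gc_zero : completion := gc_class (zero, zero).

Definition gc_in (x : T) : completion := gc_class (x, zero).

Definition gc_map (f : T -> T) (a : completion) : completion :=
  let p := gc_repr a in gc_class (f p.1, f p.2).

Hypothesis H : commutative_congruence eqv add.

Let eqv_refl : forall x, eqv x x. Proof. by case: H. Qed.
Let eqv_sym : forall x y, eqv x y -> eqv y x. Proof. by case: H. Qed.
Let eqv_trans : forall x y z, eqv x y -> eqv y z -> eqv x z.
Proof. by case: H. Qed.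
Let eqv_add : forall x x' y y',
  eqv x x' -> eqv y y' -> eqv (add x y) (add x' y').
Proof. by case: H. Qed.
Let addA : forall x y z, eqv (add x (add y z)) (add (add x y) z).
Proof. by case: H. Qed.
Let addC : forall x y, eqv (add x y) (add y x). Proof. by case: H. Qed.

Let addACA x y z t :
  eqv (add (add x y) (add z t)) (add (add x z) (add y t)).
Proof.
apply: eqv_trans (eqv_sym (addA _ _ _)) _; apply: eqv_trans (addA _ _ _).
apply: (eqv_add) => //; apply: eqv_trans (addA _ _ _) _.
by apply: eqv_trans (eqv_sym (addA _ _ _)); apply: (eqv_add).
Qed.

Lemma diff_eq_refl p : diff_eq p p.
Proof. by exists p.1. Qed.

Lemma diff_eq_sym p q : diff_eq p q -> diff_eq q p.
Proof. by move=> [t /eqv_sym ?]; exists t. Qed.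

Let addC2 x y z : eqv (add (add x y) z) (add (add y x) z).
Proof. exact: eqv_add. Qed.

Lemma diff_eq_trans p q r : diff_eq p q -> diff_eq q r -> diff_eq p r.
Proof.
move=> [t pq] [u qr]; exists (add (add q.2 q.1) (add t u)).
have sw a b c d w :
    eqv (add (add a b) (add (add c d) w)) (add (add (add a c) (add d b)) w).
  apply: eqv_trans (addA _ _ _) _; apply: (eqv_add) => //.
  by apply: eqv_trans (addACA _ _ _ _) _; apply: (eqv_add).
apply: eqv_trans (sw _ _ _ _ _) _; apply: eqv_trans (addACA _ _ _ _) _.
apply: eqv_trans (eqv_add pq qr) _; apply: eqv_trans (addACA _ _ _ _) _.
by apply: eqv_trans (addC2 _ _ _) _; apply: eqv_sym; apply: sw.
Qed.

Lemma diff_eq_add p p' q q' : diff_eq p p' -> diff_eq q q' ->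
  diff_eq (add p.1 q.1, add p.2 q.2) (add p'.1 q'.1, add p'.2 q'.2).
Proof.
move=> [t pp] [u qq]; exists (add t u) => /=.
apply: eqv_trans (eqv_add (addACA _ _ _ _) (eqv_refl _)) _.
apply: eqv_trans (addACA _ _ _ _) _; apply: eqv_trans (eqv_add pp qq) _.
apply: eqv_trans (addACA _ _ _ _) _.
exact: eqv_add.
Qed.

Lemma diff_eq_opp p q : diff_eq p q -> diff_eq (p.2, p.1) (q.2, q.1).
Proof.
move=> [t pq]; exists t => /=; apply: eqv_sym.
by apply: eqv_trans (addC2 _ _ _) _; apply: eqv_trans pq _.
Qed.

Lemma gc_classP p q : gc_class p = gc_class q <-> diff_eq p q.
Proof.
split=> [[E]|pq]; first by rewrite E; apply: diff_eq_refl.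
apply: completion_inj; apply/funext => r; apply/propext; split.
  exact/diff_eq_trans/diff_eq_sym.
exact: diff_eq_trans.
Qed.

Lemma gc_reprK a : gc_class (gc_repr a) = a.
Proof. by apply: completion_inj; rewrite /gc_repr; case: cid. Qed.

Lemma gc_repr_class p : diff_eq (gc_repr (gc_class p)) p.
Proof. by apply/gc_classP; apply: gc_reprK. Qed.

Lemma gc_addE p q :
  gc_add (gc_class p) (gc_class q) = gc_class (add p.1 q.1, add p.2 q.2).
Proof. apply/gc_classP. exact: diff_eq_add (gc_repr_class _) (gc_repr_class _). Qed.

Lemma gc_oppE p : gc_opp (gc_class p) = gc_class (p.2, p.1).
Proof. apply/gc_classP; exact: diff_eq_opp (gc_repr_class _). Qed.

Lemma gc_mapE (f : T -> T) p :
    (forall x y, eqv x y -> eqv (f x) (f y)) ->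
    (forall x y, eqv (f (add x y)) (add (f x) (f y))) ->
  gc_map f (gc_class p) = gc_class (f p.1, f p.2).
Proof.
move=> fE fD; apply/gc_classP; have [t /fE pt] := gc_repr_class p.
have fDD x y z : eqv (f (add (add x y) z)) (add (add (f x) (f y)) (f z)).
  by apply: eqv_trans (fD _ _) _; apply: (eqv_add).
exists (f t); apply: eqv_trans (eqv_sym (fDD _ _ _)) _.
exact: eqv_trans pt (fDD _ _ _).
Qed.

Lemma gc_addA : associative gc_add.
Proof.
move=> a b c; rewrite -[a]gc_reprK -[b]gc_reprK -[c]gc_reprK !gc_addE.
apply/gc_classP; exists (gc_repr a).1; apply: (eqv_add) => //=.
by apply: (eqv_add); [apply: addA|apply/eqv_sym/addA].
Qed.

Lemma gc_addC : commutative gc_add.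
Proof.
move=> a b; rewrite -[a]gc_reprK -[b]gc_reprK !gc_addE.
by apply/gc_classP; exists (gc_repr a).1; apply: (eqv_add) => //=; apply: (eqv_add).
Qed.

Lemma gc_add0 : left_id gc_zero gc_add.
Proof.
move=> a; rewrite -[a]gc_reprK gc_addE; apply/gc_classP.
exists zero; apply: (eqv_add) => //=.
by apply: eqv_trans (addC2 _ _ _) _; apply: eqv_sym.
Qed.

Lemma gc_addN : left_inverse gc_zero gc_opp gc_add.
Proof.
move=> a; rewrite -[a]gc_reprK gc_oppE gc_addE; apply/gc_classP.
exists zero; apply: (eqv_add) => //=.
by apply: eqv_trans (addC _ _) _; apply: (eqv_add).
Qed.

End GroupCompletion.

(* Laurent polynomials with integer coefficients: [p n] is the coefficient
   of x^n. *)
Definition laurent := {fsfun int -> int with 0}.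

Section K0gr.
Variable R : grRing.
Implicit Types (P Q : fgProjective R) (n m : int).

Definition K0gr : Type :=
  completion (fun P Q => graded_iso P Q) (@fp_sum R).

Definition K0_class P : K0gr := gc_in _ (@fp_sum R) (fp_zero R) P.

Definition K0_add : K0gr -> K0gr -> K0gr := @gc_add _ _ (@fp_sum R).

Definition K0_opp : K0gr -> K0gr := @gc_opp _ _ (@fp_sum R).

Definition K0_zero : K0gr := gc_zero _ (@fp_sum R) (fp_zero R).

Definition K0_shift n : K0gr -> K0gr := gc_map (fp_shift n).

Definition K0_intmul m (a : K0gr) : K0gr :=
  match m with
  | Posz i => iter i (K0_add a) K0_zero
  | Negz i => K0_opp (iter i.+1 (K0_add a) K0_zero)
  end.

(* The action of Z[x, x^-1] determined by x [P] = [P(1)]. *)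
Definition K0_act (p : laurent) (a : K0gr) : K0gr :=
  \big[K0_add/K0_zero]_(n <- finsupp p) K0_intmul (p n) (K0_shift n a).

Definition K0_pos (a : K0gr) : Prop := exists P, a = K0_class P.

Definition K0_unit : K0gr := K0_class (fp_reg R).

Lemma K0_congruence :
  commutative_congruence (fun P Q => graded_iso P Q) (@fp_sum R).
Proof.
split=> [P|P Q|P Q U|P P' Q Q'|P Q U|P Q].
- exact: graded_iso_refl.
- exact: graded_iso_sym.
- exact: graded_iso_trans.
- exact: graded_iso_sum.
- exact: graded_iso_sumA.
- exact: graded_iso_sumC.
Qed.

Lemma K0_addA : associative K0_add.
Proof. exact: gc_addA K0_congruence. Qed.

Lemma K0_addC : commutative K0_add.
Proof. exact: gc_addC K0_congruence. Qed.

Lemma K0_add0 : left_id K0_zero K0_add.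
Proof. exact: gc_add0 K0_congruence. Qed.

Lemma K0_addN : left_inverse K0_zero K0_opp K0_add.
Proof. exact: gc_addN K0_congruence. Qed.

Lemma K0_classD P Q :
  K0_class (fp_sum P Q) = K0_add (K0_class P) (K0_class Q).
Proof.
rewrite /K0_add (gc_addE K0_congruence); apply/(gc_classP K0_congruence).
exists (fp_zero R) => /=; apply: graded_iso_sum (graded_iso_refl _).
apply: graded_iso_sum; first exact: graded_iso_refl.
have z0 (x : 'rV[R^c]_0) : x = 0 by rewrite thinmx0.
apply: (@graded_isoP _ _ _ \0 (fun=> 0)) => [[x y]|x|n x _|n x _] //.
by congr (_, _); rewrite /= [RHS]z0.
Qed.

Lemma K0_shiftE n P : K0_shift n (K0_class P) = K0_class (fp_shift n P).
Proof.
rewrite /K0_shift /K0_class (gc_mapE K0_congruence).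
- apply/(gc_classP K0_congruence); exists (fp_zero R) => /=.
  apply: graded_iso_sum (graded_iso_refl _).
  by apply: graded_iso_sum; apply: (@graded_isoP _ _ _ idfun idfun).
- by move=> U V; apply: graded_iso_shift.
- by move=> U V; apply: (@graded_isoP _ _ _ idfun idfun).
Qed.

End K0gr.

Section K0Morphisms.
Variables R S : grRing.
Variable phi : K0gr R -> K0gr S.

(* Homomorphisms of Z[x, x^-1]-modules. *)
Definition K0_linear : Prop :=
  (forall a b, phi (K0_add a b) = K0_add (phi a) (phi b)) /\
  (forall p a, phi (K0_act p a) = K0_act p (phi a)).

Definition K0_order_preserving : Prop :=
  forall b, K0_pos b <-> exists2 a, K0_pos a & phi a = b.

Definition K0_pointed : Prop := phi (K0_unit R) = K0_unit S.

End K0Morphisms.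

Section Leavitt.
Variables (k : fieldType) (E : graph).

(* Terms over the generators in the signature of not necessarily unital
   k-algebras. *)
Inductive lterm : Type :=
| LVert of vertex E
| LEdge of edge E
| LGhost of edge E
| LZero
| LAdd of lterm & lterm
| LOpp of lterm
| LScale of k & lterm
| LMul of lterm & lterm.

(* The least k-algebra congruence containing the defining relations. *)
Inductive lcongr : lterm -> lterm -> Prop :=
| lc_refl s : lcongr s s
| lc_sym s t : lcongr s t -> lcongr t s
| lc_trans s t u : lcongr s t -> lcongr t u -> lcongr s u
| lc_add s s' t t' : lcongr s s' -> lcongr t t' -> lcongr (LAdd s t) (LAdd s' t')
| lc_opp s s' : lcongr s s' -> lcongr (LOpp s) (LOpp s')
| lc_scale a s s' : lcongr s s' -> lcongr (LScale a s) (LScale a s')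
| lc_mul s s' t t' : lcongr s s' -> lcongr t t' -> lcongr (LMul s t) (LMul s' t')
| lc_addA s t u : lcongr (LAdd s (LAdd t u)) (LAdd (LAdd s t) u)
| lc_addC s t : lcongr (LAdd s t) (LAdd t s)
| lc_add0 s : lcongr (LAdd LZero s) s
| lc_addN s : lcongr (LAdd (LOpp s) s) LZero
| lc_scaleA a b s : lcongr (LScale a (LScale b s)) (LScale (a * b) s)
| lc_scale1 s : lcongr (LScale 1 s) s
| lc_scaleDr a s t : lcongr (LScale a (LAdd s t)) (LAdd (LScale a s) (LScale a t))
| lc_scaleDl a b s : lcongr (LScale (a + b) s) (LAdd (LScale a s) (LScale b s))
| lc_mulA s t u : lcongr (LMul s (LMul t u)) (LMul (LMul s t) u)
| lc_mulDl s t u : lcongr (LMul (LAdd s t) u) (LAdd (LMul s u) (LMul t u))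
| lc_mulDr s t u : lcongr (LMul s (LAdd t u)) (LAdd (LMul s t) (LMul s u))
| lc_scaleAl a s t : lcongr (LScale a (LMul s t)) (LMul (LScale a s) t)
| lc_scaleAr a s t : lcongr (LScale a (LMul s t)) (LMul s (LScale a t))
| lc_vv v : lcongr (LMul (LVert v) (LVert v)) (LVert v)
| lc_vw v w : v <> w -> lcongr (LMul (LVert v) (LVert w)) LZero
| lc_se e : lcongr (LMul (LVert (src e)) (LEdge e)) (LEdge e)
| lc_er e : lcongr (LMul (LEdge e) (LVert (rng e))) (LEdge e)
| lc_rg e : lcongr (LMul (LVert (rng e)) (LGhost e)) (LGhost e)
| lc_gs e : lcongr (LMul (LGhost e) (LVert (src e))) (LGhost e)
| lc_ck1 e : lcongr (LMul (LGhost e) (LEdge e)) (LVert (rng e))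
| lc_ck1' e f : e <> f -> lcongr (LMul (LGhost e) (LEdge f)) LZero
| lc_ck2 v : ~~ is_sink v ->
    lcongr (LVert v) (\big[LAdd/LZero]_(e | src e == v) LMul (LEdge e) (LGhost e)).

HB.instance Definition _ := gen_eqMixin lterm.
HB.instance Definition _ := gen_choiceMixin lterm.

Definition lrel : rel lterm := fun s t => `[< lcongr s t >].

Lemma lrel_equiv : equiv_class_of lrel.
Proof.
split=> [s|s t|t s u]; first exact/asboolP/lc_refl.
  by apply/asboolP/asboolP; apply: lc_sym.
by move=> /asboolP st /asboolP tu; apply/asboolP/lc_trans/tu.
Qed.

Canonical lrel_equiv_rel := EquivRelPack lrel_equiv.

Definition leavitt_alg := {eq_quot lrel}.

HB.instance Definition _ := Choice.on leavitt_alg.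

Definition lcls (t : lterm) : leavitt_alg := \pi_leavitt_alg t.

Lemma lclsP s t : lcls s = lcls t <-> lcongr s t.
Proof.
split=> [/eqmodP/asboolP //|st].
exact/eqmodP/asboolP.
Qed.

Lemma lreprK (x : leavitt_alg) : lcls (repr x) = x.
Proof. exact: reprK. Qed.

Lemma lrepr_cls t : lcongr (repr (lcls t)) t.
Proof. by apply/lclsP; apply: lreprK. Qed.

Definition ladd (x y : leavitt_alg) := lcls (LAdd (repr x) (repr y)).
Definition lopp (x : leavitt_alg) := lcls (LOpp (repr x)).
Definition lscale a (x : leavitt_alg) := lcls (LScale a (repr x)).
Definition lmul (x y : leavitt_alg) := lcls (LMul (repr x) (repr y)).

Lemma laddE s t : ladd (lcls s) (lcls t) = lcls (LAdd s t).
Proof. by apply/lclsP/lc_add; apply: lrepr_cls. Qed.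
Lemma loppE s : lopp (lcls s) = lcls (LOpp s).
Proof. by apply/lclsP/lc_opp; apply: lrepr_cls. Qed.
Lemma lscaleE a s : lscale a (lcls s) = lcls (LScale a s).
Proof. by apply/lclsP/lc_scale; apply: lrepr_cls. Qed.
Lemma lmulE s t : lmul (lcls s) (lcls t) = lcls (LMul s t).
Proof. by apply/lclsP/lc_mul; apply: lrepr_cls. Qed.

Lemma lclsW (P : leavitt_alg -> Prop) : (forall t, P (lcls t)) -> forall x, P x.
Proof. by move=> Pt x; rewrite -[x]lreprK. Qed.

Lemma laddA : associative ladd.
Proof. by do 3!elim/lclsW=> ?; rewrite !laddE; apply/lclsP/lc_addA. Qed.
Lemma laddC : commutative ladd.
Proof. by do 2!elim/lclsW=> ?; rewrite !laddE; apply/lclsP/lc_addC. Qed.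
Lemma ladd0 : left_id (lcls LZero) ladd.
Proof. by elim/lclsW=> ?; rewrite !laddE; apply/lclsP/lc_add0. Qed.
Lemma laddN : left_inverse (lcls LZero) lopp ladd.
Proof. by elim/lclsW=> ?; rewrite loppE laddE; apply/lclsP/lc_addN. Qed.

HB.instance Definition _ :=
  GRing.isZmodule.Build leavitt_alg laddA laddC ladd0 laddN.

Lemma lclsD s t : lcls (LAdd s t) = lcls s + lcls t.
Proof. by rewrite -laddE. Qed.
Lemma lclsN s : lcls (LOpp s) = - lcls s.
Proof. by rewrite -loppE. Qed.
Lemma lcls_sum (I : Type) (r : seq I) (P : pred I) (F : I -> lterm) :
  lcls (\big[LAdd/LZero]_(i <- r | P i) F i) = \sum_(i <- r | P i) lcls (F i).
Proof. by apply: big_morph => // s t; rewrite lclsD. Qed.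

Lemma lscaleA a b x : lscale a (lscale b x) = lscale (a * b) x.
Proof. by elim/lclsW: x => ?; rewrite !lscaleE; apply/lclsP/lc_scaleA. Qed.
Lemma lscale1 : left_id 1 lscale.
Proof. by elim/lclsW=> ?; rewrite !lscaleE; apply/lclsP/lc_scale1. Qed.
Lemma lscaleDr : right_distributive lscale +%R.
Proof.
by move=> a; do 2!elim/lclsW=> ?; rewrite -lclsD !lscaleE -lclsD; apply/lclsP/lc_scaleDr.
Qed.
Lemma lscaleDl x : {morph lscale^~ x : a b / a + b}.
Proof.
by elim/lclsW: x => ? a b; rewrite !lscaleE -lclsD; apply/lclsP/lc_scaleDl.
Qed.

HB.instance Definition _ := GRing.Zmodule_isLmodule.Build k leavitt_alg
  lscaleA lscale1 lscaleDr lscaleDl.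

Lemma lclsZ a s : lcls (LScale a s) = a *: lcls s.
Proof. by rewrite -lscaleE. Qed.

Lemma lmulA : associative lmul.
Proof. by do 3!elim/lclsW=> ?; rewrite !lmulE; apply/lclsP/lc_mulA. Qed.
Lemma lmulDl : left_distributive lmul +%R.
Proof.
by do 3!elim/lclsW=> ?; rewrite -lclsD !lmulE -lclsD; apply/lclsP/lc_mulDl.
Qed.
Lemma lmulDr : right_distributive lmul +%R.
Proof.
by do 3!elim/lclsW=> ?; rewrite -lclsD !lmulE -lclsD; apply/lclsP/lc_mulDr.
Qed.

(* Since E has finitely many vertices, their sum is a unit. *)
Definition lone : leavitt_alg := \sum_(v : vertex E) lcls (LVert v).

Let lmul0l x : lmul 0 x = 0.
Proof. by apply: (addIr (lmul 0 x)); rewrite -lmulDl !add0r. Qed.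
Let lmul0r x : lmul x 0 = 0.
Proof. by apply: (addIr (lmul x 0)); rewrite -lmulDr !add0r. Qed.
Let lmulNl x y : lmul (- x) y = - lmul x y.
Proof. by apply: (addIr (lmul x y)); rewrite -lmulDl !addNr lmul0l. Qed.
Let lmulNr x y : lmul x (- y) = - lmul x y.
Proof. by apply: (addIr (lmul x y)); rewrite -lmulDr !addNr lmul0r. Qed.

Let lmulZl a x y : lmul (lscale a x) y = lscale a (lmul x y).
Proof.
elim/lclsW: x => s; elim/lclsW: y => t; rewrite lscaleE !lmulE lscaleE.
exact/lclsP/lc_sym/lc_scaleAl.
Qed.
Let lmulZr a x y : lmul x (lscale a y) = lscale a (lmul x y).
Proof.
elim/lclsW: x => s; elim/lclsW: y => t; rewrite lscaleE !lmulE lscaleE.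
exact/lclsP/lc_sym/lc_scaleAr.
Qed.

Let lvw v w : lmul (lcls (LVert v)) (lcls (LVert w)) =
  if v == w then lcls (LVert v) else 0.
Proof.
rewrite lmulE; apply/esym; case: eqP => [->|vw]; apply/lclsP/lc_sym.
  exact: lc_vv.
exact: lc_vw.
Qed.

Let lone_vert v : lmul lone (lcls (LVert v)) = lcls (LVert v).
Proof.
rewrite /lone (big_morph (lmul^~ _) (fun x y => lmulDl x y _) (lmul0l _)).
rewrite (bigD1 v) //= lvw eqxx big1 ?addr0 // => w /negPf wv.
by rewrite lvw wv.
Qed.

Let vert_lone v : lmul (lcls (LVert v)) lone = lcls (LVert v).
Proof.
rewrite /lone (big_morph (lmul _) (lmulDr _) (lmul0r _)).
rewrite (bigD1 v) //= lvw eqxx big1 ?addr0 // => w /negPf wv.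
by rewrite lvw eq_sym wv.
Qed.

Lemma lmul1l : left_id lone lmul.
Proof.
elim/lclsW; elim=> [v|e|e||s IHs t IHt|s IHs|a s IHs|s IHs t IHt].
- exact: lone_vert.
- have <- : lmul (lcls (LVert (src e))) (lcls (LEdge e)) = lcls (LEdge e).
    by rewrite lmulE; apply/lclsP/lc_se.
  by rewrite lmulA lone_vert.
- have <- : lmul (lcls (LVert (rng e))) (lcls (LGhost e)) = lcls (LGhost e).
    by rewrite lmulE; apply/lclsP/lc_rg.
  by rewrite lmulA lone_vert.
- exact: lmul0r.
- by rewrite lclsD lmulDr IHs IHt.
- by rewrite lclsN lmulNr IHs.
- by rewrite -lscaleE lmulZr IHs.
- by rewrite -lmulE lmulA IHs.
Qed.

Lemma lmul1r : right_id lone lmul.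
Proof.
elim/lclsW; elim=> [v|e|e||s IHs t IHt|s IHs|a s IHs|s IHs t IHt].
- exact: vert_lone.
- have <- : lmul (lcls (LEdge e)) (lcls (LVert (rng e))) = lcls (LEdge e).
    by rewrite lmulE; apply/lclsP/lc_er.
  by rewrite -lmulA vert_lone.
- have <- : lmul (lcls (LGhost e)) (lcls (LVert (src e))) = lcls (LGhost e).
    by rewrite lmulE; apply/lclsP/lc_gs.
  by rewrite -lmulA vert_lone.
- exact: lmul0l.
- by rewrite lclsD lmulDl IHs IHt.
- by rewrite lclsN lmulNl IHs.
- by rewrite -lscaleE lmulZl IHs.
- by rewrite -lmulE -lmulA IHt.
Qed.

HB.instance Definition _ := GRing.Zmodule_isPzRing.Build leavitt_alg
  lmulA lmul1l lmul1r lmulDl lmulDr.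

Lemma lclsM s t : lcls (LMul s t) = lcls s * lcls t.
Proof. by rewrite -lmulE. Qed.

Lemma leavitt_scaleAl a (x y : leavitt_alg) : a *: (x * y) = (a *: x) * y.
Proof.
elim/lclsW: x => s; elim/lclsW: y => t.
by rewrite -lclsM -!lclsZ -lclsM; apply/lclsP/lc_scaleAl.
Qed.

Lemma leavitt_scaleAr a (x y : leavitt_alg) : a *: (x * y) = x * (a *: y).
Proof.
elim/lclsW: x => s; elim/lclsW: y => t.
by rewrite -lclsM -!lclsZ -lclsM; apply/lclsP/lc_scaleAr.
Qed.

(* Homogeneous terms for deg v = 0, deg e = 1, deg e^* = -1. *)
Inductive lhomog : int -> lterm -> Prop :=
| lh_vert v : lhomog 0 (LVert v)
| lh_edge e : lhomog 1 (LEdge e)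
| lh_ghost e : lhomog (-1) (LGhost e)
| lh_zero n : lhomog n LZero
| lh_add n s t : lhomog n s -> lhomog n t -> lhomog n (LAdd s t)
| lh_opp n s : lhomog n s -> lhomog n (LOpp s)
| lh_scale n a s : lhomog n s -> lhomog n (LScale a s)
| lh_mul m n s t : lhomog m s -> lhomog n t -> lhomog (m + n) (LMul s t).

Definition leavitt_comp (n : int) : set leavitt_alg :=
  [set x | exists2 t, lhomog n t & x = lcls t]%classic.

(* The left regular representation twisted by the degree; it separates the
   homogeneous components. *)
Fixpoint lact (t : lterm) (f : int -> leavitt_alg) (n : int) : leavitt_alg :=
  match t with
  | LVert v => lcls (LVert v) * f n
  | LEdge e => lcls (LEdge e) * f (n - 1)
  | LGhost e => lcls (LGhost e) * f (n + 1)
  | LZero => 0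
  | LAdd s t => lact s f n + lact t f n
  | LOpp s => - lact s f n
  | LScale a s => a *: lact s f n
  | LMul s t => lact s (lact t f) n
  end.

Let lactD t f g n : lact t (fun m => f m + g m) n = lact t f n + lact t g n.
Proof.
elim: t f g n => /= [v|e|e||s IHs t IHt|s IHs|a s IHs|s IHs t IHt] f g n;
  rewrite ?mulrDr ?addr0 //.
- by rewrite IHs IHt addrACA.
- by rewrite IHs opprD.
- by rewrite IHs scalerDr.
- by rewrite -IHs; congr (lact s _ n); apply/funext => m; rewrite IHt.
Qed.

Let lactZ t a f n : lact t (fun m => a *: f m) n = a *: lact t f n.
Proof.
elim: t f n => /= [v|e|e||s IHs t IHt|s IHs|b s IHs|s IHs t IHt] f n;
  rewrite -?leavitt_scaleAr ?scaler0 //.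
- by rewrite IHs IHt scalerDr.
- by rewrite IHs scalerN.
- by rewrite IHs !scalerA mulrC.
- by rewrite -IHs; congr (lact s _ n); apply/funext => m; rewrite IHt.
Qed.

Let lact_sum (I : Type) (r : seq I) (P : pred I) (F : I -> lterm) f n :
  lact (\big[LAdd/LZero]_(i <- r | P i) F i) f n =
  \sum_(i <- r | P i) lact (F i) f n.
Proof. exact: (big_morph (fun t => lact t f n)). Qed.

Lemma lact_congr s t : lcongr s t -> forall f, lact s f = lact t f.
Proof.
elim=> {s t} //=.
- by move=> s t u _ IH1 _ IH2 f; rewrite IH1 IH2.
- by move=> s s' t t' _ IHs _ IHt f; apply/funext => n /=; rewrite IHs IHt.
- by move=> s s' _ IHs f; apply/funext => n /=; rewrite IHs.
- by move=> a s s' _ IHs f; apply/funext => n /=; rewrite IHs.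
- by move=> s s' t t' _ IHs _ IHt f; apply/funext => n /=; rewrite IHs IHt.
- by move=> s t u f; apply/funext => n /=; rewrite addrA.
- by move=> s t f; apply/funext => n /=; rewrite addrC.
- by move=> s f; apply/funext => n /=; rewrite add0r.
- by move=> s f; apply/funext => n /=; rewrite addNr.
- by move=> a b s f; apply/funext => n /=; rewrite scalerA.
- by move=> s f; apply/funext => n /=; rewrite scale1r.
- by move=> a s t f; apply/funext => n /=; rewrite scalerDr.
- by move=> a b s f; apply/funext => n /=; rewrite scalerDl.
- by move=> s t u f; apply/funext => n /=; rewrite lactD.
- by move=> a s t f; apply/funext => n /=; rewrite lactZ.
- by move=> v f; apply/funext => n /=; rewrite mulrA -lclsM ((lclsP _ _).2 (lc_vv v)).
- move=> v w vw f; apply/funext => n /=.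
  by rewrite mulrA -lclsM ((lclsP _ _).2 (lc_vw vw)) mul0r.
- by move=> e f; apply/funext => n /=; rewrite mulrA -lclsM ((lclsP _ _).2 (lc_se e)).
- by move=> e f; apply/funext => n /=; rewrite mulrA -lclsM ((lclsP _ _).2 (lc_er e)).
- by move=> e f; apply/funext => n /=; rewrite mulrA -lclsM ((lclsP _ _).2 (lc_rg e)).
- by move=> e f; apply/funext => n /=; rewrite mulrA -lclsM ((lclsP _ _).2 (lc_gs e)).
- by move=> e f; apply/funext => n /=; rewrite mulrA -lclsM ((lclsP _ _).2 (lc_ck1 e)) addrK.
- move=> e f ef g; apply/funext => n /=.
  by rewrite mulrA -lclsM ((lclsP _ _).2 (lc_ck1' ef)) mul0r.
- move=> v vs f; apply/funext => n /=; rewrite lact_sum ((lclsP _ _).2 (lc_ck2 vs)).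
  rewrite lcls_sum mulr_suml; apply: eq_bigr => e _ /=.
  by rewrite lclsM mulrA subrK.
Qed.

Let lact_homog d t : lhomog d t -> forall f n, lact t f n = lcls t * f (n - d).
Proof.
elim=> {d t} /= [v|e|e|d|d s t _ IHs _ IHt|d s _ IHs|d a s _ IHs|m d s t _ IHs _ IHt] f n.
- by rewrite subr0.
- by [].
- by rewrite opprK.
- by rewrite mul0r.
- by rewrite IHs IHt lclsD mulrDl.
- by rewrite IHs lclsN mulNr.
- by rewrite IHs lclsZ leavitt_scaleAl.
- by rewrite IHs IHt lclsM mulrA opprD addrA.
Qed.

Definition lproj (n : int) (x : leavitt_alg) : leavitt_alg :=
  lact (repr x) (fun m => if m == 0 then 1 else 0) n.

Lemma lproj_cls n t : lproj n (lcls t) = lact t (fun m => if m == 0 then 1 else 0) n.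
Proof. by rewrite /lproj (lact_congr (lrepr_cls t)). Qed.

Lemma lprojD n x y : lproj n (x + y) = lproj n x + lproj n y.
Proof. by elim/lclsW: x => s; elim/lclsW: y => t; rewrite -lclsD !lproj_cls. Qed.

Lemma lproj0 n : lproj n 0 = 0.
Proof. exact: lproj_cls. Qed.

Lemma lproj_comp m n x : leavitt_comp m x -> lproj n x = if n == m then x else 0.
Proof.
move=> [t th ->]; rewrite lproj_cls (lact_homog th) subr_eq0.
by case: eqP; rewrite ?mulr1 ?mulr0.
Qed.

Lemma leavitt_mul m n x y :
  leavitt_comp m x -> leavitt_comp n y -> leavitt_comp (m + n) (x * y).
Proof.
move=> [s sh ->] [t th ->]; exists (LMul s t); first exact: lh_mul.
by rewrite lclsM.
Qed.

Lemma leavitt_grading : is_grading leavitt_comp.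
Proof.
have C0 n : leavitt_comp n 0 by exists LZero => //; apply: lh_zero.
have CN n x : leavitt_comp n x -> leavitt_comp n (- x).
  by move=> [s sh ->]; exists (LOpp s); [apply: lh_opp|rewrite lclsN].
have CD n x y : leavitt_comp n x -> leavitt_comp n y -> leavitt_comp n (x + y).
  move=> [s sh ->] [t th ->].
  by exists (LAdd s t); [apply: lh_add|rewrite lclsD].
have CZ n a x : leavitt_comp n x -> leavitt_comp n (a *: x).
  by move=> [s sh ->]; exists (LScale a s); [apply: lh_scale|rewrite lclsZ].
split=> [n|n x y Cx Cy|x|s c us cC s0 n ns].
- exact: C0.
- by apply: CD => //; apply: CN.
- have sumP (y : leavitt_alg) : (exists2 r : seq leavitt_alg,
      (forall z, z \in r -> exists n, leavitt_comp n z) & y = \sum_(z <- r) z) ->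
    exists s : seq int, exists2 c : int -> leavitt_alg,
      forall n, leavitt_comp n (c n) & y = \sum_(n <- s) c n.
    move=> [r rC ->].
    have [d dE] : {d : leavitt_alg -> int |
        forall z, z \in r -> leavitt_comp (d z) z}.
      have /choice [d dE] : forall z, exists n, z \in r -> leavitt_comp n z.
        move=> z; case zr: (z \in r); last by exists 0.
        by have [n] := rC z zr; exists n.
      by exists d.
    exists (undup (map d r)); exists (fun n => \sum_(z <- r | d z == n) z) => [n|].
      rewrite big_seq_cond; apply: (big_ind (leavitt_comp n)) => // [|z].
        exact: CD.
      by move=> /andP[/dE zC /eqP <-].
    rewrite (exchange_big_dep xpredT) //= !big_seq; apply: eq_bigr => z zr.
    have dz : d z \in undup (map d r) by rewrite mem_undup map_f.
    rewrite big_mkcond (bigD1_seq (d z)) ?undup_uniq //= eqxx big1 ?addr0 // => n.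
    by rewrite eq_sym => /negPf ->.
  apply: sumP; elim/lclsW: x.
  have gen n t : lhomog n t -> exists2 r : seq leavitt_alg,
      (forall z, z \in r -> exists n, leavitt_comp n z) & lcls t = \sum_(z <- r) z.
    move=> th; exists [:: lcls t]; rewrite ?big_seq1 // => z.
    by rewrite inE => /eqP ->; exists n; exists t.
  elim=> [v|e|e||s [r rC IHs] t [q qC IHt]|s [r rC IHs]|a s [r rC IHs]|s [r rC IHs] t [q qC IHt]].
  + exact/gen/lh_vert.
  + exact/gen/lh_edge.
  + exact/gen/lh_ghost.
  + exact/(gen 0)/lh_zero.
  + exists (r ++ q); last by rewrite big_cat lclsD IHs IHt.
    by move=> z; rewrite mem_cat => /orP[/rC|/qC].
  + exists [seq - z | z <- r]; last by rewrite lclsN IHs big_map sumrN.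
    by move=> z /mapP [y /rC [n yC] ->]; exists n; apply: CN.
  + exists [seq a *: z | z <- r]; last by rewrite lclsZ IHs big_map scaler_sumr.
    by move=> z /mapP [y /rC [n yC] ->]; exists n; apply: CZ.
  + exists [seq y * z | y <- r, z <- q].
      move=> z /allpairsP [[y z'] /= [/rC [m yC] /qC [n zC] ->]].
      by exists (m + n); apply: leavitt_mul.
    rewrite lclsM IHs IHt big_flatten /= big_map mulr_suml.
    by apply: eq_bigr => y _; rewrite big_map mulr_sumr.
- have := lproj0 n; rewrite -s0 (big_morph _ (lprojD n) (lproj0 n)).
  rewrite (bigD1_seq n) //= (lproj_comp n (cC n)) eqxx big1 ?addr0 // => m mn.
  by rewrite (lproj_comp n (cC m)) eq_sym (negPf mn).
Qed.

Lemma leavitt_one : leavitt_comp 0 1.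
Proof.
exists (\big[LAdd/LZero]_(v : vertex E) LVert v); last by rewrite lcls_sum.
apply: (big_ind (lhomog 0)) => [|s t|v _]; [exact: lh_zero|exact: lh_add|exact: lh_vert].
Qed.

Definition leavitt : grRing := GrRing leavitt_grading leavitt_one leavitt_mul.

End Leavitt.

(* Main.v *)
From HB Require Import structures.
Require Import Defs.
From mathcomp Require Import all_boot all_order all_algebra.
From mathcomp Require Import boolp classical_sets.
From mathcomp Require Import finmap zify.

(* A graded isomorphism transports graded modules by restriction of scalars, hence
   gives (2). Conversely, over a graph without sinks every finitely generated
   graded projective module is a finite direct sum of shifts of the modules vL:
   cutting the entries of an idempotent matrix with long paths leaves scalar
   multiples of vertices, so that it can be split over k. The multiplicities are
   unique up to the action of powers of the adjacency matrix A_E on row vectors.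
   Therefore a pointed order-preserving isomorphism yields a shift equivalence of
   A_E and A_F that respects the vector u = (1, ..., 1).

   Among the 34 small graphs, the divisibility of u q(A) and q(A) by 2, 3 and 5
   (up to powers of A) and the parity of the traces of powers separate all pairs
   except (E^1_5, E^1_16), (E^1_7, E^1_17), (E^2_4, E^2_3) and (E^1_12, E^1_8).
   For these four pairs there are mutually inverse graded homomorphisms that send
   vertices and edges to sums of monomials mu nu^*, and checking them is a finite
   computation. *)

Set Implicit Arguments.
Unset Strict Implicit.
Unset Printing Implicit Defensive.

Import Order.TTheory GRing.Theory Num.Theory.
Local Open Scope ring_scope.

(** * Restriction of scalars along a graded isomorphism *)

(** What shapes the proof is the way back from K0 to the algebras: no general passage from shift
    equivalence to graded isomorphism is used. Each ordered pair of matrices is settled separately,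
    by an invariant that excludes (2) or by explicit maps that give (1). The maps are sums of
    monomials with coefficient 1, so one computation on lists serves every field.

    Powers of A_E enter because (CK2) decomposes vL into the modules r(e)L(-1), one for each edge e
    leaving v: a multiplicity vector c in degree N becomes c A_E in degree N + 1, and A_E may be
    singular. Equality in K0 allows an extra summand on both sides; it disappears because integer
    vectors cancel. Positivity makes the image of [vL] the class of an actual module, hence a row
    vector of multiplicities. These rows form the matrices D and D' of the shift equivalence. Since
    D and D' intertwine A_E and A_F, they carry divisibility up to powers from one side to the
    other; since D D' and D' D are powers, traces of high powers agree. *)

Definition grlinear (R : grRing) (M N : grModule R) (f : M -> N) (fL : linear f) :
  {linear M -> N} := HB.pack f (GRing.isLinear.Build _ _ _ _ f fL).

(** An alias of [M] that records [g], so that the S-module structure on the same group can be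
    inferred without meeting the R-module structure. *)
Definition restr_mod (R S : grRing) (g : {rmorphism S -> R}) (M : lmodType R^c) :
  Type := M.

Section RestrictScalars.
Variables (R S : grRing) (g : {rmorphism S -> R}) (M : lmodType R^c).

HB.instance Definition _ := GRing.Zmodule.on (restr_mod g M).

Let scale (s : S^c) (x : restr_mod g M) : restr_mod g M := (g s : R^c) *: (x : M).

Let scaleA s t x : scale s (scale t x) = scale (s * t) x.
Proof. by rewrite /scale scalerA; congr (_ *: _); rewrite [RHS]rmorphM. Qed.
Let scale1 : left_id 1 scale.
Proof. by move=> x; rewrite /scale [g _]rmorph1 scale1r. Qed.
Let scaleDr : right_distributive scale +%R.
Proof. by move=> s x y; rewrite /scale scalerDr. Qed.
Let scaleDl x : {morph scale^~ x : s t / s + t}.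
Proof. by move=> s t; rewrite /scale [g _]rmorphD scalerDl. Qed.

HB.instance Definition _ := GRing.Zmodule_isLmodule.Build S^c (restr_mod g M)
  scaleA scale1 scaleDr scaleDl.

Lemma restr_scaleE (s : S) (x : M) :
  (s : S^c) *: (x : restr_mod g M) = ((g s : R^c) *: x : M).
Proof. by []. Qed.

End RestrictScalars.

Section RestrictGraded.
Variables (R S : grRing) (g : {rmorphism S -> R}).
Hypothesis gC : forall n x, gr_comp S n x -> gr_comp R n (g x).

Lemma restr_grscale (M : grModule R) m n (x : restr_mod g M) (s : S) :
  gm_comp M m x -> gr_comp S n s -> gm_comp M (m + n) ((s : S^c) *: x).
Proof. by move=> xC /gC sC; apply: gm_scale. Qed.

Definition restr (M : grModule R) : grModule S :=
  @GrModule S (restr_mod g M) (gm_comp M) (gm_grading M) (@restr_grscale M).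

Lemma restr_linear (M N : grModule R) (f : {linear M -> N}) :
  {h : {linear restr M -> restr N} | h =1 f}.
Proof.
have hlin : linear (f : restr M -> restr N).
  by move=> s x y; rewrite [LHS](linearP f).
by exists (grlinear hlin).
Qed.

Lemma restr_iso (M N : grModule R) :
  graded_iso M N -> graded_iso (restr M) (restr N).
Proof.
move=> /graded_isoE [f [f' [fK f'K fC f'C]]]; have [h hE] := restr_linear f.
apply: (@graded_isoP _ _ _ h f') => [x|x|n x|//].
- by rewrite hE fK.
- by rewrite hE f'K.
- by rewrite hE; apply: fC.
Qed.

Lemma restr_sum (M N : grModule R) :
  graded_iso (restr (gsum M N)) (gsum (restr M) (restr N)).
Proof.
pose j (p : restr (gsum M N)) : gsum (restr M) (restr N) := p.
have jlin : linear j by [].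
exact: (@graded_isoP _ _ _ (grlinear jlin) id).
Qed.

Lemma restr_shift (M : grModule R) n :
  graded_iso (restr (gshift M n)) (gshift (restr M) n).
Proof.
pose j (p : restr (gshift M n)) : gshift (restr M) n := p.
have jlin : linear j by [].
exact: (@graded_isoP _ _ _ (grlinear jlin) id).
Qed.

Variable h : {rmorphism R -> S}.
Hypotheses (hC : forall n x, gr_comp R n x -> gr_comp S n (h x)).
Hypotheses (gK : cancel g h) (hK : cancel h g).

Lemma restr_fg (M : grModule R) : finitely_generated M -> finitely_generated (restr M).
Proof.
move=> [s sM]; exists s => x; have [c cE] := sM x; exists (fun i => h (c i)).
rewrite [LHS]cE; apply: eq_bigr => i _.
by rewrite restr_scaleE hK.
Qed.

Lemma restr_reg : graded_iso (restr (greg R)) (greg S).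
Proof.
pose j (x : restr (greg R)) : greg S := h x.
have jlin : linear j.
  move=> s x y; rewrite /j restr_scaleE [h _]rmorphD; congr (_ + _).
  by rewrite [LHS]rmorphM /= gK.
apply: (@graded_isoP _ _ _ (grlinear jlin) g) => //.
Qed.
End RestrictGraded.

Section RestrictInverse.
Variables (R S : grRing) (g : {rmorphism S -> R}) (h : {rmorphism R -> S}).
Hypothesis gC : forall n x, gr_comp S n x -> gr_comp R n (g x).
Hypothesis hC : forall n x, gr_comp R n x -> gr_comp S n (h x).
Hypotheses (gK : cancel g h) (hK : cancel h g).

(** A lifting problem over S becomes one over R by restricting [A] and [B] along [h]; the lift found
    there is S-linear because [g] and [h] are inverse. *)
Lemma restr_projective (M : grModule R) :
  graded_projective M -> graded_projective (restr gC M).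
Proof.
move=> pM A B a f aC fC asurj.
have [a' a'E] := restr_linear hC a.
pose f1 (x : M) : restr hC B := f x.
have f1lin : linear f1.
  by move=> r x y; rewrite /f1 -{1}[r]hK [LHS](linearP f).
have [||| u uC uE] := pM _ _ a' (grlinear f1lin).
- by move=> n x; rewrite a'E; apply: aC.
- by move=> n x; apply: fC.
- by move=> b; have [x <-] := asurj b; exists x; rewrite a'E.
pose u1 (x : restr gC M) : A := u x.
have u1lin : linear u1.
  by move=> s x y; rewrite /u1 [LHS](linearP u) restr_scaleE gK.
exists (grlinear u1lin) => [n x|x].
  exact: uC.
by rewrite -a'E; apply: uE.
Qed.

Lemma restr_restr (M : grModule R) : graded_iso (restr hC (restr gC M)) M.
Proof.
pose j (x : restr hC (restr gC M)) : M := x.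
have jlin : linear j.
  by move=> r x y; rewrite /j !restr_scaleE hK.
exact: (@graded_isoP _ _ _ (grlinear jlin) id).
Qed.

Definition fp_restr (P : fgProjective R) : fgProjective S :=
  FgProjective (restr_fg gC hK (fp_fg P)) (restr_projective (@fp_projective _ P)).

(** [gc_map] stays within one completion, so this map between two completions is again defined on
    chosen representatives; [K0_restrE] shows that the choice is immaterial. *)
Definition K0_restr (a : K0gr R) : K0gr S :=
  @gc_class (fgProjective S) (fun P Q => graded_iso P Q) (@fp_sum S)
    (fp_restr (gc_repr a).1, fp_restr (gc_repr a).2).

Local Notation gcR := (@gc_class (fgProjective R) (fun P Q => graded_iso P Q) (@fp_sum R)).
Local Notation gcS := (@gc_class (fgProjective S) (fun P Q => graded_iso P Q) (@fp_sum S)).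

Lemma K0_restrE p : K0_restr (gcR p) = gcS (fp_restr p.1, fp_restr p.2).
Proof.
apply/(gc_classP (K0_congruence S)).
have [T pT] := gc_repr_class (K0_congruence R) p; exists (fp_restr T).
have sumE P Q U : graded_iso (restr gC (fp_sum (fp_sum P Q) U))
    (fp_sum (fp_sum (fp_restr P) (fp_restr Q)) (fp_restr U)).
  apply: graded_iso_trans (restr_sum gC _ _) _.
  by apply: graded_iso_sum; [apply: restr_sum|apply: graded_iso_refl].
apply: graded_iso_trans (graded_iso_sym (sumE _ _ _)) _.
by apply: graded_iso_trans (sumE _ _ _); apply: restr_iso.
Qed.
End RestrictInverse.

Section K0Restrict.
Variables (R S : grRing) (g : {rmorphism S -> R}) (h : {rmorphism R -> S}).
Hypothesis gC : forall n x, gr_comp S n x -> gr_comp R n (g x).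
Hypothesis hC : forall n x, gr_comp R n x -> gr_comp S n (h x).
Hypotheses (gK : cancel g h) (hK : cancel h g).
Local Notation F := (fp_restr gC hC gK hK).
Local Notation phi := (K0_restr gC hC gK hK).
Local Notation gcR := (@gc_class (fgProjective R) (fun P Q => graded_iso P Q) (@fp_sum R)).
Local Notation gcS := (@gc_class (fgProjective S) (fun P Q => graded_iso P Q) (@fp_sum S)).

Lemma K0_eq_iso T (p q : fgProjective T * fgProjective T) :
  graded_iso p.1 q.1 -> graded_iso p.2 q.2 ->
  gc_class (fun P Q : fgProjective T => graded_iso P Q) (@fp_sum T) p =
  gc_class (fun P Q : fgProjective T => graded_iso P Q) (@fp_sum T) q.
Proof.
move=> pq1 pq2; apply/(gc_classP (K0_congruence T)); exists (fp_zero T).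
apply: graded_iso_sum (graded_iso_refl _); apply: graded_iso_sum => //.
exact: graded_iso_sym.
Qed.

Lemma K0_ind T (P : K0gr T -> Prop) :
  (forall p, P (gc_class (fun P Q : fgProjective T => graded_iso P Q) (@fp_sum T) p)) ->
  forall a, P a.
Proof. by move=> Pp a; rewrite -[a]gc_reprK. Qed.

Lemma K0_restrD a b : phi (K0_add a b) = K0_add (phi a) (phi b).
Proof.
elim/K0_ind: a => p; elim/K0_ind: b => q.
rewrite /K0_add (gc_addE (K0_congruence R)) !K0_restrE (gc_addE (K0_congruence S)).
by apply: K0_eq_iso; apply: restr_sum.
Qed.
End K0Restrict.

(** * Additive maps between graded Grothendieck groups *)

Section AdditiveK0.
Variables (R S : grRing) (phi : K0gr R -> K0gr S).
Hypothesis phiD : forall a b, phi (K0_add a b) = K0_add (phi a) (phi b).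

Lemma K0_addI T (a b c : K0gr T) : K0_add a b = K0_add a c -> b = c.
Proof.
move=> /(congr1 (K0_add (K0_opp a))).
by rewrite !K0_addA K0_addN !K0_add0.
Qed.

Lemma additive_K0_zero : phi (K0_zero R) = K0_zero S.
Proof.
apply: (@K0_addI _ (phi (K0_zero R))); rewrite -phiD.
by rewrite K0_add0 K0_addC K0_add0.
Qed.

Lemma additive_K0_opp a : phi (K0_opp a) = K0_opp (phi a).
Proof.
apply: (@K0_addI _ (phi a)); rewrite -phiD ![K0_add _ (K0_opp _)]K0_addC !K0_addN.
exact: additive_K0_zero.
Qed.

Lemma additive_K0_intmul m a : phi (K0_intmul m a) = K0_intmul m (phi a).
Proof.
have it i : phi (iter i (K0_add a) (K0_zero R)) =
            iter i (K0_add (phi a)) (K0_zero S).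
  by elim: i => [|i IH]; rewrite ?additive_K0_zero // !iterS phiD IH.
by case: m => i; rewrite /K0_intmul ?additive_K0_opp it.
Qed.

Lemma additive_K0_linear :
  (forall n a, phi (K0_shift n a) = K0_shift n (phi a)) -> K0_linear phi.
Proof.
move=> phiS; split=> // p a; rewrite /K0_act.
rewrite (big_morph phi phiD additive_K0_zero).
by apply: eq_bigr => n _; rewrite additive_K0_intmul phiS.
Qed.

(** The shift by n is the action of the monomial x^n, so this is a special case of linearity over
    Laurent polynomials. *)
Lemma K0_linear_shift : K0_linear phi ->
  forall n a, phi (K0_shift n a) = K0_shift n (phi a).
Proof.
move=> [_ phiA] n a.
have mono T (b : K0gr T) :
    K0_act [fsfun x in [fset n]%fset => 1 | 0] b = K0_shift n b.
  rewrite /K0_act.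
  have -> : finsupp ([fsfun x in [fset n]%fset => 1 | 0] : laurent) = [fset n]%fset.
    apply/fsetP => i; rewrite mem_finsupp fsfunE !inE.
    by case: (i == n).
  have -> : enum_fset [fset n]%fset = [:: n].
    by apply: perm_small_eq => //; apply: uniq_perm => // i; rewrite !inE.
  by rewrite big_cons big_nil fsfunE inE eqxx /= ![K0_add _ (K0_zero T)]K0_addC !K0_add0.
by rewrite -!mono phiA.
Qed.
End AdditiveK0.

Section GradedIsoK0.
Variables (R S : grRing).

Lemma graded_isomorphicE : graded_isomorphic R S ->
  exists (f : {rmorphism R -> S}) (g : {rmorphism S -> R}),
    [/\ cancel f g, cancel g f,
        forall n x, gr_comp R n x -> gr_comp S n (f x)
      & forall n y, gr_comp S n y -> gr_comp R n (g y)].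
Proof.
move=> [f [[g fK gK] fC]].
have gB : zmod_morphism g.
  by move=> x y; apply: (can_inj fK); rewrite rmorphB !gK.
have gM : monoid_morphism g.
  split=> [|x y]; apply: (can_inj fK); first by rewrite gK rmorph1.
  by rewrite rmorphM !gK.
pose gL : {rmorphism S -> R} := HB.pack g (GRing.isZmodMorphism.Build _ _ g gB)
  (GRing.isMonoidMorphism.Build _ _ g gM).
exists f, gL; split=> // n x; first by rewrite -fC => Cx; exists x.
by rewrite -fC => -[y Cy <-] /=; rewrite fK.
Qed.

Lemma graded_isomorphicP (f : {rmorphism R -> S}) (g : S -> R) :
  cancel f g -> cancel g f ->
  (forall n x, gr_comp R n x -> gr_comp S n (f x)) ->
  (forall n y, gr_comp S n y -> gr_comp R n (g y)) -> graded_isomorphic R S.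
Proof.
move=> fK gK fC gC; exists f; split; first by exists g.
move=> n; apply/seteqP; split=> [_ [x Cx <-]|y Cy]; first exact: fC.
by exists (g y); [apply: gC|apply: gK].
Qed.

(** Modules over R are restricted along the inverse of the given isomorphism. Restriction respects
    sums, shifts and regular modules, and restricting back gives an isomorphic module. *)
Lemma graded_isomorphic_K0 : graded_isomorphic R S ->
  exists phi : K0gr R -> K0gr S,
    [/\ bijective phi, K0_linear phi, K0_order_preserving phi
      & K0_pointed phi].
Proof.
move=> /graded_isomorphicE [h [g [hK gK hC gC]]].
have classE P : K0_restr gC hC gK hK (K0_class P) = K0_class (fp_restr gC hC gK hK P).
  rewrite /K0_class /gc_in K0_restrE; apply: K0_eq_iso => /=.
    exact: graded_iso_refl.
  apply: (@graded_isoP _ _ _ \0 \0) => // x.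
    exact: (etrans (thinmx0 _) (esym (thinmx0 (x : 'rV_0)))).
  exact: (etrans (thinmx0 _) (esym (thinmx0 (x : 'rV_0)))).
exists (K0_restr gC hC gK hK); split.
- exists (K0_restr hC gC hK gK); elim/K0_ind => -[P Q]; rewrite !K0_restrE /=;
    by apply: K0_eq_iso; apply: restr_restr.
- apply: additive_K0_linear => [a b|n a]; first exact: K0_restrD.
  have shiftE T (p : fgProjective T * fgProjective T) :
      K0_shift n (gc_class (fun P Q : fgProjective T => graded_iso P Q) (@fp_sum T) p) =
      gc_class (fun P Q : fgProjective T => graded_iso P Q) (@fp_sum T)
        (fp_shift n p.1, fp_shift n p.2).
    rewrite /K0_shift (gc_mapE (K0_congruence T)) // => P Q.
      exact: graded_iso_shift.
    exact: (@graded_isoP _ _ _ idfun idfun).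
  elim/K0_ind: a => p; rewrite shiftE !K0_restrE shiftE.
  by apply: K0_eq_iso; apply: restr_shift.
- move=> b; split=> [[P ->]|[a [P ->] <-]]; last by rewrite classE; eexists.
  exists (K0_class (fp_restr hC gC hK gK P)); first by eexists.
  rewrite classE; apply: K0_eq_iso => /=; last exact: graded_iso_refl.
  exact: restr_restr.
- rewrite /K0_pointed classE; apply: K0_eq_iso => /=; last exact: graded_iso_refl.
  exact: (restr_reg gC hC gK hK).
Qed.
End GradedIsoK0.

(** * Path actions *)

Section LeavittGenerators.
Variables (k : fieldType) (E : graph).
Local Notation L := (leavitt_alg k E).
Implicit Types (v w : vertex E) (e f : edge E).

Definition lv v : L := lcls (LVert k v).
Definition le e : L := lcls (LEdge k e).
Definition lg e : L := lcls (LGhost k e).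

Lemma lvM v w : lv v * lv w = if v == w then lv v else 0.
Proof.
rewrite -lclsM; case: eqP => [<-|vw]; apply/lclsP; [exact: lc_vv|exact: lc_vw].
Qed.

Lemma sum_lv : \sum_v lv v = 1. Proof. by []. Qed.

Lemma lv_le v e : lv v * le e = if v == src e then le e else 0.
Proof.
have H : lv (src e) * le e = le e by rewrite -lclsM; apply/lclsP/lc_se.
by rewrite -H mulrA lvM; case: eqP => [->|_]; rewrite ?mul0r.
Qed.

Lemma le_lv v e : le e * lv v = if rng e == v then le e else 0.
Proof.
have H : le e * lv (rng e) = le e by rewrite -lclsM; apply/lclsP/lc_er.
by rewrite -H -mulrA lvM; case: eqP => [->|_]; rewrite ?mulr0.
Qed.

Lemma lv_lg v e : lv v * lg e = if v == rng e then lg e else 0.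
Proof.
have H : lv (rng e) * lg e = lg e by rewrite -lclsM; apply/lclsP/lc_rg.
by rewrite -H mulrA lvM; case: eqP => [->|_]; rewrite ?mul0r.
Qed.

Lemma lg_lv v e : lg e * lv v = if src e == v then lg e else 0.
Proof.
have H : lg e * lv (src e) = lg e by rewrite -lclsM; apply/lclsP/lc_gs.
by rewrite -H -mulrA lvM; case: eqP => [->|_]; rewrite ?mulr0.
Qed.

Lemma lg_le e f : lg e * le f = if e == f then lv (rng e) else 0.
Proof.
rewrite -lclsM; case: eqP => [<-|ef]; apply/lclsP; [exact: lc_ck1|exact: lc_ck1'].
Qed.

Lemma le_lg v : ~~ is_sink v -> \sum_(e | src e == v) le e * lg e = lv v.
Proof.
move=> /(lc_ck2 k) vs; rewrite /lv ((lclsP _ _).2 vs) lcls_sum.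
by apply: eq_bigr => e _; rewrite lclsM.
Qed.

Lemma lv_deg v : leavitt_comp 0 (lv v).
Proof. by exists (LVert k v) => //; apply: lh_vert. Qed.
Lemma le_deg e : leavitt_comp 1 (le e).
Proof. by exists (LEdge k e) => //; apply: lh_edge. Qed.
Lemma lg_deg e : leavitt_comp (-1) (lg e).
Proof. by exists (LGhost k e) => //; apply: lh_ghost. Qed.

(** Arbitrary sequences of edges are allowed: one that is not a path gives 0. Sums over the paths of
    length n can then run over all n-tuples. *)
Fixpoint ep (s : seq (edge E)) : L := if s is e :: s' then le e * ep s' else 1.
Fixpoint gp (s : seq (edge E)) : L := if s is e :: s' then gp s' * lg e else 1.

Lemma ep_deg s : leavitt_comp (size s)%:Z (ep s).
Proof.
elim: s => [|e s IH] /=; first exact: leavitt_one.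
by rewrite -add1n PoszD; apply: leavitt_mul => //; apply: le_deg.
Qed.

Lemma gp_deg s : leavitt_comp (- (size s)%:Z) (gp s).
Proof.
elim: s => [|e s IH] /=; first exact: leavitt_one.
by rewrite -addn1 PoszD opprD; apply: leavitt_mul => //; apply: lg_deg.
Qed.

(* In each homogeneous component, cutting an element with sufficiently long
   paths leaves scalar multiples of vertices. *)
Definition vdiag (x : L) :=
  forall v w, exists c : k, lv v * x * lv w = if v == w then c *: lv v else 0.

Lemma vdiag_lv u : vdiag (lv u).
Proof.
move=> v w; exists (if v == u then 1 else 0); rewrite lvM.
case: (v =P u) => [->|_]; first by rewrite lvM scale1r.
by rewrite mul0r scale0r if_same.
Qed.

Lemma vdiagD x y : vdiag x -> vdiag y -> vdiag (x + y).
Proof.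
move=> vx vy v w; have [c xE] := vx v w; have [d yE] := vy v w.
exists (c + d); rewrite mulrDr mulrDl xE yE; case: (v == w); rewrite ?addr0 //.
by rewrite scalerDl.
Qed.

Lemma vdiagZ a x : vdiag x -> vdiag (a *: x).
Proof.
move=> vx v w; have [c xE] := vx v w; exists (a * c).
rewrite -leavitt_scaleAr -leavitt_scaleAl xE; case: (v == w); rewrite ?scaler0 //.
by rewrite scalerA.
Qed.

Lemma vdiag0 : vdiag 0.
Proof. by move=> v w; exists 0; rewrite scale0r mulr0 mul0r if_same. Qed.

Lemma vdiagN x : vdiag x -> vdiag (- x).
Proof. by rewrite -scaleN1r; apply: vdiagZ. Qed.

Lemma vdiag_sum (I : Type) (r : seq I) (P : pred I) (F : I -> L) :
  (forall i, P i -> vdiag (F i)) -> vdiag (\sum_(i <- r | P i) F i).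
Proof. by move=> FP; apply: big_ind => //; [apply: vdiag0|apply: vdiagD]. Qed.

Lemma vdiagM x y : vdiag x -> vdiag y -> vdiag (x * y).
Proof.
move=> vx vy v w.
have [c xE] := vx v v; have [d yE] := vy v w; exists (c * d).
have -> : x * y = \sum_u x * lv u * (lv u * y).
  rewrite -[x in LHS]mulr1 -sum_lv mulr_sumr mulr_suml; apply: eq_bigr => u _.
  by rewrite mulrA -(mulrA x (lv u) (lv u)) lvM eqxx.
rewrite mulr_sumr mulr_suml (bigD1 v) //= big1 ?addr0 => [|u uv].
  rewrite !mulrA xE eqxx -mulrA -mulrA [lv v * _]mulrA yE -leavitt_scaleAl.
  case: (v == w); last by rewrite mulr0 scaler0.
  by rewrite -leavitt_scaleAr lvM eqxx scalerA.
rewrite !mulrA; have [b ->] := vx v u.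
by rewrite eq_sym (negPf uv) !mul0r.
Qed.

(** Equal lengths let every ghost edge meet an edge: the innermost pair around [u] is 0 or, by
    (CK1), a vertex that takes the place of [u]. *)
Lemma gp_lv_ep s t u : size s = size t ->
  gp s * lv u * ep t = 0 \/ exists v, gp s * lv u * ep t = lv v.
Proof.
elim: s t u => [|e s IH] [|f t] u //= => [_|[st]].
  by right; exists u; rewrite mul1r mulr1.
have -> : gp s * lg e * lv u * (le f * ep t) = gp s * (lg e * lv u * le f) * ep t.
  by rewrite !mulrA.
rewrite lg_lv; case: eqP => [_|_]; last by left; rewrite mul0r mulr0 mul0r.
rewrite lg_le; case: eqP => [_|_]; last by left; rewrite mulr0 mul0r.
exact: IH.
Qed.

Lemma vdiag_gp_lv_ep s t u : size s = size t -> vdiag (gp s * lv u * ep t).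
Proof.
by case/(gp_lv_ep u) => [->|[v ->]]; [apply: vdiag0|apply: vdiag_lv].
Qed.

Lemma vdiag_gp_ep s t : size s = size t -> vdiag (gp s * ep t).
Proof.
move=> st; rewrite -[gp s]mulr1 -sum_lv mulr_sumr mulr_suml.
by apply: vdiag_sum => u _; apply: vdiag_gp_lv_ep.
Qed.

(** Ghost paths of length [a] on the left and paths of length [b] on the right bring a homogeneous
    [x] of degree a - b to degree 0. *)
Definition scalar_at a b (x : L) := forall s t,
  size s = a -> size t = b -> vdiag (gp s * x * ep t).

Hypothesis noSink : forall v, ~~ is_sink v.

Lemma sum_le_lg : \sum_e le e * lg e = 1.
Proof.
rewrite -sum_lv (partition_big (@src E) xpredT) //=.
by apply: eq_bigr => v _; rewrite le_lg.
Qed.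

(** (CK2) iterated: without sinks every path can be prolonged, so 1 is the sum of all mu mu^* over
    the paths mu of length n. *)
Lemma sum_ep_gp n : \sum_(s : n.-tuple (edge E)) ep s * gp s = 1.
Proof.
elim: n => [|n IH].
  rewrite (eq_bigr (fun=> 1)) => [|s _]; last by rewrite tuple0 /= mulr1.
  by rewrite sumr_const card_tuple expn0.
pose h (p : edge E * n.-tuple (edge E)) : n.+1.-tuple (edge E) := [tuple of p.1 :: p.2].
rewrite (reindex h) /=; last first.
  exists (fun s => (thead s, [tuple of behead s])) => [[e s] _|s _] /=.
    by congr (_, _); apply: val_inj.
  by rewrite /h /= -tuple_eta.
rewrite -(pair_big xpredT xpredT (fun e (s : n.-tuple (edge E)) => ep (e :: s) * gp (e :: s))) /= -sum_le_lg.
apply: eq_bigr => e _; rewrite -[le e in RHS]mulr1 -IH mulr_sumr mulr_suml.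
by apply: eq_bigr => s _; rewrite !mulrA.
Qed.

Lemma scalar_atM a b c x y :
  scalar_at a c x -> scalar_at c b y -> scalar_at a b (x * y).
Proof.
move=> xS yS s t sa tb.
have -> : gp s * (x * y) * ep t =
    \sum_(u : c.-tuple (edge E)) (gp s * x * ep u) * (gp u * y * ep t).
  rewrite -[x in LHS]mulr1 -(sum_ep_gp c) mulr_sumr !(mulr_suml, mulr_sumr).
  by apply: eq_bigr => u _; rewrite !mulrA.
apply: vdiag_sum => u _.
by apply: vdiagM; [apply: xS|apply: yS]; rewrite ?size_tuple.
Qed.

Lemma lhomog_scalar d t : lhomog d t -> exists N : nat, forall a b : nat,
  (N <= a)%N -> (N <= b)%N -> a%:Z = b%:Z + d -> scalar_at a b (lcls t).
Proof.
elim=> {d t} [v|e|e|d|d s t _ [N IHs] _ [M IHt]|d s _ [N IHs]|d c s _ [N IHs]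
  |m d s t _ [N IHs] _ [M IHt]].
- exists 0%N => a b _ _; rewrite addr0 => -[->] s t sa tb.
  by apply: vdiag_gp_lv_ep; rewrite sa.
- exists 0%N => a b _ _ ab s t sa tb; rewrite -mulrA.
  have -> : lcls (LEdge k e) * ep t = ep (e :: t) by [].
  by apply: vdiag_gp_ep; rewrite /= sa tb; lia.
- exists 0%N => a b _ _ ab s t sa tb.
  have -> : gp s * lcls (LGhost k e) = gp (e :: s) by [].
  by apply: vdiag_gp_ep; rewrite /= sa tb; lia.
- by exists 0%N => a b _ _ _ s t _ _; rewrite mulr0 mul0r; apply: vdiag0.
- exists (maxn N M) => a b; rewrite !geq_max => /andP[Na Ma] /andP[Nb Mb] ab u w ua wb.
  rewrite lclsD mulrDr mulrDl.
  by apply: vdiagD; [apply: (IHs a b)|apply: (IHt a b)].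
- exists N => a b Na Nb ab u w ua wb; rewrite lclsN mulrN mulNr.
  by apply: vdiagN; apply: (IHs a b).
- exists N => a b Na Nb ab u w ua wb; rewrite lclsZ -leavitt_scaleAr -leavitt_scaleAl.
  by apply: vdiagZ; apply: (IHs a b).
- exists (N + M + `|m| + `|d|)%N => a b Na Nb ab; rewrite lclsM.
  (* The paths inserted between the two factors have length c = b + d, as the degree of [t]
     dictates; the summand |d| of the bound keeps c above [N] and [M]. *)
  have [c cE] : exists c : nat, c%:Z = b%:Z + d by exists `|(b%:Z + d)%R|%N; lia.
  by apply: (@scalar_atM _ _ c); [apply: IHs|apply: IHt]; lia.
Qed.

Lemma comp0_scalar x : leavitt_comp 0 x -> exists N : nat, forall n,
  (N <= n)%N -> scalar_at n n x.
Proof.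
move=> [t /lhomog_scalar [N tN] ->]; exists N => n Nn.
by apply: tN => //; rewrite addr0.
Qed.

(** * Action on functions on infinite paths: vertices are nonzero *)

Definition is_inf_path (p : nat -> edge E) := forall n, rng (p n) = src (p n.+1).

Definition scons e (p : nat -> edge E) n := if n is m.+1 then p m else e.

(** An edge evaluates a function at the path without its first edge, a ghost edge at the path with
    that edge prepended. The relations hold only at infinite paths; by [pact_ext] the values there
    depend on no other values. *)
Fixpoint pact (t : lterm k E) (f : (nat -> edge E) -> k) (p : nat -> edge E) : k :=
  match t with
  | LVert v => if src (p 0%N) == v then f p else 0
  | LEdge e => if p 0%N == e then f (fun n => p n.+1) else 0
  | LGhost e => if src (p 0%N) == rng e then f (scons e p) else 0
  | LZero => 0
  | LAdd s t => pact s f p + pact t f p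
  | LOpp s => - pact s f p
  | LScale a s => a * pact s f p
  | LMul s t => pact s (pact t f) p
  end.

Lemma pact_ext t (f g : (nat -> edge E) -> k) : (forall p, is_inf_path p -> f p = g p) ->
  forall p, is_inf_path p -> pact t f p = pact t g p.
Proof.
elim: t f g => /= [v|e|e||s IHs t IHt|s IHs|a s IHs|s IHs t IHt] f g fg p pp //.
- by rewrite fg.
- by case: eqP => // _; apply: fg => n; apply: pp.
- by case: eqP => // pe; apply: fg => -[|n] /=; rewrite ?pe.
- by rewrite (IHs f g) // (IHt f g).
- by rewrite (IHs f g).
- by rewrite (IHs f g).
- by apply: IHs => // q qp; apply: IHt.
Qed.

Lemma pactD t (f g : (nat -> edge E) -> k) p : pact t (fun q => f q + g q) p = pact t f p + pact t g p.
Proof.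
elim: t f g p => /= [v|e|e||s IHs t IHt|s IHs|a s IHs|s IHs t IHt] f g p;
  try by case: ifP => //; rewrite addr0.
- by rewrite addr0.
- by rewrite IHs IHt addrACA.
- by rewrite IHs opprD.
- by rewrite IHs mulrDr.
- by rewrite -IHs; congr (pact s _ p); apply/funext => q; rewrite IHt.
Qed.

Lemma pactZ t a (f : (nat -> edge E) -> k) p : pact t (fun q => a * f q) p = a * pact t f p.
Proof.
elim: t f p => /= [v|e|e||s IHs t IHt|s IHs|b s IHs|s IHs t IHt] f p;
  try by case: ifP => //; rewrite mulr0.
- by rewrite mulr0.
- by rewrite IHs IHt mulrDr.
- by rewrite IHs mulrN.
- by rewrite IHs mulrCA.
- by rewrite -IHs; congr (pact s _ p); apply/funext => q; rewrite IHt.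
Qed.

Lemma pact_congr s t : lcongr s t ->
  forall (f : (nat -> edge E) -> k) p, is_inf_path p -> pact s f p = pact t f p.
Proof.
elim=> {s t} //=.
- by move=> s t _ IH f p pp; rewrite IH.
- by move=> s t u _ IH1 _ IH2 f p pp; rewrite IH1 ?IH2.
- by move=> s s' t t' _ IHs _ IHt f p pp; rewrite IHs ?IHt.
- by move=> s s' _ IHs f p pp; rewrite IHs.
- by move=> a s s' _ IHs f p pp; rewrite IHs.
- move=> s s' t t' _ IHs _ IHt f p pp; rewrite IHs //.
  by apply: pact_ext => // q qp; apply: IHt.
- by move=> s t u f p pp; rewrite addrA.
- by move=> s t f p pp; rewrite addrC.
- by move=> s f p pp; rewrite add0r.
- by move=> s f p pp; rewrite addNr.
- by move=> a b s f p pp; rewrite mulrA.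
- by move=> s f p pp; rewrite mul1r.
- by move=> a s t f p pp; rewrite mulrDr.
- by move=> a b s f p pp; rewrite mulrDl.
- by move=> s t u f p pp; rewrite pactD.
- by move=> a s t f p pp; rewrite pactZ.
- by move=> v f p pp; case: eqP.
- by move=> v w vw f p pp; case: eqP => // ->; case: eqP.
- by move=> e f p pp; case: eqP => //; case: eqP => // -> [].
- by move=> e f p pp; case: eqP => // pe; rewrite -pp pe eqxx.
- by move=> e f p pp; case: eqP.
- by move=> e f p pp; case: eqP => //=; rewrite eqxx.
- by move=> e f p pp; case: eqP => //=; rewrite eqxx.
- by move=> e g eg f p pp; case: eqP => //= _; case: eqP.
- move=> v vs f p pp.
  have -> : pact (\big[LAdd (E:=E)/LZero k E]_(e | src e == v)
      LMul (LEdge k e) (LGhost k e)) f p =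
    \sum_(e | src e == v) pact (LMul (LEdge k e) (LGhost k e)) f p.
    exact: (big_morph (fun t => pact t f p)).
  rewrite big_mkcond (bigD1 (p 0%N)) //= big1 ?addr0 => [|e ep0]; last first.
    by rewrite [p 0%N == e]eq_sym (negPf ep0) if_same.
  rewrite eqxx -pp eqxx; case: eqP => // _; congr (f _).
  by apply/funext; case.
Qed.

(** Without sinks an infinite path [p] starts at [v], and [v] preserves the value at [p] of the
    constant function 1. *)
Lemma lv_neq0 v : lv v != 0.
Proof.
have nxt w : {e | src e = w}.
  apply: cid; have := noSink w; rewrite negb_forall => /existsP[e].
  by rewrite negbK => /eqP; exists e.
pose p n := iter n (fun e => sval (nxt (rng e))) (sval (nxt v)).
have pp : is_inf_path p by move=> n; rewrite /p iterS; case: (nxt (rng _)).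
apply/eqP => /lclsP /pact_congr /(_ (fun=> 1) p pp) /=.
by rewrite /p /=; case: (nxt v) => e /= ->; rewrite eqxx => /eqP; rewrite oner_eq0.
Qed.

End LeavittGenerators.

(** * Frames of graded modules *)

(** Hides the converse ring, so that [ractA] reads as associativity of a right action. *)
Definition ract (R : grRing) (M : lmodType R^c) (x : M) (r : R) : M :=
  (r : R^c) *: x.
Notation "x <* r" := (ract x r) (at level 40, left associativity).

Section RightAction.
Variables (R : grRing) (M : lmodType R^c).
Implicit Types (x y : M) (r s : R).

Lemma ractA x r s : x <* (r * s) = x <* r <* s.
Proof. by rewrite /ract scalerA. Qed.
Lemma ract1 x : x <* 1 = x. Proof. exact: scale1r. Qed.
Lemma ractDr x r s : x <* (r + s) = x <* r + x <* s.
Proof. exact: scalerDl. Qed.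
Lemma ract0 x : x <* 0 = 0. Proof. exact: scale0r. Qed.
Lemma r0act r : (0 : M) <* r = 0. Proof. exact: scaler0. Qed.
Lemma ract_suml (I : Type) (l : seq I) (P : pred I) (F : I -> M) r :
  (\sum_(i <- l | P i) F i) <* r = \sum_(i <- l | P i) F i <* r.
Proof. exact: scaler_sumr. Qed.
Lemma ract_sumr (I : Type) (l : seq I) (P : pred I) (F : I -> R) x :
  x <* (\sum_(i <- l | P i) F i) = \sum_(i <- l | P i) x <* F i.
Proof.
by apply: (big_morph (ract x)) => [r s|]; [apply: ractDr|apply: ract0].
Qed.
End RightAction.

Lemma ract_comp (R : grRing) (M : grModule R) m n (x : M) (r : R) :
  gm_comp M m x -> gr_comp R n r -> gm_comp M (m + n) (x <* r).
Proof. exact: gm_scale. Qed.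

Lemma comp_sum (R : grRing) (M : grModule R) n (I : Type) (l : seq I) (P : pred I)
    (F : I -> M) : (forall i, P i -> gm_comp M n (F i)) ->
  gm_comp M n (\sum_(i <- l | P i) F i).
Proof.
case: (gm_grading M) => M0 MB _ _ FC; apply: big_ind => // x y Cx Cy.
by rewrite -[y]opprK -[- y]add0r; apply: (MB) => //; apply: (MB).
Qed.

Lemma homog_decomp (R : grRing) (M : grModule R) (x : M) :
  exists s : seq int, exists2 c : int -> M, (forall n, gm_comp M n (c n)) &
    x = \sum_(n <- s) c n.
Proof. by case: (gm_grading M). Qed.

(** Fibres of equal size are matched by position in their enumerations. This pairs the members of
    two frames at equal vertices. *)
Lemma count_bijection (I J T : finType) (w : I -> T) (w' : J -> T) :
  (forall v, #|[pred i | w i == v]| = #|[pred j | w' j == v]|) ->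
  exists2 s : I -> J, bijective s & forall i, w' (s i) = w i.
Proof.
move=> cw; pose P v := [pred i | w i == v]; pose Q v := [pred j | w' j == v].
have ex i : exists j, w' j == w i /\ index j (enum (Q (w i))) = index i (enum (P (w i))).
  have lt : (index i (enum (P (w i))) < size (enum (Q (w i))))%N.
    by rewrite -cardE -cw cardE index_mem mem_enum inE.
  case Eq: (enum (Q (w i))) lt => [//|j0 r] lt.
  exists (nth j0 (j0 :: r) (index i (enum (P (w i))))); rewrite -Eq in lt *.
  split; last by rewrite index_uniq // enum_uniq.
  by have := mem_nth j0 lt; rewrite mem_enum inE.
have [s sP] := fin_all_exists ex.
have sw i : w' (s i) = w i by have [/eqP] := sP i.
exists s => //; apply: inj_card_bij => [i i' ss|].
  have ww : w i = w i' by rewrite -!sw ss.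
  have [_] := sP i'; have [_] := sP i; rewrite ss ww => -> ii'.
  have i'P : i' \in enum (P (w i')) by rewrite mem_enum inE.
  have iP : i \in enum (P (w i')) by rewrite mem_enum inE ww.
  by rewrite -[i](nth_index i iP) ii' nth_index.
have part (K : finType) (u : K -> T) : #|K| = (\sum_v #|[pred x | u x == v]|)%N.
  rewrite -sum1_card (partition_big u xpredT) //=; apply: eq_bigr => v _.
  by rewrite sum1_card; apply: eq_card => x; rewrite !inE.
by rewrite (part J w') (part I w); apply: leq_sum => v _; rewrite cw.
Qed.

Section Frames.
Variables (k : fieldType) (E : graph).
Local Notation R := (leavitt k E).
Local Notation lv := (@lv k E).
Local Notation le := (@le k E).
Local Notation lg := (@lg k E).

(* A frame identifies P with the direct sum of the modules (w i)L(-N). *)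
Record frame (P : grModule R) (N : int) (I : finType) (w : I -> vertex E)
    (b : I -> P) (K : I -> P -> R) : Prop := Frame {
  fr_deg : forall i, gm_comp P N (b i);
  fr_add : forall i x y, K i (x + y) = K i x + K i y;
  fr_ract : forall i x r, K i (x <* r) = K i x * r;
  fr_Kdeg : forall i n x, gm_comp P n x -> gr_comp R (n - N) (K i x);
  fr_lv : forall i x, lv (w i) * K i x = K i x;
  fr_dual : forall i j, K i (b j) = if i == j then lv (w i) else 0;
  fr_span : forall x, x = \sum_i b i <* K i x
}.

Definition has_frame (P : grModule R) N (I : finType) (w : I -> vertex E) :=
  exists b K, @frame P N I w b K.

Section FrameTheory.
Variables (P : grModule R) (N : int) (I : finType) (w : I -> vertex E).
Variables (b : I -> P) (K : I -> P -> R).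
Hypothesis F : frame N w b K.

Lemma fr_sum i (J : Type) (l : seq J) (Q : pred J) (G : J -> P) :
  K i (\sum_(j <- l | Q j) G j) = \sum_(j <- l | Q j) K i (G j).
Proof.
apply: (big_morph (K i)) => [x y|]; first exact: (fr_add F).
by rewrite -(r0act P 0) (fr_ract F) mulr0.
Qed.

Lemma fr_blv i : b i <* lv (w i) = b i.
Proof.
rewrite [RHS](fr_span F) (bigD1 i) //= big1 ?addr0 => [|j ji].
  by rewrite (fr_dual F) eqxx.
by rewrite (fr_dual F) (negPf ji) ract0.
Qed.

End FrameTheory.

Lemma frame_graded_iso P Q N (I J : finType) (w : I -> vertex E) (w' : J -> vertex E) :
  has_frame P N w -> has_frame Q N w' ->
  (forall v, #|[pred i | w i == v]| = #|[pred j | w' j == v]|) ->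
  graded_iso P Q.
Proof.
move=> [b [K F]] [b' [K' F']] /count_bijection [s [t sK tK] ws].
pose f (x : P) : Q := \sum_i b' (s i) <* K i x.
pose g (y : Q) : P := \sum_j b (t j) <* K' j y.
have fL : linear f.
  move=> r x y; rewrite /f scaler_sumr -big_split; apply: eq_bigr => i _ /=.
  by rewrite (fr_add F) ractDr (fr_ract F) ractA.
have wt j : w (t j) = w' j by rewrite -ws tK.
apply: (@graded_isoP _ _ _ (grlinear fL) g) => [x|y|n x Cx|n y Cy] /=.
- rewrite /g (reindex s) /=; last by exists t => j _; rewrite ?sK ?tK.
  rewrite [RHS](fr_span F); apply: eq_bigr => i _.
  rewrite sK (fr_sum F') (bigD1 i) //= big1 ?addr0 => [|i' i'i].
    by rewrite (fr_ract F') (fr_dual F') eqxx ws (fr_lv F).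
  rewrite (fr_ract F') (fr_dual F') (inj_eq (can_inj sK)) eq_sym (negPf i'i).
  by rewrite mul0r.
- rewrite /f (reindex t) /=; last by exists s => j _; rewrite ?sK ?tK.
  rewrite [RHS](fr_span F'); apply: eq_bigr => j _.
  rewrite tK (fr_sum F) (bigD1 j) //= big1 ?addr0 => [|i' i'i].
    by rewrite (fr_ract F) (fr_dual F) eqxx wt (fr_lv F').
  rewrite (fr_ract F) (fr_dual F) (inj_eq (can_inj tK)) eq_sym (negPf i'i).
  by rewrite mul0r.
- apply: comp_sum => i _; rewrite -[n](subrK N) addrC.
  by apply: ract_comp; [apply: (fr_deg F')|apply: (fr_Kdeg F)].
- apply: comp_sum => i _; rewrite -[n](subrK N) addrC.
  by apply: ract_comp; [apply: (fr_deg F)|apply: (fr_Kdeg F')].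
Qed.

Lemma has_frame_iso P Q N (I : finType) (w : I -> vertex E) :
  graded_iso P Q -> has_frame P N w -> has_frame Q N w.
Proof.
move=> /graded_isoE [f [g [fK gK fC gC]]] [b [K F]].
exists (fun i => f (b i)), (fun i y => K i (g y)); split=> [i|i x y|i x r|i n x Cx|i x|i j|x].
- exact/fC/(fr_deg F).
- by rewrite linearD (fr_add F).
- by rewrite [g _]linearZ [LHS](fr_ract F).
- exact/(fr_Kdeg F)/gC.
- exact: (fr_lv F).
- by rewrite fK (fr_dual F).
- rewrite -[LHS]gK [X in f X](fr_span F) linear_sum; apply: eq_bigr => i _.
  by rewrite [LHS]linearZ.
Qed.

Lemma has_frame_sum P Q N (I J : finType) (w : I -> vertex E) (w' : J -> vertex E) :
  has_frame P N w -> has_frame Q N w' ->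
  has_frame (gsum P Q) N (fun ij : I + J => match ij with inl i => w i | inr j => w' j end).
Proof.
move=> [b [K F]] [b' [K' F']].
have P0 n : gm_comp P n 0 by case: (gm_grading P).
have Q0 n : gm_comp Q n 0 by case: (gm_grading Q).
exists (fun ij => match ij with inl i => (b i, 0) | inr j => (0, b' j) end).
exists (fun ij (p : gsum P Q) =>
  match ij with inl i => K i p.1 | inr j => K' j p.2 end).
have K0 i : K i 0 = 0 by rewrite -(r0act P 0) (fr_ract F) mulr0.
have K'0 j : K' j 0 = 0 by rewrite -(r0act Q 0) (fr_ract F') mulr0.
split=> [[i|j]|[i|j] x y|[i|j] x r|[i|j] n x [Cx Cy]|[i|j] x|[i|j] [i'|j']|[x y]] //=.
- by split=> //; apply: (fr_deg F).
- by split=> //; apply: (fr_deg F').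
- exact: (fr_add F).
- exact: (fr_add F').
- exact: (fr_ract F).
- exact: (fr_ract F').
- exact: (fr_Kdeg F).
- exact: (fr_Kdeg F').
- exact: (fr_lv F).
- exact: (fr_lv F').
- exact: (fr_dual F).
- exact: (fr_dual F').
- have pairE (T : Type) (l : seq T) (u : T -> P) (v : T -> Q) :
      \sum_(i <- l) ((u i, v i) : gsum P Q) = (\sum_(i <- l) u i, \sum_(i <- l) v i).
    by elim: l => [|i l IH]; rewrite ?big_nil // !big_cons IH.
  rewrite big_sumType /=.
  rewrite (eq_bigr (fun i => (b i <* K i x, 0))); last first.
    by move=> i _; apply: (congr1 (pair _) (r0act Q (K i x))).
  rewrite [X in _ + X](eq_bigr (fun j => (0, b' j <* K' j y))); last first.
    by move=> j _; apply: (congr1 (pair^~ _) (r0act P (K' j y))).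
  rewrite !pairE !big1_eq -(fr_span F) -(fr_span F').
  by congr (_, _); rewrite /= ?addr0 ?add0r.
Qed.

Lemma has_frame_shift P N n (I : finType) (w : I -> vertex E) :
  has_frame P N w -> has_frame (gshift P n) (N - n) w.
Proof.
move=> [b [K F]]; exists b, K.
split=> [i|i x y|i x r|i m x Cx|i x|i j|x].
- by rewrite /= addrC subrK; apply: (fr_deg F).
- exact: (fr_add F).
- exact: (fr_ract F).
- by have := fr_Kdeg F i Cx; congr (gr_comp _ _ _); rewrite opprB addrCA addrA.
- exact: (fr_lv F).
- exact: (fr_dual F).
- exact: (fr_span F).
Qed.

Lemma has_frame_zero N : has_frame (gzero R) N (fun i : void => of_void _ i).
Proof.
exists (fun=> 0), (fun _ _ => 0); split=> //; try by case.
by move=> x; rewrite thinmx0 [RHS]thinmx0.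
Qed.

Lemma has_frame_reg : has_frame (greg R) 0 (id : vertex E -> vertex E).
Proof.
exists lv, (fun v x => lv v * x); split=> [i|i x y|i x r|i m x Cx|i x|i j|x].
- exact: lv_deg.
- exact: mulrDr.
- exact: mulrA.
- by rewrite subr0 -[m]add0r; apply: leavitt_mul Cx; apply: lv_deg.
- by rewrite mulrA lvM eqxx.
- exact: lvM.
- transitivity (\sum_v lv v * x); first by rewrite -mulr_suml sum_lv mul1r.
  apply: eq_bigr => v _; transitivity (lv v * (lv v * x)) => //.
  by rewrite mulrA lvM eqxx.
Qed.

Hypothesis noSink : forall v : vertex E, ~~ is_sink v.

Definition lift_pred (I : finType) (w : I -> vertex E) :=
  [pred p : I * edge E | src p.2 == w p.1].
Definition lift_index (I : finType) (w : I -> vertex E) := {p in lift_pred w}.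
Definition lift_end (I : finType) (w : I -> vertex E) (p : lift_index w) :=
  rng (val p).2.

(** (CK2) writes [w i] as the sum of e e^* over its outgoing edges, so (w i)L(-N) is the direct sum
    of the r(e)L(-N-1); the new coordinates are the old ones cut by e^*. *)
Lemma frame_lift P N (I : finType) (w : I -> vertex E) b K : @frame P N I w b K ->
  frame (N + 1) (@lift_end I w) (fun p => b (val p).1 <* le (val p).2)
    (fun p x => lg (val p).2 * K (val p).1 x).
Proof.
move=> F; split=> [[[i e] /= ie]|[[i e] /= ie] x y|[[i e] /= ie] x r|[[i e] /= ie] m x Cx
  |[[i e] /= ie] x|[[i e] ie] [[j f] jf]|x].
- by apply: ract_comp; [apply: (fr_deg F)|apply: le_deg].
- by rewrite (fr_add F) mulrDr.
- by rewrite (fr_ract F) mulrA.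
- have -> : m - (N + 1) = -1 + (m - N) by rewrite opprD addrA addrC.
  by apply: leavitt_mul; [apply: lg_deg|apply: (fr_Kdeg F)].
- by rewrite mulrA lv_lg eqxx.
- have ie1 : src e == w i by move: ie; rewrite inE.
  rewrite /= (fr_ract F) (fr_dual F) -val_eqE /= xpair_eqE.
  case: eqP => [ij|_] /=; last by rewrite mul0r mulr0.
  by rewrite mulrA lg_lv ie1 lg_le; case: eqP.
- rewrite -(big_sub (lift_pred w) (fun p => b p.1 <* le p.2 <* (lg p.2 * K p.1 x))).
  rewrite -(pair_big_dep xpredT (fun i e => src e == w i)
    (fun i e => b i <* le e <* (lg e * K i x))) /=.
  rewrite [LHS](fr_span F); apply: eq_bigr => i _.
  rewrite -[in LHS](fr_lv F) -le_lg // mulr_suml ract_sumr.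
  by apply: eq_bigr => e _; rewrite -ractA mulrA.
Qed.

Section Counting.
Variables (n : nat) (vt : 'I_n -> vertex E).
Hypothesis vt_bij : bijective vt.

Definition adjm : 'M[int]_n :=
  \matrix_(i, j) \sum_e ((src e == vt i) && (rng e == vt j))%:R.
Definition cnt (I : finType) (w : I -> vertex E) : 'rV[int]_n :=
  \row_j \sum_i (w i == vt j)%:R.

Lemma sum_indicator (I : finType) (P : pred I) :
  \sum_i (P i)%:R = #|P|%:R :> int.
Proof.
rewrite -sum1_card natr_sum [RHS]big_mkcond; apply: eq_bigr => i _.
by rewrite unfold_in; case: (P i).
Qed.

Lemma cnt_card (I J : finType) (w : I -> vertex E) (w' : J -> vertex E) :
  cnt w = cnt w' -> forall v, #|[pred i | w i == v]| = #|[pred j | w' j == v]|.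
Proof.
move=> cw v; have [tv _ vK] := vt_bij; have /rowP /(_ (tv v)) := cw.
rewrite !mxE vK (sum_indicator [pred i | w i == v]).
by rewrite (sum_indicator [pred i | w' i == v]) => -[]; rewrite !natz => -[].
Qed.

Lemma cnt_iso P Q N (I J : finType) (w : I -> vertex E) (w' : J -> vertex E) :
  has_frame P N w -> has_frame Q N w' -> cnt w = cnt w' -> graded_iso P Q.
Proof. by move=> FP FQ cw; apply: frame_graded_iso FP FQ (cnt_card cw). Qed.

Lemma sum_vt (f : vertex E -> int) v : \sum_i (v == vt i)%:R * f (vt i) = f v.
Proof.
have [tv vtK vK] := vt_bij.
rewrite (bigD1 (tv v)) //= vK eqxx mul1r big1 ?addr0 // => i.
by apply: contraNeq; case: (v =P vt i) => [->|_]; rewrite ?vtK ?mul0r ?eqxx.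
Qed.

Lemma cnt_mul (I : finType) (w : I -> vertex E) m (D : 'M[int]_(n, m))
    (G : vertex E -> 'rV[int]_m) :
  (forall i, row i D = G (vt i)) -> cnt w *m D = \sum_i G (w i).
Proof.
move=> DG; apply/rowP => j; rewrite !mxE summxE.
have -> : \sum_i G (w i) 0 j = \sum_i \sum_l (w i == vt l)%:R * D l j.
  apply: eq_bigr => i _; rewrite -(sum_vt (fun v => G v 0 j)).
  by apply: eq_bigr => l _; rewrite -DG mxE.
rewrite exchange_big; apply: eq_bigr => l _.
by rewrite !mxE mulr_suml.
Qed.

Lemma cnt_lift (I : finType) (w : I -> vertex E) :
  cnt (@lift_end I w) = cnt w *m adjm.
Proof.
rewrite (@cnt_mul _ _ _ _ (fun v => \row_j \sum_e ((src e == v) && (rng e == vt j))%:R)).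
  apply/rowP => j; rewrite mxE summxE.
  rewrite -(big_sub (lift_pred w) (fun p => (rng p.2 == vt j)%:R)).
  rewrite -(pair_big_dep xpredT (fun i e => src e == w i)
    (fun i e => (rng e == vt j)%:R)) /=.
  apply: eq_bigr => i _; rewrite mxE big_mkcond; apply: eq_bigr => e _.
  by case: (src e == w i).
by move=> i; apply/rowP => j; rewrite !mxE.
Qed.

Lemma cnt_sum (I J : finType) (w : I -> vertex E) (w' : J -> vertex E) :
  cnt (fun ij : I + J => match ij with inl i => w i | inr j => w' j end) =
  cnt w + cnt w'.
Proof. by apply/rowP => j; rewrite !mxE big_sumType. Qed.

Lemma has_frame_lift P N (I : finType) (w : I -> vertex E) (a : nat) :
  has_frame P N w -> exists (J : finType) (w' : J -> vertex E),
    has_frame P (N + a%:Z) w' /\ cnt w' = cnt w *m adjm ^+ a.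
Proof.
move=> F; elim: a => [|a [J [w' [[b [K F']] cw']]]].
  by exists I, w; rewrite addr0 expr0 mulmx1.
exists (lift_index w'), (@lift_end J w'); split; last first.
  by rewrite cnt_lift cw' -mulmxA exprSr.
rewrite -addn1 PoszD addrA.
exists (fun p => b (val p).1 <* le (val p).2).
exists (fun p x => lg (val p).2 * K (val p).1 x); exact: frame_lift.
Qed.

(** A matrix over k with a right inverse has at least as many columns as rows. The rank gives the
    sizes in every characteristic, whereas a trace over k would give them only modulo the
    characteristic. *)
Lemma card_inverse (I J : finType) (P : pred I) (Q : pred J) (C : I -> J -> k)
    (C' : J -> I -> k) :
  {in P &, forall i i', \sum_(j in Q) C i j * C' j i' = (i == i')%:R} ->
  (#|P| <= #|Q|)%N.
Proof.
move=> CC.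
pose A : 'M[k]_(#|P|, #|Q|) := \matrix_(i, j) C (enum_val i) (enum_val j).
pose B : 'M[k]_(#|Q|, #|P|) := \matrix_(j, i) C' (enum_val j) (enum_val i).
have AB : A *m B = 1%:M.
  apply/matrixP => i i'; rewrite !mxE.
  have := CC _ _ (enum_valP i) (enum_valP i').
  rewrite (inj_eq enum_val_inj) => <-; rewrite [RHS]big_enum_val.
  by apply: eq_bigr => j _; rewrite !mxE.
have := mulmx_max_rank A B; rewrite AB mxrank1; exact.
Qed.

End Counting.
End Frames.

(** * Existence of frames from dual bases *)

Section FrameExistence.
Variables (k : fieldType) (E : graph).
Hypothesis noSink : forall v : vertex E, ~~ is_sink v.
Local Notation R := (leavitt k E).
Local Notation L := (leavitt_alg k E).
Local Notation lv := (@lv k E).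
Local Notation ep := (@ep k E).
Local Notation gp := (@gp k E).

Implicit Types (P Q : grModule R).

Lemma comp_scale n a (x : L) : leavitt_comp n x -> leavitt_comp n (a *: x).
Proof.
by move=> [t th ->]; exists (LScale a t); [apply: lh_scale|rewrite lclsZ].
Qed.

Lemma fin_scalar (T : finType) (f : T -> L) : (forall t, leavitt_comp 0 (f t)) ->
  exists n, forall t, scalar_at n n (f t).
Proof.
move=> f0; have /fin_all_exists [N NP] := fun t => comp0_scalar noSink (f0 t).
by exists (\max_t N t)%N => t; apply: NP; apply: leq_bigmax.
Qed.

(** The data of the dual basis lemma with all members in degree N: a frame without the duality
    between [K] and [b]. Applying [K i] to the expansion of [b j] shows that the matrix of the
    [K i (b j)] is idempotent. *)
Record dual_basis (P : grModule R) (N : int) (I : finType) (b : I -> P)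
    (K : I -> P -> R) : Prop := DualBasis {
  db_deg : forall i, gm_comp P N (b i);
  db_add : forall i x y, K i (x + y) = K i x + K i y;
  db_ract : forall i x r, K i (x <* r) = K i x * r;
  db_Kdeg : forall i n x, gm_comp P n x -> gr_comp R (n - N) (K i x);
  db_span : forall x, x = \sum_i b i <* K i x
}.

Lemma db_sum P N (I : finType) (b : I -> P) (K : I -> P -> R) i (J : Type)
    (l : seq J) (Q : pred J) (G : J -> P) : dual_basis N b K ->
  K i (\sum_(j <- l | Q j) G j) = \sum_(j <- l | Q j) K i (G j).
Proof.
move=> F; apply: (big_morph (K i)) => [x y|]; first exact: (db_add F).
by rewrite -(r0act P 0) (db_ract F) mulr0.
Qed.

Lemma dual_basis_ord P N (I : finType) (b : I -> P) (K : I -> P -> R) :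
  dual_basis N b K -> dual_basis N (fun a : 'I_#|I| => b (enum_val a))
    (fun a : 'I_#|I| => K (enum_val a)).
Proof.
move=> F; split=> [a|a x y|a x r|a n x Cx|x].
- exact: (db_deg F).
- exact: (db_add F).
- exact: (db_ract F).
- exact: (db_Kdeg F).
- rewrite [LHS](db_span F).
  by rewrite -(big_enum_val (A := I) (fun i => b i <* K i x)).
Qed.

(** Inserting 1 as the sum of the mu mu^* replaces an entry x of the idempotent matrix by the
    elements nu^* x mu, which are vertex-diagonal once the paths are long. *)
Lemma dual_basis_refine P N (I : finType) (b : I -> P) (K : I -> P -> R) n :
  dual_basis N b K -> dual_basis (N + n%:Z)
    (fun p : I * n.-tuple (edge E) => b p.1 <* ep p.2) (fun p x => gp p.2 * K p.1 x).
Proof.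
move=> F; split=> [[i s]|[i s] x y|[i s] x r|[i s] m x Cx|x] /=.
- by apply: ract_comp; [apply: (db_deg F)|have := ep_deg k s; rewrite size_tuple].
- by rewrite (db_add F) mulrDr.
- by rewrite (db_ract F) mulrA.
- have -> : m - (N + n%:Z) = - n%:Z + (m - N) by rewrite opprD addrA addrC.
  apply: leavitt_mul; last exact: (db_Kdeg F).
  by have := gp_deg k s; rewrite size_tuple.
- rewrite -(pair_big xpredT xpredT
    (fun i (s : n.-tuple (edge E)) => b i <* ep s <* (gp s * K i x))) /=.
  rewrite [LHS](db_span F); apply: eq_bigr => i _.
  rewrite -[K i x in LHS]mul1r -(sum_ep_gp k noSink n) mulr_suml ract_sumr.
  by apply: eq_bigr => s _; rewrite -ractA mulrA.
Qed.

Lemma scaled_lv_inj v (a b : k) : a *: lv v = b *: lv v -> a = b.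
Proof.
move=> /eqP; rewrite -subr_eq0 -scalerBl scaler_eq0 (negPf (lv_neq0 k noSink v)).
by rewrite orbF subr_eq0 => /eqP.
Qed.

Lemma split_lv (x : L) : x = \sum_v \sum_w lv v * x * lv w.
Proof.
rewrite -{1}[x]mulr1 -{1}[x]mul1r -sum_lv !mulr_suml.
by apply: eq_bigr => v _; rewrite mulr_sumr.
Qed.

(** A rank factorization C = U V; cancelling the outer factors in U V U V = U V leaves V U = 1. The
    size r is given in Type because it will index a frame. *)
Lemma idempotent_split q (C : 'M[k]_q) : C *m C = C ->
  {r : nat & {UV : 'M[k]_(q, r) * 'M[k]_(r, q) |
    UV.1 *m UV.2 = C /\ UV.2 *m UV.1 = 1%:M}}.
Proof.
move=> CC; exists (\rank C); exists (col_base C, row_base C) => /=.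
move: (col_base C) (row_base C) (col_base_full C) (row_base_free C) (mulmx_base C).
move=> U V Ufull Vfree UV; split=> //.
apply: (row_free_inj Vfree); rewrite mul1mx; apply: (row_full_inj Ufull).
by rewrite !mulmxA UV -mulmxA UV CC.
Qed.

(* The coefficients of the [lv v]-corners of the [K i (b j)] form an idempotent
   matrix [C v] over k; splitting [C v] yields the members of the frame at [v]. *)
Lemma dual_basis_frame P N q (b : 'I_q -> P) (K : 'I_q -> P -> R) :
  dual_basis N b K -> (forall i j, vdiag (K i (b j) : L)) ->
  exists (I : finType) (w : I -> vertex E), has_frame P N w.
Proof.
move=> F diag.
have /choice [C0 C0E] : forall p : vertex E * 'I_q * 'I_q, exists c : k,
    lv p.1.1 * (K p.1.2 (b p.2) : L) * lv p.1.1 = c *: lv p.1.1.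
  by move=> [[v i] j] /=; have [c] := diag i j v v; rewrite eqxx; exists c.
pose C v : 'M[k]_q := \matrix_(i, j) C0 (v, i, j).
have CE v w i j : lv v * (K i (b j) : L) * lv w = if v == w then C v i j *: lv v else 0.
  case: (v =P w) => [<-|/eqP/negPf vw]; first by rewrite (C0E (v, i, j)) mxE.
  by have [c ->] := diag i j v w; rewrite vw.
have CC v : C v *m C v = C v.
  apply/matrixP => i j; apply: (@scaled_lv_inj v).
  have := CE v v i j; rewrite eqxx => <-.
  rewrite [b j](db_span F) (db_sum _ _ _ _ F) mulr_sumr mulr_suml.
  rewrite mxE scaler_suml; apply: eq_bigr => l _; rewrite (db_ract F).
  have -> : lv v * (K i (b l) * K l (b j) : L) * lv v =
      \sum_u (lv v * (K i (b l) : L) * lv u) * (lv u * (K l (b j) : L) * lv v).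
    rewrite -[K i (b l) in LHS]mulr1 -sum_lv !(mulr_suml, mulr_sumr).
    by apply: eq_bigr => u _; rewrite !mulrA -(mulrA _ (lv u) (lv u)) lvM eqxx.
  rewrite (bigD1 v) //= big1 ?addr0 => [|u uv].
    rewrite !CE eqxx -leavitt_scaleAl -leavitt_scaleAr lvM eqxx scalerA.
    by congr (_ *: _).
  by rewrite CE eq_sym (negPf uv) mul0r.
have S v := idempotent_split (CC v).
pose rk v := tag (S v); pose U v : 'M_(q, rk v) := (sval (tagged (S v))).1.
pose V v : 'M_(rk v, q) := (sval (tagged (S v))).2.
have UV v : U v *m V v = C v by have [] := svalP (tagged (S v)).
have VU v : V v *m U v = 1%:M by have [] := svalP (tagged (S v)).
pose I : finType := {v : vertex E & 'I_(rk v)}.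
exists I, (fun p : I => tag p).
(* Column s of [U v] combines the [b a] into a member at v, and row s of [V v] gives its coordinate:
   V U = 1 yields duality, U V = C v yields spanning. *)
exists (fun p : I => \sum_a b a <* (U (tag p) a (tagged p) *: lv (tag p) : L)).
exists (fun (p : I) x => \sum_a V (tag p) (tagged p) a *: (lv (tag p) * K a x : L)).
split=> [[v s]|[v s] x y|[v s] x r|[v s] n x Cx|[v s] x|[v s] [w t]|x] /=.
- apply: comp_sum => a _; rewrite -[N]addr0; apply: ract_comp; first exact: (db_deg F).
  exact/comp_scale/lv_deg.
- rewrite -big_split; apply: eq_bigr => a _.
  by rewrite (db_add F) mulrDr scalerDr.
- rewrite mulr_suml; apply: eq_bigr => a _.
  by rewrite (db_ract F) mulrA leavitt_scaleAl.
- apply: (@comp_sum _ (greg R)) => a _; apply: comp_scale; rewrite -[n - N]add0r.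
  by apply: leavitt_mul; [apply: lv_deg|apply: (db_Kdeg F)].
- rewrite mulr_sumr; apply: eq_bigr => a _.
  by rewrite -leavitt_scaleAr mulrA lvM eqxx.
- have -> : \sum_a V v s a *: (lv v * K a (\sum_a' b a' <* (U w a' t *: lv w : L)) : L) =
      \sum_a \sum_a' (V v s a * U w a' t) *: (lv v * (K a (b a') : L) * lv w).
    apply: eq_bigr => a _; rewrite (db_sum _ _ _ _ F) mulr_sumr scaler_sumr.
    apply: eq_bigr => a' _; rewrite (db_ract F) mulrA -leavitt_scaleAr scalerA.
    by [].
  under eq_bigr do under eq_bigr do rewrite CE.
  case: (v =P w) => [vw|vw]; last first.
    rewrite big1 => [|a _]; last by rewrite big1 // => a' _; rewrite scaler0.
    by case: eqP => // -[].
  case: w / vw t => t.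
  transitivity ((V v *m C v *m U v) s t *: lv v).
    rewrite !mxE scaler_suml exchange_big; apply: eq_bigr => a' _ /=.
    rewrite mxE mulr_suml scaler_suml; apply: eq_bigr => a _.
    by rewrite scalerA mulrAC.
  rewrite -UV mulmxA VU mul1mx VU mxE eq_Tagged /=.
  by case: eqP; rewrite ?scale1r ?scale0r.
- rewrite [LHS](db_span F).
  transitivity (\sum_a b a <* \sum_a' (K a (b a') : L) * K a' x).
    apply: eq_bigr => a _; apply: (congr1 (ract (b a))); rewrite [x in LHS](db_span F) (db_sum _ _ _ _ F).
    by apply: eq_bigr => a' _; rewrite (db_ract F).
  rewrite -(sig_big_dep xpredT (fun _ => xpredT) (fun v s =>
    (\sum_a b a <* (U v a s *: lv v : L)) <* (\sum_a V v s a *: (lv v * K a x : L)))) /=.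
  (* Corners between distinct vertices vanish, so an entry is the sum of its diagonal corners. *)
  have KE a a' : (K a (b a') : L) = \sum_v C v a a' *: lv v.
    rewrite [LHS]split_lv; apply: eq_bigr => v _.
    rewrite (bigD1 v) //= big1 ?addr0 => [|w wv]; first by rewrite CE eqxx.
    by rewrite CE eq_sym (negPf wv).
  have -> : \sum_v \sum_(s < rk v) (\sum_a b a <* (U v a s *: lv v : L)) <*
      (\sum_a V v s a *: (lv v * K a x : L)) =
    \sum_a b a <* \sum_v \sum_s \sum_a' (U v a s * V v s a') *: (lv v * K a' x : L).
    transitivity (\sum_v \sum_a \sum_(s < rk v) b a <*
        \sum_a' (U v a s * V v s a') *: (lv v * K a' x : L)).
      apply: eq_bigr => v _; rewrite exchange_big; apply: eq_bigr => s _ /=.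
      rewrite ract_suml; apply: eq_bigr => a _; rewrite -ractA mulr_sumr.
      apply: (congr1 (ract (b a))); apply: eq_bigr => a' _.
      rewrite -leavitt_scaleAr -leavitt_scaleAl mulrA lvM eqxx scalerA.
      by rewrite mulrC.
    rewrite exchange_big; apply: eq_bigr => a _ /=.
    by rewrite ract_sumr; apply: eq_bigr => v _; rewrite ract_sumr.
  apply: eq_bigr => a _; apply: (congr1 (ract (b a))).
  transitivity (\sum_v \sum_a' C v a a' *: (lv v * K a' x : L)).
    rewrite exchange_big; apply: eq_bigr => a' _ /=; rewrite KE mulr_suml.
    by apply: eq_bigr => v _; rewrite leavitt_scaleAl.
  apply: eq_bigr => v _; rewrite exchange_big; apply: eq_bigr => a' _ /=.
  by rewrite -scaler_suml -UV mxE.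
Qed.

End FrameExistence.

Lemma comp_add (R : grRing) (M : grModule R) n (x y : M) :
  gm_comp M n x -> gm_comp M n y -> gm_comp M n (x + y).
Proof.
case: (gm_grading M) => M0 MB _ _ Cx Cy.
by rewrite -[y]opprK -[- y]add0r; apply: (MB) => //; apply: (MB).
Qed.

(** * Free covers with generators in one degree *)

Section FreeCover.
Variables (R : grRing) (P : grModule R) (N : int).

(** Each copy of R is shifted by -N, which puts its generator 1 into degree N. *)
Fixpoint free_mod (ys : seq P) : grModule R :=
  if ys is _ :: ys' then gsum (gshift (greg R) (- N)) (free_mod ys') else gzero R.

Fixpoint free_map (ys : seq P) : free_mod ys -> P :=
  match ys return free_mod ys -> P with
  | [::] => fun _ => 0
  | y :: ys' => fun p => y <* (p.1 : R) + free_map p.2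
  end.

Lemma free_map_linear ys : linear (@free_map ys).
Proof.
elim: ys => [|y ys IH] r p q; first by rewrite /= scaler0 addr0.
transitivity (((r *: (y <* (p.1 : R)) + y <* (q.1 : R))) +
              (r *: free_map p.2 + free_map q.2)); last first.
  by rewrite /= scalerDr addrACA.
apply: congr2; last exact: IH.
have -> : (r : R^c) *: (y <* (p.1 : R)) = y <* ((p.1 : R) * (r : R)).
  by rewrite ractA.
exact: ractDr.
Qed.

Lemma free_map_hom ys : (forall y, y \in ys -> gm_comp P N y) ->
  graded_hom (grlinear (@free_map_linear ys)).
Proof.
elim: ys => [|y ys IH] ysN n p.
  by move=> _; case: (gm_grading P).
move=> [p1 p2]; have /IH /(_ n _ p2) Cp2 : forall y, y \in ys -> gm_comp P N y.
  by move=> z zs; apply: ysN; rewrite in_cons zs orbT.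
have Cp1 : gm_comp P n (y <* (p.1 : R)).
  have -> : n = N + (- N + n) by rewrite addrA subrr add0r.
  by apply: ract_comp p1; apply: ysN; rewrite mem_head.
exact: comp_add.
Qed.

(** For a graded section [h] of [free_map], as projectivity provides, these coordinates and the
    members of [ys] form a dual basis. *)
Lemma free_map_coords ys (h : P -> free_mod ys) : linear h ->
  (forall n x, gm_comp P n x -> gm_comp (free_mod ys) n (h x)) ->
  exists H : 'I_(size ys) -> P -> R,
    [/\ forall i x y, H i (x + y) = H i x + H i y,
        forall i x r, H i (x <* r) = H i x * r,
        forall i n x, gm_comp P n x -> gr_comp R (n - N) (H i x)
      & forall x, free_map (h x) = \sum_(i < size ys) ys`_i <* H i x].
Proof.
elim: ys h => [|y ys IH] h hL hC.
  exists (fun=> fun=> 0); split=> [[]|[]|[]|x] //=; by rewrite big_ord0.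
have [||H [HD HR HC HE]] := IH (fun x => (h x).2).
- by move=> r x y'; rewrite hL.
- by move=> n x /hC [].
have hD x x' : h (x + x') = h x + h x' by have := hL 1 x x'; rewrite !scale1r.
have hR x (r : R) : h (x <* r) = (r : R^c) *: h x.
  have h0 : h 0 = 0 by have := hL (-1) 0 0; rewrite scaler0 addr0 scaleN1r addNr.
  by have := hL r x 0; rewrite h0 !addr0.
exists (fun i x => if unlift ord0 i is Some j then H j x else (h x).1 : R); split.
- by move=> i x x'; case: unliftP => [j|] _; rewrite ?HD ?hD.
- by move=> i x r; case: unliftP => [j|] _; rewrite ?HR ?hR.
- move=> i n x Cx; case: unliftP => [j|] _; first exact: HC.
  by rewrite addrC; have [] := hC _ _ Cx.
- move=> x; rewrite big_ord_recl unlift_none /= HE; congr (_ + _).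
  by apply: eq_bigr => j _; rewrite -[in RHS]/(lift ord0 j) liftK.
Qed.

Lemma free_map_span ys zs : (forall y, y \in ys -> exists a, @free_map zs a = y) ->
  forall a, exists b, @free_map zs b = @free_map ys a.
Proof.
elim: ys => [_ a|y ys IH yz [r a]].
  by exists 0; have := linear0 (grlinear (@free_map_linear zs)).
have [b bE] : exists b, @free_map zs b = free_map a.
  by apply: IH => z zs'; apply: yz; rewrite in_cons zs' orbT.
have [c cE] := yz y (mem_head _ _).
exists ((r : R^c) *: c + b).
by rewrite free_map_linear cE bE.
Qed.
End FreeCover.

Section Spans.
Variables (R : grRing) (P : grModule R) (N : int).
Definition spans (ys : seq P) (x : P) := exists a, @free_map R P N ys a = x.

Lemma spans0 ys : spans ys 0.
Proof. by exists 0; have := linear0 (grlinear (@free_map_linear _ P N ys)). Qed.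

Lemma spansD ys x y : spans ys x -> spans ys y -> spans ys (x + y).
Proof.
by move=> [a <-] [b <-]; exists (1 *: a + b); rewrite free_map_linear scale1r.
Qed.

Lemma spans_act ys x r : spans ys x -> spans ys (x <* r).
Proof.
move=> [a <-]; exists ((r : R^c) *: a + 0); rewrite free_map_linear.
by have := linear0 (grlinear (@free_map_linear _ P N ys)); move=> /= ->; rewrite addr0.
Qed.

Lemma spans_sum (I : Type) (l : seq I) (Q : pred I) (F : I -> P) ys :
  (forall i, Q i -> spans ys (F i)) -> spans ys (\sum_(i <- l | Q i) F i).
Proof. by move=> FQ; apply: big_ind => //; [apply: spans0|apply: spansD]. Qed.

Lemma spans_mem ys y : y \in ys -> spans ys y.
Proof.
elim: ys => // z ys IH; rewrite in_cons => /orP[/eqP ->|/IH [a aE]].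
  have [a aE] := spans0 ys; exists ((1 : R), a).
  by rewrite /= aE addr0 ract1.
by exists ((0 : R), a); rewrite /= aE ract0 add0r.
Qed.

Lemma spans_sub ys zs x : {subset ys <= zs} -> spans ys x -> spans zs x.
Proof.
move=> yz [a <-]; have [|b bE] := @free_map_span R P N ys zs _ a; last by exists b.
by move=> y /yz /spans_mem.
Qed.
End Spans.

(** * Frames of finitely generated graded projective modules *)

Section FrameOfProjective.
Variables (k : fieldType) (E : graph).
Hypothesis noSink : forall v : vertex E, ~~ is_sink v.
Local Notation R := (leavitt k E).
Implicit Types (P : grModule R).

(** A frame has all its members in one degree. Asking for every large N, and not just for some N,
    lets several elements be spanned from the same degree. *)
Definition homog_span P (l : seq P) := exists D : nat, forall N : nat, (D <= N)%N ->
  exists ys : seq P, (forall y, y \in ys -> gm_comp P N y) /\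
    forall x, x \in l -> spans N ys x.

Lemma homog_span_cat P (l l' : seq P) :
  homog_span l -> homog_span l' -> homog_span (l ++ l').
Proof.
move=> [D DP] [D' DP']; exists (maxn D D') => N; rewrite geq_max => /andP[DN DN'].
have [ys [ysN ysS]] := DP N DN; have [zs [zsN zsS]] := DP' N DN'.
exists (ys ++ zs); split=> [y|x].
  by rewrite mem_cat => /orP[/ysN|/zsN].
rewrite mem_cat => /orP[/ysS|/zsS]; apply: spans_sub => z zi;
  by rewrite mem_cat zi ?orbT.
Qed.

Lemma homog_span_homog P d (z : P) : gm_comp P d z -> homog_span [:: z].
Proof.
(* [a] is N - d, since N is at least |d|. Writing z as the sum of (z mu) mu^* over the mu of length
   [a] moves the generators to degree N. *)
move=> zd; exists `|d|%N => N dN; pose a := `|(N%:Z - d)%R|%N.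
exists [seq z <* ep k (s : a.-tuple (edge E)) | s <- enum {: a.-tuple (edge E)}].
split=> [y /mapP [s _ ->]|x].
  have -> : N%:Z = d + a%:Z by rewrite /a; lia.
  by apply: ract_comp => //; have := ep_deg k s; rewrite size_tuple.
rewrite inE => /eqP ->.
have zE : z = \sum_(s : a.-tuple (edge E)) z <* ep k s <* gp k s.
  rewrite -[LHS]ract1 -(sum_ep_gp k noSink a) ract_sumr.
  by apply: eq_bigr => s _; rewrite ractA.
rewrite [X in spans _ _ X]zE; apply: spans_sum => s _; apply/spans_act/spans_mem.
by apply/mapP; exists s => //; rewrite mem_enum.
Qed.

Lemma homog_span1 P (x : P) : homog_span [:: x].
Proof.
have [s [c cC ->]] := homog_decomp x.
elim: s => [|n s [D DP]].
  rewrite big_nil; exists 0%N => N _; exists [::]; split=> // y.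
  by rewrite inE => /eqP ->; apply: spans0.
have [D' DP'] := homog_span_homog (cC n).
exists (maxn D D') => N; rewrite geq_max => /andP[DN DN'].
have [ys [ysN ysS]] := DP N DN; have [zs [zsN zsS]] := DP' N DN'.
exists (ys ++ zs); split=> [y|y].
  by rewrite mem_cat => /orP[/ysN|/zsN].
rewrite inE => /eqP ->; rewrite big_cons; apply: spansD.
  apply: (spans_sub (ys := zs)); last by apply: zsS; rewrite inE.
  by move=> z zi; rewrite mem_cat zi orbT.
apply: (spans_sub (ys := ys)); last by apply: ysS; rewrite inE.
by move=> z zi; rewrite mem_cat zi.
Qed.

Lemma homog_spanP P (l : seq P) : homog_span l.
Proof.
elim: l => [|x l IH]; first by exists 0%N => N _; exists [::].
exact: (homog_span_cat (homog_span1 x) IH).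
Qed.

Lemma fg_projective_frame (P : fgProjective R) :
  exists (N : int) (I : finType) (w : I -> vertex E), has_frame P N w.
Proof.
have [s sP] := fp_fg P; have [N /(_ N (leqnn N)) [ys [ysN ysS]]] := homog_spanP s.
have surj x : spans N ys x.
  have [c ->] := sP x; apply: spans_sum => i _; apply: spans_act.
  by apply: ysS; rewrite mem_nth.
have [|||h hC hE] := @fp_projective _ P _ _ (grlinear (@free_map_linear _ P N ys)) idfun.
- exact: free_map_hom.
- by [].
- exact: surj.
have [||H [HD HR HC HE]] := @free_map_coords _ P N ys h.
- by move=> r x y; rewrite linearP.
- exact: hC.
have F : dual_basis N (fun i : 'I_(size ys) => ys`_i) H.
  split=> // [i|x]; first by apply: ysN; rewrite mem_nth.
  by rewrite -HE; apply: esym (hE x).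
(* The entries of the matrix have degree 0; n is a cutting length that suits all of them at once. *)
have [|n nP] := @fin_scalar k E noSink _
    (fun p : 'I_(size ys) * 'I_(size ys) => H p.1 ys`_p.2).
  by move=> [i j] /=; have := HC i _ _ (db_deg F j); rewrite subrr.
have F' := dual_basis_ord (dual_basis_refine noSink n F).
have [|I [w Fw]] := dual_basis_frame noSink F'; last by exists (N%:Z + n%:Z), I, w.
move=> a b; rewrite HR mulrA.
by apply: (nP (_, _)); rewrite size_tuple.
Qed.

End FrameOfProjective.

(** * The graded projective modules vL *)

Section VertexModule.
Variables (k : fieldType) (E : graph) (v : vertex E).
Local Notation R := (leavitt k E).
Local Notation lv := (@lv k E).

(** The elements fixed by left multiplication with v are those of vL, a direct summand of the
    regular module; [vs_proj] is the projection through which projectivity is inherited. *)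
Definition vertex_pred : {pred greg R} := fun x => lv v * (x : R) == x :> R.

Lemma vertex_submod : submod_closed vertex_pred.
Proof.
split=> [|r x y]; rewrite !unfold_in; first by rewrite mulr0.
move=> /eqP xE /eqP yE; apply/eqP; transitivity (lv v * ((x : R) * (r : R) + (y : R))) => //.
by rewrite mulrDr mulrA xE yE.
Qed.

HB.instance Definition _ := GRing.isSubmodClosed.Build R^c (greg R) vertex_pred
  vertex_submod.

Record vertex_sub := VertexSub { vs_val : greg R; _ : vs_val \in vertex_pred }.
HB.instance Definition _ := [isSub for vs_val].
HB.instance Definition _ := [Choice of vertex_sub by <:].
HB.instance Definition _ := [SubChoice_isSubLmodule of vertex_sub by <:].

Lemma vs_lv (x : vertex_sub) : lv v * (val x : R) = val x.
Proof. by apply/eqP; have := valP x. Qed.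

Lemma vs_proj_subproof (x : greg R) : (lv v * (x : R) : greg R) \in vertex_pred.
Proof. by rewrite unfold_in mulrA lvM eqxx. Qed.
Definition vs_proj (x : greg R) : vertex_sub := VertexSub (vs_proj_subproof x).

Lemma vs_projK x : vs_proj (val x) = x.
Proof. by apply: val_inj; rewrite /= vs_lv. Qed.

Lemma vs_proj_linear : linear vs_proj.
Proof.
move=> r x y; apply: val_inj.
transitivity (lv v * ((x : R) * (r : R) + (y : R))) => //.
by rewrite mulrDr mulrA.
Qed.

Lemma vs_val_linear : linear (val : vertex_sub -> greg R).
Proof. exact: GRing.linearP. Qed.

Definition vs_comp (n : int) : set vertex_sub := [set x | gr_comp R n (val x)]%classic.

Lemma vs_grading : is_grading vs_comp.
Proof.
have pr n x : gr_comp R n x -> vs_comp n (vs_proj x).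
  by move=> Cx; rewrite /vs_comp /= -[n]add0r; apply: leavitt_mul Cx; apply: lv_deg.
have valS (s : seq int) (c : int -> vertex_sub) :
    val (\sum_(n <- s) c n) = \sum_(n <- s) (val (c n)).
  by apply: (big_morph val).
case: (gr_grading R) => C0 CB Cex Cun; split=> [n|n x y|x|s c us cC s0 n ns].
- exact: C0.
- exact: CB.
- have [s [c cC cE]] := Cex (val x); exists s, (fun n => vs_proj (c n)) => [n|].
    exact: pr.
  apply: val_inj; rewrite valS /= -[LHS]vs_lv [val x in LHS]cE mulr_sumr.
  by [].
- apply: val_inj; apply: (Cun s (fun n => val (c n))) => //.
  by rewrite -valS s0.
Qed.

Lemma vs_grscale m n (x : vertex_sub) (r : R) :
  vs_comp m x -> gr_comp R n r -> vs_comp (m + n) ((r : R^c) *: x).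
Proof.
move=> Cx Cr; have valZ : val ((r : R^c) *: x) = (r : R^c) *: val x by rewrite linearZ.
by rewrite /vs_comp /mkset valZ; apply: leavitt_mul.
Qed.

Definition vertex_mod : grModule R := GrModule vs_grading vs_grscale.

Lemma vertex_mod_gen (x : vertex_mod) : x = (vs_proj (1 : R) : vertex_mod) <* (val x : R).
Proof.
apply: val_inj; transitivity (lv v * 1 * (val x : R)) => //.
by rewrite mulr1 vs_lv.
Qed.

Lemma vertex_mod_fg : finitely_generated vertex_mod.
Proof.
exists [:: vs_proj (1 : R) : vertex_mod] => x; exists (fun=> val x : R).
by rewrite big_ord1 [LHS]vertex_mod_gen.
Qed.

Lemma vertex_mod_projective : graded_projective vertex_mod.
Proof.
move=> A B g f gC fC gs.
pose p : {linear greg R -> vertex_mod} := @grlinear R (greg R) vertex_mod vs_proj vs_proj_linear.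
have [|h hC hE] := @projective_reg R A B g (f \o p) gC _ gs.
  move=> n x Cx /=; apply: fC; rewrite /= /vs_comp /= -[n]add0r.
  by apply: leavitt_mul Cx; apply: lv_deg.
pose i : {linear vertex_mod -> greg R} :=
  @grlinear R vertex_mod (greg R) val vs_val_linear.
exists (h \o i) => [n x Cx|x] /=; first exact: hC.
by rewrite hE /= vs_projK.
Qed.

Definition fp_vertex : fgProjective R := FgProjective vertex_mod_fg vertex_mod_projective.

Lemma has_frame_vertex : has_frame fp_vertex 0 (fun _ : unit => v).
Proof.
exists (fun=> vs_proj (1 : R)), (fun _ x => val x : R).
split=> [_|_ x y|_ x r|_ n x Cx|_ x|[] []|x].
- by apply: (@leavitt_mul k E 0 0); [apply: lv_deg|apply: leavitt_one].
- exact: raddfD.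
- by have := vs_val_linear (r : R^c) x 0; rewrite !addr0.
- by rewrite subr0.
- exact: vs_lv.
- exact: mulr1.
- rewrite (bigD1 tt) // big1; last by case.
  exact: etrans (vertex_mod_gen x) (esym (addr0 _)).
Qed.

End VertexModule.

(** * Uniqueness of multiplicities up to powers of the adjacency matrix *)

Section FrameUniqueness.
Variables (k : fieldType) (E : graph).
Hypothesis noSink : forall v : vertex E, ~~ is_sink v.
Local Notation R := (leavitt k E).
Local Notation L := (leavitt_alg k E).
Local Notation lv := (@lv k E).
Implicit Types (P Q : grModule R).

(** At each vertex the coefficient matrices of the two changes of frame multiply to the identity
    over k: members at other vertices contribute nothing, since [vdiag] kills the corners between
    distinct vertices. *)
Lemma frame_card_le P N (I J : finType) (w : I -> vertex E) (w' : J -> vertex E)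
    b K b' K' : @frame k E P N I w b K -> @frame k E P N J w' b' K' ->
  (forall i j, vdiag (K i (b' j) : L)) -> (forall j i, vdiag (K' j (b i) : L)) ->
  forall v, (#|[pred i | w i == v]| <= #|[pred j | w' j == v]|)%N.
Proof.
move=> F F' diag diag' v.
have entry (I1 J1 : finType) (w1 : I1 -> vertex E) (w1' : J1 -> vertex E) b1 K1 b1' K1' i j :
    @frame k E P N I1 w1 b1 K1 -> @frame k E P N J1 w1' b1' K1' ->
    (K1 i (b1' j) : L) = lv (w1 i) * (K1 i (b1' j) : L) * lv (w1' j).
  by move=> F1 F1'; rewrite (fr_lv F1) -[in LHS](fr_blv F1') (fr_ract F1).
have /choice [C CE] : forall p : I * J, exists c : k,
    lv v * (K p.1 (b' p.2) : L) * lv v = c *: lv v.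
  by move=> [i j] /=; have [c] := diag i j v v; rewrite eqxx; exists c.
have /choice [C' CE'] : forall p : J * I, exists c : k,
    lv v * (K' p.1 (b p.2) : L) * lv v = c *: lv v.
  by move=> [j i] /=; have [c] := diag' j i v v; rewrite eqxx; exists c.
apply: (@card_inverse k _ _ _ _ (fun i j => C (i, j)) (fun j i => C' (j, i))).
move=> i i' /eqP iv /eqP i'v; apply: (@scaled_lv_inj k E noSink v).
transitivity (K i (b i') : L); last first.
  by rewrite (fr_dual F) iv; case: eqP; rewrite ?scale1r ?scale0r.
rewrite [b i' in RHS](fr_span F') (fr_sum F) scaler_suml.
rewrite [RHS](bigID (fun j => w' j == v)) /= [X in _ + X]big1 ?addr0 => [|j jv].
  apply: eq_bigr => j /eqP jv; rewrite (fr_ract F) (entry _ _ _ _ _ _ _ _ i j F F').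
  rewrite (entry _ _ _ _ _ _ _ _ j i' F' F) iv jv i'v (CE (i, j)) (CE' (j, i')) /=.
  by rewrite -leavitt_scaleAl -leavitt_scaleAr lvM eqxx scalerA.
rewrite (fr_ract F) (entry _ _ _ _ _ _ _ _ i j F F') iv.
have [c ->] := diag i j v (w' j).
by rewrite eq_sym (negPf jv) mul0r.
Qed.

Section Counting.
Variables (n : nat) (vt : 'I_n -> vertex E).
Hypothesis vt_bij : bijective vt.
Local Notation A := (adjm vt).

(** A lift of both frames multiplies the counts by A and absorbs one edge on either side of each
    entry. After m lifts the entries are vertex-diagonal and [frame_card_le] applies in both
    directions. *)
Lemma frame_cnt_scalar m P N (I J : finType) (w : I -> vertex E) (w' : J -> vertex E)
    b K b' K' : @frame k E P N I w b K -> @frame k E P N J w' b' K' ->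
  (forall i j, scalar_at m m (K i (b' j) : L)) ->
  (forall j i, scalar_at m m (K' j (b i) : L)) ->
  cnt vt w *m A ^+ m = cnt vt w' *m A ^+ m.
Proof.
elim: m N I J w w' b K b' K' => [|m IH] N I J w w' b K b' K' F F' sc sc'.
  have dg (x : L) : scalar_at 0 0 x -> vdiag x.
    by move=> /(_ [::] [::] erefl erefl); rewrite /= mul1r mulr1.
  congr (_ *m _); apply/rowP => j; rewrite !mxE.
  rewrite (sum_indicator [pred i | w i == vt j]).
  rewrite (sum_indicator [pred i | w' i == vt j]).
  congr (_%:R); apply: anti_leq.
  by rewrite !(frame_card_le F F', frame_card_le F' F) // => *; apply: dg.
rewrite exprS !mulmxA -!cnt_lift //.
apply: IH (frame_lift noSink F) (frame_lift noSink F') _ _ => p q s t ss st.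
  rewrite (fr_ract F) mulrA -(mulrA _ (lg _ _)).
  have := sc (val p).1 (val q).1 ((val p).2 :: s) ((val q).2 :: t).
  by rewrite /= ss st !mulrA; apply.
rewrite (fr_ract F') mulrA -(mulrA _ (lg _ _)).
have := sc' (val p).1 (val q).1 ((val p).2 :: s) ((val q).2 :: t).
by rewrite /= ss st !mulrA; apply.
Qed.

Lemma frame_cnt P Q N (I J : finType) (w : I -> vertex E) (w' : J -> vertex E) :
  graded_iso P Q -> has_frame P N w -> has_frame Q N w' ->
  exists m, cnt vt w *m A ^+ m = cnt vt w' *m A ^+ m.
Proof.
move=> PQ /(has_frame_iso PQ) [b [K F]] [b' [K' F']].
(* The sum type collects the entries of both changes of frame, so that one m serves them all. *)
have [|m sc] := @fin_scalar k E noSink _ (fun p : (I * J) + (J * I) =>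
    match p with inl p => K p.1 (b' p.2) | inr p => K' p.1 (b p.2) end).
  move=> [[i j]|[j i]] /=.
    by have := fr_Kdeg F i (fr_deg F' j); rewrite subrr.
  by have := fr_Kdeg F' j (fr_deg F i); rewrite subrr.
exists m; apply: frame_cnt_scalar F F' _ _ => [i j|j i].
  exact: (sc (inl (i, j))).
exact: (sc (inr (j, i))).
Qed.
End Counting.
End FrameUniqueness.

(** * From K0 to shift equivalence *)

Lemma mxpowD n (A : 'M[int]_n) a b : A ^+ (a + b) = A ^+ a *m A ^+ b.
Proof. exact: exprD. Qed.

Section FrameClasses.
Variables (k : fieldType) (E : graph).
Hypothesis noSink : forall v : vertex E, ~~ is_sink v.
Local Notation R := (leavitt k E).
Variables (n : nat) (vt : 'I_n -> vertex E).
Hypothesis vt_bij : bijective vt.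
Local Notation A := (adjm vt).
Implicit Types (P Q : fgProjective R).

Definition has_cnt P (N : int) (c : 'rV[int]_n) :=
  exists (I : finType) (w : I -> vertex E), has_frame P N w /\ cnt vt w = c.

Lemma has_cnt_lift P N (a : nat) c : has_cnt P N c -> has_cnt P (N + a%:Z) (c *m A ^+ a).
Proof.
move=> [I [w [F <-]]].
by have [J [w' [F' cw']]] := has_frame_lift noSink vt_bij a F; exists J, w'.
Qed.

Lemma has_cnt_sum P Q N c d :
  has_cnt P N c -> has_cnt Q N d -> has_cnt (fp_sum P Q) N (c + d).
Proof.
move=> [I [w [F <-]]] [J [w' [F' <-]]].
exists (I + J)%type, (fun ij => match ij with inl i => w i | inr j => w' j end).
by split; [apply: has_frame_sum|apply: cnt_sum].
Qed.

Lemma has_cnt_zero N : has_cnt (fp_zero R) N 0.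
Proof.
exists void, (of_void _); split; first exact: has_frame_zero.
by apply/rowP => j; rewrite !mxE big1 // => -[].
Qed.

Lemma has_cnt_shift P N a c : has_cnt P N c -> has_cnt (fp_shift a P) (N - a) c.
Proof. by move=> [I [w [F <-]]]; exists I, w; split=> //; apply: has_frame_shift. Qed.

Lemma has_cnt_reg : has_cnt (fp_reg R) 0 (const_mx 1).
Proof.
exists (vertex E), id; split; first exact: has_frame_reg.
apply/rowP => j; rewrite !mxE (sum_indicator (pred1 (vt j))) card1.
by [].
Qed.

Lemma has_cnt_vertex v : has_cnt (fp_vertex k v) 0 (cnt vt (fun _ : unit => v)).
Proof. by exists unit, (fun=> v); split=> //; apply: has_frame_vertex. Qed.

Lemma cnt_unit v j : cnt vt (fun _ : unit => v) 0 j = (v == vt j)%:R.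
Proof. by rewrite mxE (bigD1 tt) //= big1 ?addr0 //; case. Qed.

Lemma cnt_vt i : cnt vt (fun _ : unit => vt i) = delta_mx 0 i.
Proof.
apply/rowP => j; rewrite cnt_unit !mxE eqxx /=.
by rewrite (inj_eq (bij_inj vt_bij)) eq_sym.
Qed.

Lemma cnt_sum_unit (I : finType) (w : I -> vertex E) :
  cnt vt w = \sum_i cnt vt (fun _ : unit => w i).
Proof.
apply/rowP => j; rewrite summxE mxE; apply: eq_bigr => i _.
by rewrite cnt_unit.
Qed.

Lemma has_cnt_exists P : exists N c, has_cnt P N c.
Proof.
have [N [I [w F]]] := fg_projective_frame noSink P.
by exists N, (cnt vt w), I, w.
Qed.

Definition fp_bigsum (I : Type) (r : seq I) (F : I -> fgProjective R) :=
  foldr (fun i => fp_sum (F i)) (fp_zero R) r.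

Lemma has_cnt_bigsum (I : Type) (r : seq I) (F : I -> fgProjective R) N c :
  (forall i, has_cnt (F i) N (c i)) -> has_cnt (fp_bigsum r F) N (\sum_(i <- r) c i).
Proof.
move=> FN; elim: r => [|i r IH]; first by rewrite big_nil; apply: has_cnt_zero.
by rewrite big_cons; apply: has_cnt_sum.
Qed.

Lemma K0_class_iso P Q : graded_iso P Q -> K0_class P = K0_class Q.
Proof. by move=> PQ; apply: K0_eq_iso => //; apply: graded_iso_refl. Qed.

Lemma has_cnt_class P Q N c : has_cnt P N c -> has_cnt Q N c -> K0_class P = K0_class Q.
Proof.
move=> [I [w [F cw]]] [J [w' [F' cw']]]; apply: K0_class_iso.
by apply: (cnt_iso vt_bij) F F' _; rewrite cw cw'.
Qed.

(** Equal classes mean an isomorphism after adding some [T] to both sides; in a common degree the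
    vector of [T] cancels. *)
Lemma class_has_cnt P Q N c d : K0_class P = K0_class Q ->
  has_cnt P N c -> has_cnt Q N d -> exists m, c *m A ^+ m = d *m A ^+ m.
Proof.
move=> /(gc_classP (K0_congruence R)) [T PQ] Pc Qd.
have [M [t Tt]] := has_cnt_exists T.
(* [a] lifts P and Q, and [b] lifts T, to the common degree |M| + |N|. *)
pose a := `|(`|M| + `|N|)%N%:Z - N|%N; pose b := `|(`|M| + `|N|)%N%:Z - M|%N.
have MN : M + b%:Z = N + a%:Z by rewrite /a /b; lia.
have := has_cnt_lift b Tt; rewrite MN => Tb.
have [I [w [F cw]]] := has_cnt_sum (has_cnt_sum (has_cnt_lift a Pc) (has_cnt_zero _)) Tb.
have [J [w' [F' cw']]] := has_cnt_sum (has_cnt_sum (has_cnt_lift a Qd) (has_cnt_zero _)) Tb.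
have [m] := frame_cnt noSink vt_bij PQ F F'.
rewrite cw cw' !addr0 !mulmxDl => /addIr cd.
by exists (a + m)%N; rewrite mxpowD !mulmxA.
Qed.

End FrameClasses.

Section K0Transport.
Variables (k : fieldType) (E F : graph).
Hypothesis noSinkE : forall v : vertex E, ~~ is_sink v.
Hypothesis noSinkF : forall v : vertex F, ~~ is_sink v.
Variables (n m : nat) (vE : 'I_n -> vertex E) (vF : 'I_m -> vertex F).
Hypotheses (vE_bij : bijective vE) (vF_bij : bijective vF).
Local Notation A := (adjm vE).
Local Notation B := (adjm vF).
Variable phi : K0gr (leavitt k E) -> K0gr (leavitt k F).
Hypothesis phiL : K0_linear phi.
Hypothesis phi_pos : forall a, K0_pos a -> K0_pos (phi a).

Definition transports (N : nat) (D : 'M[int]_(n, m)) := forall P t c,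
  has_cnt vE P t c -> exists Q, phi (K0_class P) = K0_class Q /\
    has_cnt vF Q (N%:Z + t) (c *m D).

(** By positivity each [vL] goes to the class of a module, whose multiplicity vector in degree N is
    a row of D. By its frame, any P has the class of a sum of equally shifted vertex modules, so
    additivity and compatibility with shifts settle the rest. *)
Lemma K0_transports : exists N D, transports N D.
Proof.
have phiD := proj1 phiL; have phiS := K0_linear_shift phiL.
have /choice [Q QE] : forall v, exists Q, phi (K0_class (fp_vertex k v)) = K0_class Q.
  by move=> v; apply: phi_pos; exists (fp_vertex k v).
have /choice [M MP] : forall v, exists M, exists c, has_cnt vF (Q v) M c.
  by move=> v; apply: has_cnt_exists.
(* A bound for the degrees of all chosen frames, so that each of them can be lifted to degree N. *)
pose N := (\sum_v `|M v|)%N.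
have /choice [c cP] : forall v, exists c, has_cnt vF (Q v) N%:Z c.
  move=> v; have [c Qc] := MP v.
  have NM : M v + `|N%:Z - M v|%N%:Z = N%:Z.
    have : (`|M v| <= N)%N by rewrite /N (bigD1 v) //= leq_addr.
    by move: N => N' ?; lia.
  by rewrite -NM; eexists; apply: has_cnt_lift Qc.
exists N, (\matrix_i c (vE i)) => P t d [I [w [Fr <-]]].
pose S (v : vertex E) := fp_shift (- t) (fp_vertex k v).
pose S' v := fp_shift (- t) (Q v).
have SE v : phi (K0_class (S v)) = K0_class (S' v) by rewrite -K0_shiftE phiS QE K0_shiftE.
have PE : K0_class P = K0_class (fp_bigsum (index_enum I) (fun i => S (w i))).
  have Pc : has_cnt vE P t (cnt vE w) by exists I, w.
  apply: (has_cnt_class vE_bij Pc); rewrite cnt_sum_unit.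
  apply: has_cnt_bigsum => i.
  by rewrite -[t in has_cnt _ _ t]opprK -[- - t]add0r; apply/has_cnt_shift/has_cnt_vertex.
exists (fp_bigsum (index_enum I) (fun i => S' (w i))); split.
  rewrite PE; elim: (index_enum I) => [|i r IH] /=; first exact: (additive_K0_zero phiD).
  by rewrite !K0_classD phiD SE IH.
have -> : cnt vE w *m (\matrix_i c (vE i)) = \sum_i c (w i).
  rewrite (cnt_mul vE_bij w (G := c)) // => i.
  by rewrite rowK.
apply: has_cnt_bigsum => i; rewrite -[t]opprK; exact: has_cnt_shift.
Qed.
End K0Transport.

Lemma eventually_rows n p (A : 'M[int]_n) (X Y : 'M[int]_(p, n)) :
  (forall i, exists a, row i X *m A ^+ a = row i Y *m A ^+ a) ->
  exists a, X *m A ^+ a = Y *m A ^+ a.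
Proof.
move=> /fin_all_exists [a aP]; exists (\max_i a i)%N; apply/row_matrixP => i.
rewrite !row_mul -[(\max_i _)%N](@subnKC (a i)); last exact: leq_bigmax.
by rewrite mxpowD !mulmxA aP.
Qed.

Section TransportEquations.
Variables (k : fieldType) (E F : graph).
Hypothesis noSinkE : forall v : vertex E, ~~ is_sink v.
Hypothesis noSinkF : forall v : vertex F, ~~ is_sink v.
Variables (n m : nat) (vE : 'I_n -> vertex E) (vF : 'I_m -> vertex F).
Hypotheses (vE_bij : bijective vE) (vF_bij : bijective vF).
Local Notation A := (adjm vE).
Local Notation B := (adjm vF).
Variable phi : K0gr (leavitt k E) -> K0gr (leavitt k F).

Variables (N : nat) (D : 'M[int]_(n, m)).
Hypothesis DT : transports vE vF phi N D.

Lemma transports_unit : phi (K0_unit _) = K0_unit _ ->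
  exists a, const_mx 1 *m D *m B ^+ a = const_mx 1 *m B ^+ N *m B ^+ a :> 'rV[int]_m.
Proof.
move=> phi1; have [Q [QE Qc]] := DT (has_cnt_reg k vE).
apply: (class_has_cnt noSinkF vF_bij) Qc _; first by rewrite -QE; apply: phi1.
by rewrite addr0 -[N%:Z]add0r; apply: has_cnt_lift (has_cnt_reg k vF).
Qed.

(** The module at vertex i has the vector e_i in degree 0 and e_i A in degree 1. Transporting both
    describes one class twice, hence agreement up to a power of B. *)
Lemma transports_intertwine : exists a, A *m D *m B ^+ a = D *m B *m B ^+ a.
Proof.
apply: eventually_rows => i.
have Pc := has_cnt_vertex k vE (vE i).
have [Q [QE Qc]] := DT Pc; have [Q' [Q'E Qc']] := DT (has_cnt_lift noSinkE vE_bij 1 Pc).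
rewrite !rowE !mulmxA -(cnt_vt vE_bij).
apply: (class_has_cnt noSinkF vF_bij _ (N := N%:Z + (0 + 1)) (P := Q') (Q := Q)).
- by rewrite -QE -Q'E.
- exact: Qc'.
- by rewrite addrA; apply: (has_cnt_lift noSinkF vF_bij 1 Qc).
Qed.

Variables (psi : K0gr (leavitt k F) -> K0gr (leavitt k E)) (M : nat) (D' : 'M[int]_(m, n)).
Hypothesis DT' : transports vF vE psi M D'.
Hypothesis phiK : cancel phi psi.

Lemma transports_inverse :
  exists a, D *m D' *m A ^+ a = A ^+ (N + M) *m A ^+ a.
Proof.
apply: eventually_rows => i; have Pc := has_cnt_vertex k vE (vE i).
have [Q [QE Qc]] := DT Pc; have [Q' [Q'E Qc']] := DT' Qc.
rewrite !rowE !mulmxA -(cnt_vt vE_bij).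
apply: (class_has_cnt noSinkE vE_bij _ (N := 0 + (N + M)%N%:Z) (P := Q')
  (Q := fp_vertex k (vE i))).
- by rewrite -Q'E -QE phiK.
- by rewrite add0r; move: Qc'; rewrite addr0 addrC -PoszD.
- exact: has_cnt_lift.
Qed.
End TransportEquations.

(** Shift equivalence over the integers with lag N + N'. The last two equations record pointedness:
    u goes to u up to the N or N' steps by which D or D' raises degrees. *)
Definition shift_equivalent n m (A : 'M[int]_n) (B : 'M[int]_m) :=
  exists (N N' : nat) (D : 'M[int]_(n, m)) (D' : 'M[int]_(m, n)),
    [/\ A *m D = D *m B, B *m D' = D' *m A,
        D *m D' = A ^+ (N + N') /\ D' *m D = B ^+ (N + N'),
        const_mx 1 *m D = const_mx 1 *m B ^+ N :> 'rV[int]_m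
      & const_mx 1 *m D' = const_mx 1 *m A ^+ N' :> 'rV[int]_n].

Lemma mxpowC n (A : 'M[int]_n) a : A *m A ^+ a = A ^+ a *m A.
Proof. by rewrite -[LHS](exprS A) -[RHS](exprSr A). Qed.

Lemma intertwine_pow n m (A : 'M[int]_n) (B : 'M[int]_m) (D : 'M[int]_(n, m)) a :
  A *m D = D *m B -> A ^+ a *m D = D *m B ^+ a.
Proof.
move=> AD; elim: a => [|a IH]; first by rewrite !expr0 mul1mx mulmx1.
rewrite [A ^+ _](exprS A) -[_ * _]/(A *m A ^+ a) -mulmxA IH mulmxA AD -mulmxA.
by congr (D *m _); rewrite [RHS](exprS B).
Qed.

Lemma eventually_eq n p (A : 'M[int]_n) (X Y : 'M[int]_(p, n)) a b : (a <= b)%N ->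
  X *m A ^+ a = Y *m A ^+ a -> X *m A ^+ b = Y *m A ^+ b.
Proof. by move=> ab XY; rewrite -(subnKC ab) mxpowD !mulmxA XY. Qed.

(** Replacing D by D B^a and D' by D' A^a absorbs the powers up to which the equations hold; N and
    N' both grow by a. *)
Lemma eventual_shift_equivalent n m (A : 'M[int]_n) (B : 'M[int]_m) N N' D D' :
  (exists a, A *m D *m B ^+ a = D *m B *m B ^+ a) ->
  (exists a, B *m D' *m A ^+ a = D' *m A *m A ^+ a) ->
  (exists a, D *m D' *m A ^+ a = A ^+ (N + N') *m A ^+ a) ->
  (exists a, D' *m D *m B ^+ a = B ^+ (N' + N) *m B ^+ a) ->
  (exists a, const_mx 1 *m D *m B ^+ a = const_mx 1 *m B ^+ N *m B ^+ a :> 'rV[int]_m) ->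
  (exists a, const_mx 1 *m D' *m A ^+ a = const_mx 1 *m A ^+ N' *m A ^+ a :> 'rV[int]_n) ->
  shift_equivalent A B.
Proof.
move=> [a1 e1] [a2 e2] [a3 e3] [a4 e4] [a5 e5] [a6 e6].
pose a := (a1 + a2 + a3 + a4 + a5 + a6)%N.
have {}e1 := eventually_eq (b := a) _ e1; have {}e2 := eventually_eq (b := a) _ e2.
have {}e3 := eventually_eq (b := a) _ e3; have {}e4 := eventually_eq (b := a) _ e4.
have {}e5 := eventually_eq (b := a) _ e5; have {}e6 := eventually_eq (b := a) _ e6.
have i1 : A *m (D *m B ^+ a) = D *m B ^+ a *m B.
  by rewrite mulmxA e1; [rewrite -!mulmxA mxpowC|rewrite /a; lia].
have i2 : B *m (D' *m A ^+ a) = D' *m A ^+ a *m A.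
  by rewrite mulmxA e2; [rewrite -!mulmxA mxpowC|rewrite /a; lia].
exists (N + a)%N, (N' + a)%N, (D *m B ^+ a), (D' *m A ^+ a); split=> //.
- split.
    rewrite -mulmxA (intertwine_pow a i2) !mulmxA e3; last by rewrite /a; lia.
    by rewrite -!mxpowD; congr (A ^+ _); lia.
  rewrite -mulmxA (intertwine_pow a i1) !mulmxA e4; last by rewrite /a; lia.
  by rewrite -!mxpowD; congr (B ^+ _); lia.
- by rewrite mulmxA e5; [rewrite mxpowD mulmxA|rewrite /a; lia].
- by rewrite mulmxA e6; [rewrite mxpowD mulmxA|rewrite /a; lia].
Qed.

Lemma K0_shift_equivalent (k : fieldType) (E F : graph) (n m : nat)
    (vE : 'I_n -> vertex E) (vF : 'I_m -> vertex F)
    (phi : K0gr (leavitt k E) -> K0gr (leavitt k F)) :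
  (forall v : vertex E, ~~ is_sink v) -> (forall v : vertex F, ~~ is_sink v) ->
  bijective vE -> bijective vF ->
  bijective phi -> K0_linear phi -> K0_order_preserving phi -> K0_pointed phi ->
  shift_equivalent (adjm vE) (adjm vF).
Proof.
move=> sE sF bE bF [psi phiK psiK] [phiD phiA] phiO phi1.
have psiL : K0_linear psi.
  split=> [a b|p a]; apply: (can_inj phiK); rewrite psiK.
    by rewrite phiD !psiK.
  by rewrite phiA psiK.
have phi_pos a : K0_pos a -> K0_pos (phi a).
  by move=> aP; apply/phiO; exists a.
have psi_pos b : K0_pos b -> K0_pos (psi b).
  by move=> /phiO [a aP <-]; rewrite phiK.
have psi1 : psi (K0_unit _) = K0_unit _ by rewrite -phi1 phiK.
have [N [D DT]] := K0_transports sF bE bF (conj phiD phiA) phi_pos.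
have [N' [D' DT']] := K0_transports sE bF bE psiL psi_pos.
apply: (@eventual_shift_equivalent _ _ _ _ N N' D D').
- exact: transports_intertwine DT.
- exact: transports_intertwine DT'.
- exact: (transports_inverse sE bE DT DT' phiK).
- exact: (transports_inverse sF bF DT' DT psiK).
- exact: transports_unit DT phi1.
- exact: transports_unit DT' psi1.
Qed.

(** * Universal property of Leavitt path algebras *)

Section LeavittHom.
Variables (k : fieldType) (E F : graph).
Local Notation L := (leavitt_alg k E).
Local Notation T := (leavitt_alg k F).
Variables (hv : vertex E -> T) (he hg : edge E -> T).

Fixpoint lift_term (t : lterm k E) : T :=
  match t with
  | LVert v => hv v
  | LEdge e => he e
  | LGhost e => hg e
  | LZero => 0
  | LAdd s t => lift_term s + lift_term t
  | LOpp s => - lift_term s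
  | LScale a s => a *: lift_term s
  | LMul s t => lift_term s * lift_term t
  end.

Record leavitt_relations : Prop := LeavittRelations {
  lr_vv : forall v w, hv v * hv w = if v == w then hv v else 0;
  lr_se : forall e, hv (src e) * he e = he e;
  lr_er : forall e, he e * hv (rng e) = he e;
  lr_rg : forall e, hv (rng e) * hg e = hg e;
  lr_gs : forall e, hg e * hv (src e) = hg e;
  lr_ge : forall e f, hg e * he f = if e == f then hv (rng e) else 0;
  lr_eg : forall v, hv v = \sum_(e | src e == v) he e * hg e;
  lr_1 : \sum_v hv v = 1
}.

Hypothesis rel : leavitt_relations.

Lemma lift_term_congr s t : lcongr s t -> lift_term s = lift_term t.
Proof.
elim=> {s t} //=.
- by move=> s t u _ -> _ ->.
- by move=> s s' t t' _ -> _ ->.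
- by move=> s s' _ ->.
- by move=> a s s' _ ->.
- by move=> s s' t t' _ -> _ ->.
- by move=> s t u; rewrite addrA.
- by move=> s t; rewrite addrC.
- by move=> s; rewrite add0r.
- by move=> s; rewrite addNr.
- by move=> a b s; rewrite scalerA.
- by move=> s; rewrite scale1r.
- by move=> a s t; rewrite scalerDr.
- by move=> a b s; rewrite scalerDl.
- by move=> s t u; rewrite mulrA.
- by move=> s t u; rewrite mulrDl.
- by move=> s t u; rewrite mulrDr.
- by move=> a s t; rewrite leavitt_scaleAl.
- by move=> a s t; rewrite leavitt_scaleAr.
- by move=> v; rewrite (lr_vv rel) eqxx.
- by move=> v w /eqP/negPf vw; rewrite (lr_vv rel) vw.
- exact: (lr_se rel).
- exact: (lr_er rel).
- exact: (lr_rg rel).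
- exact: (lr_gs rel).
- by move=> e; rewrite (lr_ge rel) eqxx.
- by move=> e f /eqP/negPf ef; rewrite (lr_ge rel) ef.
- move=> v _; rewrite (lr_eg rel) (big_morph lift_term (id1 := 0) (op1 := +%R)) //.
Qed.

Definition leavitt_map (x : L) : T := lift_term (repr x).

Lemma leavitt_mapE t : leavitt_map (lcls t) = lift_term t.
Proof. by apply: lift_term_congr; apply: lrepr_cls. Qed.

Lemma leavitt_map_zmod : zmod_morphism leavitt_map.
Proof.
elim/lclsW=> s; elim/lclsW=> t.
by rewrite -lclsN -lclsD !leavitt_mapE.
Qed.

Lemma leavitt_map_monoid : monoid_morphism leavitt_map.
Proof.
split; last by elim/lclsW=> s; elim/lclsW=> t; rewrite -lclsM !leavitt_mapE.
have -> : (1 : L) = lcls (\big[LAdd (E:=E)/LZero k E]_(v : vertex E) LVert k v).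
  by rewrite lcls_sum.
rewrite leavitt_mapE (big_morph lift_term (id1 := 0) (op1 := +%R)) //.
exact: (lr_1 rel).
Qed.

HB.instance Definition _ := GRing.isZmodMorphism.Build L T leavitt_map leavitt_map_zmod.
HB.instance Definition _ := GRing.isMonoidMorphism.Build L T leavitt_map
  leavitt_map_monoid.

Definition leavitt_hom : {rmorphism L -> T} := leavitt_map.

Lemma leavitt_hom_vert v : leavitt_hom (lv k v) = hv v.
Proof. exact: leavitt_mapE. Qed.
Lemma leavitt_hom_edge e : leavitt_hom (le k e) = he e.
Proof. exact: leavitt_mapE. Qed.
Lemma leavitt_hom_ghost e : leavitt_hom (lg k e) = hg e.
Proof. exact: leavitt_mapE. Qed.
Lemma leavitt_homZ a x : leavitt_hom (a *: x) = a *: leavitt_hom x.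
Proof. by elim/lclsW: x => t; rewrite -lclsZ /leavitt_hom /= !leavitt_mapE. Qed.

Lemma leavitt_hom_graded :
  (forall v, leavitt_comp 0 (hv v)) -> (forall e, leavitt_comp 1 (he e)) ->
  (forall e, leavitt_comp (-1) (hg e)) ->
  forall n x, leavitt_comp n x -> leavitt_comp n (leavitt_hom x).
Proof.
move=> Cv Ce Cg n _ [t th ->]; rewrite /leavitt_hom /= leavitt_mapE.
have [C0 CB _ _] := leavitt_grading k F.
elim: th => {n t} //= [n s t _ Cs _ Ct|n s _ Cs|n a s _ Cs|m n s t _ Cs _ Ct].
- exact: (@comp_add _ (greg (leavitt k F))).
- by rewrite -sub0r; apply: CB.
- exact: comp_scale.
- exact: leavitt_mul.
Qed.
End LeavittHom.

Lemma leavitt_ext (k : fieldType) (E : graph) (L := leavitt_alg k E) (f : {rmorphism L -> L}) : (forall a x, f (a *: x) = a *: f x) ->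
  (forall v, f (lv k v) = lv k v) -> (forall e, f (le k e) = le k e) ->
  (forall e, f (lg k e) = lg k e) -> forall x, f x = x.
Proof.
move=> fZ fv fe fg; elim/lclsW; elim=> [v|e|e||s IHs t IHt|s IHs|a s IHs|s IHs t IHt].
- exact: fv.
- exact: fe.
- exact: fg.
- exact: (rmorph0 f).
- by rewrite lclsD rmorphD IHs IHt.
- by rewrite lclsN rmorphN IHs.
- by rewrite lclsZ fZ IHs.
- by rewrite lclsM rmorphM IHs IHt.
Qed.

(** * Computing with monomials *)

Definition bmatrix := seq (seq bool).
Definition adj (M : bmatrix) i j := nth false (nth [::] M i) j.

(* A pair [(mu, nu)] of vertex sequences stands for the monomial mu nu^*,
   a list of pairs for the sum of its monomials. *)
Definition mono := (seq nat * seq nat)%type.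

Section Monomials.
Variable M : bmatrix.

(** The product nu^* mu is nonzero only if one path is an initial segment of the other; the
    remainder is left, as a path or as a ghost path. The test of [adj] discards shared steps along
    which there is no edge. *)
Fixpoint cancel_paths (nu mu : seq nat) : seq mono :=
  match nu, mu with
  | i :: nu', i' :: mu' =>
      if i == i' then
        match nu', mu' with
        | [::], _ => [:: (mu, [:: last i mu'])]
        | _, [::] => [:: ([:: last i nu'], nu)]
        | j :: _, j' :: _ => if (j == j') && adj M i j then cancel_paths nu' mu' else [::]
        end
      else [::]
  | _, _ => [::]
  end.

Definition cat_path (s t : seq nat) : option (seq nat) :=
  match s, t with
  | i :: s', j :: t' => if last i s' == j then Some (s ++ t') else None
  | _, _ => None
  end.

Definition mul_mono (x y : mono) : seq mono :=
  flatten [seq (match cat_path x.1 z.1, cat_path y.2 z.2 with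
                | Some s, Some t => [:: (s, t)]
                | _, _ => [::]
                end) | z <- cancel_paths x.2 y.1].

Definition mul_terms (l l' : seq mono) : seq mono :=
  flatten [seq flatten [seq mul_mono x y | y <- l'] | x <- l].

(** (CK2) inserted at the common end: mu nu^* is the sum of the (mu e)(nu e)^*. Different ends give
    0. *)
Definition expand_mono (x : mono) : seq mono :=
  match x with
  | (i :: s, j :: t) =>
      if last i s == last j t then
        [seq (rcons (i :: s) w, rcons (j :: t) w) | w <- iota 0 3 & adj M (last i s) w]
      else [::]
  | _ => [::]
  end.

Definition expand_to (n : nat) (l : seq mono) : seq mono :=
  iter n (fun l => flatten [seq if (size x.2 < n)%N then expand_mono x else [:: x] | x <- l]) l.

(** (CK2) lets one element be written in many ways. Expanding all ghost parts to the greatest length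
    present makes the two sides comparable as multisets of monomials. *)
Definition eq_terms (l l' : seq mono) : bool :=
  let n := foldr (fun x m => maxn (size x.2) m) 0%N (l ++ l') in
  perm_eq (expand_to n l) (expand_to n l').

Section Evaluation.
Variables (T : pzRingType) (p : nat -> T) (e g : nat -> nat -> T).

(** Generators are indexed by natural numbers, with e i j = 0 where there is no edge, so that lists
    can be evaluated without dependent indices. *)
Record leavitt_family : Prop := LeavittFamily {
  lf_pp : forall i j, p i * p j = if i == j then p i else 0;
  lf_pe : forall i j l, p i * e j l = if i == j then e j l else 0;
  lf_ep : forall i j l, e j l * p i = if l == i then e j l else 0;
  lf_pg : forall i j l, p i * g j l = if i == l then g j l else 0;
  lf_gp : forall i j l, g j l * p i = if j == i then g j l else 0;
  lf_ge : forall i j j', g i j * e i j' = if (j == j') && adj M i j then p j else 0;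
  lf_e0 : forall i j, ~~ adj M i j -> e i j = 0;
  lf_eg : forall i, p i = \sum_(0 <= j < 3) e i j * g i j
}.

Hypothesis fam : leavitt_family.

(** A path of n edges is a sequence of n + 1 vertices; the empty sequence stands for no path and
    gives 0. *)
Fixpoint eval_path (s : seq nat) : T :=
  match s with
  | [::] => 0
  | i :: t => if t is j :: _ then e i j * eval_path t else p i
  end.

Fixpoint eval_ghost (s : seq nat) : T :=
  match s with
  | [::] => 0
  | i :: t => if t is j :: _ then eval_ghost t * g i j else p i
  end.

Definition eval_mono (x : mono) : T := eval_path x.1 * eval_ghost x.2.
Definition eval_terms (l : seq mono) : T := \sum_(x <- l) eval_mono x.

Lemma p_eval_path i j s : p i * eval_path (j :: s) = if i == j then eval_path (j :: s) else 0.
Proof.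
case: s => [|l s]; first by rewrite /= (lf_pp fam); case: eqP => [->|].
by rewrite /= mulrA (lf_pe fam); case: eqP; rewrite ?mul0r.
Qed.

Lemma eval_path_p i j s : eval_path (j :: s) * p i = if last j s == i then eval_path (j :: s) else 0.
Proof.
elim: s j => [|l s IH] j; first by rewrite /= (lf_pp fam).
rewrite [eval_path _]/= -mulrA IH /=; case: eqP => // _; exact: mulr0.
Qed.

Lemma eval_ghost_p i j s : eval_ghost (j :: s) * p i = if j == i then eval_ghost (j :: s) else 0.
Proof.
case: s => [|l s]; first by rewrite /= (lf_pp fam).
by rewrite /= -mulrA (lf_gp fam); case: eqP; rewrite ?mulr0.
Qed.

Lemma p_eval_ghost i j s : p i * eval_ghost (j :: s) = if i == last j s then eval_ghost (j :: s) else 0.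
Proof.
elim: s j => [|l s IH] j; first by rewrite /= (lf_pp fam); case: eqP => [->|].
rewrite [eval_ghost _]/= mulrA IH /=; case: eqP => // _; exact: mul0r.
Qed.

Lemma eval_terms_nil : eval_terms [::] = 0. Proof. exact: big_nil. Qed.
Lemma eval_terms1 x : eval_terms [:: x] = eval_mono x. Proof. exact: big_seq1. Qed.
Lemma eval_terms_flatten (I : Type) (r : seq I) (f : I -> seq mono) :
  eval_terms (flatten [seq f i | i <- r]) = \sum_(i <- r) eval_terms (f i).
Proof. by rewrite /eval_terms big_flatten /= big_map. Qed.

Lemma eval_cancel nu mu :
  eval_ghost nu * eval_path mu = eval_terms (cancel_paths nu mu).
Proof.
elim: nu mu => [|i nu IH] [|i' mu]; rewrite ?eval_terms_nil ?mul0r ?mulr0 //.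
rewrite [cancel_paths _ _]/=; case: (i =P i') => [<-|/eqP/negPf ii']; last first.
  have := eval_ghost_p i i nu; rewrite eqxx => <-.
  by rewrite -mulrA p_eval_path ii' mulr0 eval_terms_nil.
case: nu IH => [|j nu] IH.
  rewrite eval_terms1 /eval_mono p_eval_path eqxx.
  by rewrite eval_path_p eqxx.
case: mu => [|j' mu].
  have := p_eval_ghost (last j nu) i (j :: nu); have := eval_ghost_p i i (j :: nu).
  by rewrite !eqxx eval_terms1 => + E'; rewrite /eval_mono /= in E' *; rewrite E'.
have -> : eval_ghost [:: i, j & nu] * eval_path [:: i, j' & mu] =
    eval_ghost (j :: nu) * (g i j * e i j') * eval_path (j' :: mu) by rewrite !mulrA.
rewrite (lf_ge fam); case: ifP => [/andP[/eqP jj _]|_].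
  by rewrite -mulrA jj p_eval_path eqxx -jj IH.
by rewrite mulr0 mul0r eval_terms_nil.
Qed.

Lemma eval_cat_path s t :
  eval_path s * eval_path t = if cat_path s t is Some u then eval_path u else 0.
Proof.
case: s t => [|i s] [|j t]; rewrite ?mul0r ?mulr0 //=.
elim: s i => [|l s IH] i.
  rewrite p_eval_path /=; case: eqP => [->|//].
  by [].
by rewrite -mulrA IH /=; case: eqP => //= _; rewrite ?mulr0.
Qed.

Lemma eval_cat_ghost s t :
  eval_ghost t * eval_ghost s = if cat_path s t is Some u then eval_ghost u else 0.
Proof.
case: s t => [|i s] [|j t]; rewrite ?mul0r ?mulr0 //=.
elim: s i => [|l s IH] i.
  by rewrite eval_ghost_p /= eq_sym; case: eqP => [->|//].
by rewrite mulrA IH /=; case: eqP => //= _; rewrite ?mul0r.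
Qed.

Lemma eval_mul_mono x y : eval_mono x * eval_mono y = eval_terms (mul_mono x y).
Proof.
case: x y => [m n] [m' n']; rewrite /mul_mono eval_terms_flatten /=.
have -> : eval_mono (m, n) * eval_mono (m', n') =
    eval_path m * (eval_ghost n * eval_path m') * eval_ghost n' by rewrite /eval_mono !mulrA.
rewrite eval_cancel mulr_sumr mulr_suml; apply: eq_bigr => z _.
have -> : eval_path m * eval_mono z * eval_ghost n' =
    (eval_path m * eval_path z.1) * (eval_ghost z.2 * eval_ghost n') by rewrite !mulrA.
rewrite eval_cat_path eval_cat_ghost.
case: cat_path => [s|]; last by rewrite mul0r eval_terms_nil.
case: cat_path => [t|]; last by rewrite mulr0 eval_terms_nil.
by rewrite eval_terms1.
Qed.

Lemma eval_mul_terms l l' : eval_terms l * eval_terms l' = eval_terms (mul_terms l l').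
Proof.
rewrite eval_terms_flatten mulr_suml; apply: eq_bigr => x _.
rewrite eval_terms_flatten mulr_sumr; apply: eq_bigr => y _.
exact: eval_mul_mono.
Qed.

Lemma eval_rcons_path i s w : eval_path (rcons (i :: s) w) = eval_path (i :: s) * e (last i s) w.
Proof.
elim: s i => [|j s IH] i.
  by rewrite /= (lf_ep fam) eqxx (lf_pe fam) eqxx.
have -> : eval_path (rcons [:: i, j & s] w) = e i j * eval_path (rcons (j :: s) w) by [].
by rewrite IH mulrA.
Qed.

Lemma eval_rcons_ghost i s w : eval_ghost (rcons (i :: s) w) = g (last i s) w * eval_ghost (i :: s).
Proof.
elim: s i => [|j s IH] i.
  by rewrite /= (lf_pg fam) eqxx (lf_gp fam) eqxx.
have -> : eval_ghost (rcons [:: i, j & s] w) = eval_ghost (rcons (j :: s) w) * g i j by [].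
by rewrite IH mulrA.
Qed.

Lemma eval_expand_mono x : eval_terms (expand_mono x) = eval_mono x.
Proof.
case: x => [[|i s] [|j t]]; rewrite ?eval_terms_nil /eval_mono ?mul0r ?mulr0 //.
rewrite /expand_mono; case: eqP => [lst|/eqP/negPf lst]; last first.
  have := eval_path_p (last i s) i s; rewrite eqxx => <-.
  by rewrite -mulrA p_eval_ghost lst mulr0 eval_terms_nil.
rewrite /eval_terms big_map big_filter.
have := eval_path_p (last i s) i s; rewrite eqxx => <-.
rewrite (lf_eg fam) mulr_sumr mulr_suml big_mkcond /=.
rewrite /index_iota subn0; apply: eq_bigr => w _.
rewrite /eval_mono [(_, _).1]/= [(_, _).2]/= -!rcons_cons eval_rcons_path eval_rcons_ghost -lst.
case: ifP => [_|/negbT/(lf_e0 fam) ->]; rewrite ?mulrA //.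
by rewrite mulr0 !mul0r.
Qed.

Lemma eval_expand_to n l : eval_terms (expand_to n l) = eval_terms l.
Proof.
rewrite /expand_to; elim: {1}n => //= m IH; rewrite -[RHS]IH eval_terms_flatten.
by apply: eq_bigr => x _; case: ifP => _; rewrite ?eval_expand_mono ?eval_terms1.
Qed.

Lemma eq_termsP l l' : eq_terms l l' -> eval_terms l = eval_terms l'.
Proof.
rewrite /eq_terms; move: (foldr _ _ _) => n ll'.
rewrite -(eval_expand_to n l) -(eval_expand_to n l'); exact: perm_big.
Qed.
End Evaluation.
End Monomials.

(** * Graphs presented by boolean matrices *)

Record presentation (E : graph) (M : bmatrix) (vt : 'I_3 -> vertex E)
    (idx : vertex E -> 'I_3) : Prop := Presentation {
  pr_vtK : cancel vt idx;
  pr_idxK : cancel idx vt;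
  pr_parallel : no_parallel_edges E;
  pr_sink : forall v : vertex E, ~~ is_sink v;
  pr_adj : forall i j : nat, adj M i j =
    [exists e : edge E, (idx (src e) == i :> nat) && (idx (rng e) == j :> nat)]
}.

Definition presented E M := exists vt idx, @presentation E M vt idx.

Section PresentedFamily.
Variables (k : fieldType) (E : graph) (M : bmatrix).
Variables (vt : 'I_3 -> vertex E) (idx : vertex E -> 'I_3).
Hypothesis pr : presentation M vt idx.
Local Notation L := (leavitt_alg k E).

(** A sum with at most one term, so that an index out of range gives 0. *)
Definition vert_at (i : nat) : L := \sum_(v | idx v == i :> nat) lv k v.
Definition edge_at (i j : nat) : L :=
  \sum_(e | (idx (src e) == i :> nat) && (idx (rng e) == j :> nat)) le k e.
Definition ghost_at (i j : nat) : L :=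
  \sum_(e | (idx (src e) == i :> nat) && (idx (rng e) == j :> nat)) lg k e.

Lemma idx_eq v w : (idx v == idx w :> nat) = (v == w).
Proof. by rewrite val_eqE (inj_eq (can_inj (pr_idxK pr))). Qed.

Lemma vert_at_idx v : vert_at (idx v) = lv k v.
Proof. by rewrite /vert_at (eq_bigl (pred1 v)) ?big_pred1_eq // => w; rewrite idx_eq. Qed.

Lemma edge_pred e f : (idx (src f) == idx (src e) :> nat) && (idx (rng f) == idx (rng e) :> nat)
  = (f == e).
Proof.
rewrite !idx_eq; apply/andP/eqP => [[/eqP se /eqP re]|->]; last by rewrite !eqxx.
exact: (pr_parallel pr).
Qed.

Lemma edge_at_idx e : edge_at (idx (src e)) (idx (rng e)) = le k e.
Proof. by rewrite /edge_at (eq_bigl (pred1 e)) ?big_pred1_eq // => f; rewrite edge_pred. Qed.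

Lemma ghost_at_idx e : ghost_at (idx (src e)) (idx (rng e)) = lg k e.
Proof. by rewrite /ghost_at (eq_bigl (pred1 e)) ?big_pred1_eq // => f; rewrite edge_pred. Qed.

Lemma adj_edge e : adj M (idx (src e)) (idx (rng e)).
Proof. by rewrite (pr_adj pr); apply/existsP; exists e; rewrite !eqxx. Qed.

Variant vert_at_spec (i : nat) : nat -> L -> Prop :=
| VertAt v of i = idx v : vert_at_spec i (idx v) (lv k v)
| NoVertAt of (3 <= i)%N : vert_at_spec i i 0.

Lemma vert_atP i : vert_at_spec i i (vert_at i).
Proof.
have [i3|i3] := ltnP i 3.
  have E' : i = idx (vt (Ordinal i3)) by rewrite (pr_vtK pr).
  by rewrite {2 3}E' vert_at_idx; constructor.
rewrite /vert_at big1 => [|v /eqP vi]; first exact: NoVertAt.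
by have := ltn_ord (idx v); rewrite vi ltnNge i3.
Qed.

Variant edge_at_spec : nat -> nat -> L -> L -> bool -> Prop :=
| EdgeAt e : edge_at_spec (idx (src e)) (idx (rng e)) (le k e) (lg k e) true
| NoEdgeAt i j : edge_at_spec i j 0 0 false.

Lemma edge_atP i j : edge_at_spec i j (edge_at i j) (ghost_at i j) (adj M i j).
Proof.
rewrite (pr_adj pr); case: existsP => [[e /andP[/eqP <- /eqP <-]]|no].
  by rewrite edge_at_idx ghost_at_idx; constructor.
by rewrite /edge_at /ghost_at !big1 => [|e ij|e ij]; [constructor| |]; case: no; exists e.
Qed.

Lemma presented_family : leavitt_family M vert_at edge_at ghost_at.
Proof.
split=> [i j|i j l|i j l|i j l|i j l|i j j'|i j|i].
- case: (vert_atP i) => [v _|i3]; case: (vert_atP j) => [w _|j3];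
    rewrite ?mul0r ?mulr0 ?if_same // ?lvM ?idx_eq //.
  by case: eqP => // vj; have := ltn_ord (idx v); rewrite vj ltnNge j3.
- case: edge_atP => [e|? ?]; last by rewrite mulr0 if_same.
  case: vert_atP => [v _|i3]; first by rewrite lv_le idx_eq.
  by rewrite mul0r; case: eqP => // ij; have := ltn_ord (idx (src e)); rewrite -ij ltnNge i3.
- case: edge_atP => [e|? ?]; last by rewrite mul0r if_same.
  case: vert_atP => [v _|i3]; first by rewrite le_lv idx_eq.
  by rewrite mulr0; case: eqP => // ij; have := ltn_ord (idx (rng e)); rewrite ij ltnNge i3.
- case: edge_atP => [e|? ?]; last by rewrite mulr0 if_same.
  case: vert_atP => [v _|i3]; first by rewrite lv_lg idx_eq.
  by rewrite mul0r; case: eqP => // ij; have := ltn_ord (idx (rng e)); rewrite -ij ltnNge i3.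
- case: edge_atP => [e|? ?]; last by rewrite mul0r if_same.
  case: vert_atP => [v _|i3]; first by rewrite lg_lv idx_eq.
  by rewrite mulr0; case: eqP => // ij; have := ltn_ord (idx (src e)); rewrite ij ltnNge i3.
- have [/eqP <-|jj'] /= := boolP (j == j').
    case: edge_atP => [e|? ?]; last by rewrite mul0r.
    by rewrite lg_le eqxx vert_at_idx.
  case: (edge_atP i j) jj' => [e|? ?] jj'; last by rewrite mul0r.
  rewrite mulr_sumr big1 // => f /andP[_ /eqP fj'].
  by rewrite lg_le; case: eqP => // ef; rewrite ef fj' eqxx in jj'.
- by case: edge_atP.
- case: (vert_atP i) => [v _|i3]; last first.
    rewrite big1 // => j _; rewrite /edge_at big1 ?mul0r // => e /andP[/eqP ei].
    by have := ltn_ord (idx (src e)); rewrite ei ltnNge i3.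
  rewrite -(le_lg k (pr_sink pr v)) (partition_big (fun e => idx (rng e)) xpredT) //=.
  rewrite big_mkord; apply: eq_bigr => j _; rewrite /edge_at mulr_suml.
  apply: eq_big => [e|e /andP[/eqP sv /eqP rj]]; first by rewrite idx_eq.
  by rewrite -sv -rj ghost_at_idx.
Qed.

Lemma vert_at_deg i : leavitt_comp 0 (vert_at i).
Proof.
case: vert_atP => [v _|_]; first exact: lv_deg.
by have [C0 _ _ _] := leavitt_grading k E; apply: C0.
Qed.
Lemma edge_at_deg i j : leavitt_comp 1 (edge_at i j).
Proof.
case: edge_atP => [e|? ?]; first exact: le_deg.
by have [C0 _ _ _] := leavitt_grading k E; apply: C0.
Qed.
Lemma ghost_at_deg i j : leavitt_comp (-1) (ghost_at i j).
Proof.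
case: edge_atP => [e|? ?]; first exact: lg_deg.
by have [C0 _ _ _] := leavitt_grading k E; apply: C0.
Qed.

Definition eval : seq mono -> L := eval_terms vert_at edge_at ghost_at.

Lemma eval_path_deg s : leavitt_comp ((size s)%:Z - 1) (eval_path vert_at edge_at s).
Proof.
have [C0 _ _ _] := leavitt_grading k E.
elim: s => [|i [|j s] IH]; first exact: C0.
  exact: vert_at_deg.
have -> : (size [:: i, j & s])%:Z - 1 = 1 + ((size (j :: s))%:Z - 1) by rewrite /=; lia.
by apply: leavitt_mul IH; apply: edge_at_deg.
Qed.

Lemma eval_ghost_deg s : leavitt_comp (1 - (size s)%:Z) (eval_ghost vert_at ghost_at s).
Proof.
have [C0 _ _ _] := leavitt_grading k E.
elim: s => [|i [|j s] IH]; first exact: C0.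
  exact: vert_at_deg.
have -> : 1 - (size [:: i, j & s])%:Z = (1 - (size (j :: s))%:Z) - 1 by rewrite /=; lia.
by apply: leavitt_mul IH _; apply: ghost_at_deg.
Qed.

Lemma eval_deg n (l : seq mono) :
  all (fun x => (size x.1)%:Z - (size x.2)%:Z == n) l -> leavitt_comp n (eval l).
Proof.
move=> ln; rewrite /eval /eval_terms big_seq.
apply: (@comp_sum _ (greg (leavitt k E))) => x xl.
have /eqP <- := allP ln x xl.
have -> : (size x.1)%:Z - (size x.2)%:Z = ((size x.1)%:Z - 1) + (1 - (size x.2)%:Z) by lia.
by apply: leavitt_mul; [apply: eval_path_deg|apply: eval_ghost_deg].
Qed.

End PresentedFamily.

(* Images of the vertices and edges of a three-vertex graph, as sums of monomials
   over another one; ghosts go to the adjoint sums. *)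
Definition hom_data := (seq (seq mono) * seq (seq (seq mono)))%type.

(** * Homomorphisms checked on lists of monomials *)

Section HomData.
Variables (M M' : bmatrix) (d : hom_data).

Definition img_vert i : seq mono := if (i < 3)%N then nth [::] d.1 i else [::].
Definition img_edge i j : seq mono :=
  if adj M i j then nth [::] (nth [::] d.2 i) j else [::].
Definition img_ghost i j : seq mono := [seq (x.2, x.1) | x <- img_edge i j].

Definition edges : seq (nat * nat) :=
  [seq p <- [seq (i, j) | i <- iota 0 3, j <- iota 0 3] | adj M p.1 p.2].

(** The clauses cover [leavitt_relations]: products of vertices, sources and ranges, (CK1), (CK2),
    the unit. The last two force degree 0 on vertices and degree 1 on edges, hence a graded map. *)
Definition check_hom : bool :=
  let eqt := eq_terms M' in let mult := mul_terms M' in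
  [&& all (fun i => all (fun j => eqt (mult (img_vert i) (img_vert j))
        (if i == j then img_vert i else [::])) (iota 0 3)) (iota 0 3),
      all (fun p => let e := img_edge p.1 p.2 in let g := img_ghost p.1 p.2 in
        [&& eqt (mult (img_vert p.1) e) e, eqt (mult e (img_vert p.2)) e,
            eqt (mult (img_vert p.2) g) g & eqt (mult g (img_vert p.1)) g]) edges,
      all (fun p => all (fun q => eqt (mult (img_ghost p.1 p.2) (img_edge q.1 q.2))
        (if p == q then img_vert p.2 else [::])) edges) edges,
      all (fun i => eqt (img_vert i)
        (flatten [seq mult (img_edge i j) (img_ghost i j) | j <- iota 0 3])) (iota 0 3),
      eqt (flatten [seq img_vert i | i <- iota 0 3]) [seq ([:: i], [:: i]) | i <- iota 0 3],
      all (fun i => all (fun x : mono => size x.1 == size x.2) (img_vert i)) (iota 0 3)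
    & all (fun p => all (fun x : mono => size x.1 == (size x.2).+1) (img_edge p.1 p.2)) edges].

(** The image of a path computed on lists, so that the composite of two homomorphisms stays within
    the arithmetic of monomials. *)
Fixpoint subst_path (s : seq nat) : seq mono :=
  if s is i :: t then
    if t is j :: _ then mul_terms M' (img_edge i j) (subst_path t) else img_vert i
  else [::].
Fixpoint subst_ghost (s : seq nat) : seq mono :=
  if s is i :: t then
    if t is j :: _ then mul_terms M' (subst_ghost t) (img_ghost i j) else img_vert i
  else [::].
Definition subst_terms (l : seq mono) : seq mono :=
  flatten [seq mul_terms M' (subst_path x.1) (subst_ghost x.2) | x <- l].

Lemma edges_mem i j : (i < 3)%N -> (j < 3)%N -> adj M i j -> (i, j) \in edges.
Proof.
move=> i3 j3 ij; rewrite mem_filter ij; apply/allpairsP; exists (i, j).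
by rewrite !mem_iota /= !add0n i3 j3.
Qed.
End HomData.

Section PresentedHom.
Variables (k : fieldType) (E F : graph) (M M' : bmatrix).
Variables (vt : 'I_3 -> vertex E) (idx : vertex E -> 'I_3).
Variables (vt' : 'I_3 -> vertex F) (idx' : vertex F -> 'I_3).
Hypotheses (pr : presentation M vt idx) (pr' : presentation M' vt' idx').
Variable d : hom_data.
Hypothesis chk : check_hom M M' d.
Local Notation ev := (eval k idx').

Let hv v := ev (img_vert d (idx v)).
Let he e := ev (img_edge M d (idx (src e)) (idx (rng e))).
Let hg e := ev (img_ghost M d (idx (src e)) (idx (rng e))).

Let evM l l' : ev l * ev l' = ev (mul_terms M' l l').
Proof. exact: eval_mul_terms (presented_family k pr') l l'. Qed.

Let evE l l' : eq_terms M' l l' -> ev l = ev l'.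
Proof. exact: eq_termsP (presented_family k pr') l l'. Qed.

Let ev0 : ev [::] = 0. Proof. exact: eval_terms_nil. Qed.

Let edge_in e : (nat_of_ord (idx (src e)), nat_of_ord (idx (rng e))) \in edges M.
Proof. by apply: edges_mem; rewrite ?ltn_ord //; apply: (adj_edge pr). Qed.

Let ord_in (i : 'I_3) : nat_of_ord i \in iota 0 3.
Proof. by rewrite mem_iota add0n ltn_ord. Qed.

Lemma presented_relations : leavitt_relations hv he hg.
Proof.
case/and5P: chk => vv ve ge eg /and3P[one _ _].
split=> [v w|e|e|e|e|e f|v|].
- rewrite /hv evM (evE (allP (allP vv _ (ord_in _)) _ (ord_in _))) (idx_eq pr) //.
  by case: eqP.
- by rewrite /hv /he evM; have /and4P[/evE H _ _ _] := allP ve _ (edge_in e).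
- by rewrite /hv /he evM; have /and4P[_ /evE H _ _] := allP ve _ (edge_in e).
- by rewrite /hv /hg evM; have /and4P[_ _ /evE H _] := allP ve _ (edge_in e).
- by rewrite /hv /hg evM; have /and4P[_ _ _ /evE H] := allP ve _ (edge_in e).
- rewrite /hg /he evM (evE (allP (allP ge _ (edge_in e)) _ (edge_in f))) xpair_eqE.
  by rewrite (edge_pred pr); case: eqP.
- rewrite /hv (evE (allP eg _ (ord_in _))) /eval eval_terms_flatten.
  rewrite [RHS](partition_big (fun e => idx (rng e)) xpredT) //.
  rewrite -[iota 0 3]/(index_iota 0 3) big_mkord; apply: eq_bigr => j _.
  rewrite -/(eval k idx' _) -evM.
  case adjj: (adj M (idx v) j); last first.
    have -> : img_edge M d (idx v) j = [::] by rewrite /img_edge adjj.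
    rewrite ev0 mul0r big1 // => e /andP[/eqP sv /eqP rj].
    by rewrite -sv -rj (adj_edge pr) in adjj.
  move: adjj; rewrite (pr_adj pr) => /existsP[e /andP[/eqP/val_inj/(can_inj (pr_idxK pr)) <-]].
  move=> /eqP/val_inj <-; rewrite (big_pred1 e) // => f.
  by rewrite -(idx_eq pr) -[idx (rng f) == _]val_eqE (edge_pred pr).
- have H : \sum_(i <- iota 0 3) ev (img_vert d i) =
      \sum_(i <- iota 0 3) ev [:: ([:: i], [:: i])].
    transitivity (ev (flatten [seq [:: ([:: i], [:: i])] | i <- iota 0 3])); last first.
      exact: eval_terms_flatten.
    by rewrite -[LHS]eval_terms_flatten; apply: evE one.
  have idx_bij : bijective idx by exists vt; [apply: (pr_idxK pr)|apply: (pr_vtK pr)].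
  transitivity (\sum_(i < 3) ev (img_vert d i)).
    by rewrite [RHS](reindex idx) //; apply: onW_bij.
  rewrite -(big_mkord xpredT (fun i => ev (img_vert d i))) H.
  transitivity (\sum_(0 <= i < 3) vert_at k idx' i).
    apply: eq_bigr => i _; rewrite /eval eval_terms1 /eval_mono /=.
    by rewrite (lf_pp (presented_family k pr')) eqxx.
  rewrite big_mkord -sum_lv (reindex idx').
    by apply: eq_bigr => v _; rewrite (vert_at_idx k pr').
  by apply: onW_bij; exists vt'; [apply: (pr_idxK pr')|apply: (pr_vtK pr')].
Qed.

Definition presented_hom : {rmorphism leavitt_alg k E -> leavitt_alg k F} :=
  leavitt_hom presented_relations.

Lemma presented_hom_graded n x : leavitt_comp n x -> leavitt_comp n (presented_hom x).
Proof.
case/and5P: chk => _ _ _ _ /and3P[_ dv de].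
apply: leavitt_hom_graded => [v|e|e]; apply: (eval_deg k pr').
- by apply/allP => y /(allP (allP dv _ (ord_in _))) /eqP ->; rewrite subrr.
- apply/allP => y /(allP (allP de _ (edge_in e))) /eqP ->.
  by rewrite -addn1 PoszD addrAC subrr add0r.
- apply/allP => y /mapP [z /(allP (allP de _ (edge_in e))) /eqP zE ->] /=.
  by rewrite zE -addn1 PoszD opprD addrA subrr sub0r.
Qed.

Lemma presented_hom_eval l : presented_hom (eval k idx l) = ev (subst_terms M M' d l).
Proof.
have hvert i : presented_hom (vert_at k idx i) = ev (img_vert d i).
  case: (vert_atP k pr i) => [v _|i3]; first exact: leavitt_hom_vert.
  by rewrite rmorph0 /img_vert ltnNge i3.
have hedge i j : presented_hom (edge_at k idx i j) = ev (img_edge M d i j).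
  rewrite /img_edge; case: (edge_atP k pr i j) => [e|? ?]; last by rewrite rmorph0 ev0.
  by rewrite [LHS]leavitt_hom_edge /he /img_edge (adj_edge pr).
have hghost i j : presented_hom (ghost_at k idx i j) = ev (img_ghost M d i j).
  rewrite /img_ghost /img_edge; case: (edge_atP k pr i j) => [e|? ?].
    by rewrite [LHS]leavitt_hom_ghost /hg /img_ghost /img_edge (adj_edge pr).
  by rewrite rmorph0 ev0.
have hpath s : presented_hom (eval_path (vert_at k idx) (edge_at k idx) s) =
    ev (subst_path M M' d s).
  elim: s => [|i [|j s] IH]; first by rewrite ev0 [LHS]rmorph0.
    exact: hvert.
  rewrite [eval_path _ _ _]/= rmorphM hedge IH; exact: evM.
have hgpath s : presented_hom (eval_ghost (vert_at k idx) (ghost_at k idx) s) =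
    ev (subst_ghost M M' d s).
  elim: s => [|i [|j s] IH]; first by rewrite ev0 [LHS]rmorph0.
    exact: hvert.
  rewrite [eval_ghost _ _ _]/= rmorphM hghost IH; exact: evM.
rewrite [RHS]eval_terms_flatten /eval /eval_terms rmorph_sum.
apply: eq_bigr => x _; rewrite /eval_mono rmorphM hpath hgpath; exact: evM.
Qed.
End PresentedHom.

(** The right-hand sides spell the generators as monomials: an edge from i to j is itself times the
    vertex j, hence the pair of [[:: i; j]] and [[:: j]]. *)
Definition check_inverse (M M' : bmatrix) (d d' : hom_data) : bool :=
  all (fun i => eq_terms M (subst_terms M' M d' (img_vert d i)) [:: ([:: i], [:: i])])
    (iota 0 3) &&
  all (fun p => let: (i, j) := p in
    eq_terms M (subst_terms M' M d' (img_edge M d i j)) [:: ([:: i; j], [:: j])] &&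
    eq_terms M (subst_terms M' M d' (img_ghost M d i j)) [:: ([:: j], [:: i; j])]) (edges M).

Definition check_iso (M M' : bmatrix) (d d' : hom_data) : bool :=
  [&& check_hom M M' d, check_hom M' M d', check_inverse M M' d d'
    & check_inverse M' M d' d].

Section PresentedIso.
Variable k : fieldType.

Lemma presented_homK (E F : graph) (M M' : bmatrix)
  (vt : 'I_3 -> vertex E) (idx : vertex E -> 'I_3)
  (vt' : 'I_3 -> vertex F) (idx' : vertex F -> 'I_3)
  (pr : presentation M vt idx) (pr' : presentation M' vt' idx') d d'
  (chk : check_hom M M' d) (chk' : check_hom M' M d') :
  check_inverse M M' d d' ->
  cancel (presented_hom k pr pr' chk) (presented_hom k pr' pr chk').
Proof.
move=> /andP[cv ce].
pose f := presented_hom k pr pr' chk; pose f' := presented_hom k pr' pr chk'.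
have evE l l' : eq_terms M l l' -> eval k idx l = eval k idx l'.
  exact: eq_termsP (presented_family k pr) l l'.
have lvE v : lv k v = eval k idx [:: ([:: nat_of_ord (idx v)], [:: nat_of_ord (idx v)])].
  by rewrite /eval eval_terms1 /eval_mono /= (vert_at_idx k pr) lvM eqxx.
have leE e : le k e = eval k idx
    [:: ([:: nat_of_ord (idx (src e)); nat_of_ord (idx (rng e))], [:: nat_of_ord (idx (rng e))])].
  rewrite /eval eval_terms1 /eval_mono /= (edge_at_idx k pr) !(vert_at_idx k pr).
  by rewrite -mulrA lvM eqxx le_lv eqxx.
have lgE e : lg k e = eval k idx
    [:: ([:: nat_of_ord (idx (rng e))], [:: nat_of_ord (idx (src e)); nat_of_ord (idx (rng e))])].
  rewrite /eval eval_terms1 /eval_mono /= (ghost_at_idx k pr) !(vert_at_idx k pr).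
  by rewrite mulrA lvM eqxx lv_lg eqxx.
have ord_in (i : 'I_3) : nat_of_ord i \in iota 0 3 by rewrite mem_iota add0n ltn_ord.
have edge_in e : (nat_of_ord (idx (src e)), nat_of_ord (idx (rng e))) \in edges M.
  by apply: edges_mem; rewrite ?ltn_ord //; apply: (adj_edge pr).
have fv v : f (lv k v) = eval k idx' (img_vert d (idx v)) by apply: leavitt_hom_vert.
have fe e : f (le k e) = eval k idx' (img_edge M d (idx (src e)) (idx (rng e))).
  exact: leavitt_hom_edge.
have fg e : f (lg k e) = eval k idx' (img_ghost M d (idx (src e)) (idx (rng e))).
  exact: leavitt_hom_ghost.
apply: (@leavitt_ext k E (f' \o f)) => [a x|v|e|e] /=.
- by rewrite [f _]leavitt_homZ [f' _]leavitt_homZ.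
- by rewrite fv /f' (presented_hom_eval k pr' pr chk') (evE _ _ (allP cv _ (ord_in _))) -lvE.
- by rewrite fe /f' (presented_hom_eval k pr' pr chk'); have /andP[/evE -> _] := allP ce _ (edge_in e).
- by rewrite fg /f' (presented_hom_eval k pr' pr chk'); have /andP[_ /evE ->] := allP ce _ (edge_in e).
Qed.

Lemma check_iso_graded (E F : graph) (M M' : bmatrix) d d' :
  presented E M -> presented F M' -> check_iso M M' d d' ->
  graded_isomorphic (leavitt k E) (leavitt k F).
Proof.
move=> [vt [idx pr]] [vt' [idx' pr']] /and4P[chk chk' inv inv'].
pose f : {rmorphism leavitt k E -> leavitt k F} := presented_hom k pr pr' chk.
apply: (@graded_isomorphicP _ _ f (presented_hom k pr' pr chk')).
- exact: presented_homK.
- exact: presented_homK.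
- exact: presented_hom_graded.
- exact: presented_hom_graded.
Qed.
End PresentedIso.

(** * Separating shift equivalence classes *)

Section EventualVanishing.
Variable m : nat.

(** Vanishing modulo m in the direct limit along A, on which a shift equivalence induces an
    isomorphism. *)
Definition vanishes n p (A : 'M[int]_n) (X : 'M[int]_(p, n)) :=
  exists a (Z : 'M[int]_(p, n)), X *m A ^+ a = Z *+ m.

(** Horner's scheme for X q(A), with the coefficients in order of increasing degree. *)
Definition poly_act n p (A : 'M[int]_n) (q : seq nat) (X : 'M[int]_(p, n)) :=
  foldr (fun c Y => X *+ c + Y *m A) 0 q.

Lemma mulmxMn n p r (A : 'M[int]_(n, p)) (B : 'M[int]_(p, r)) c : A *m (B *+ c) = (A *m B) *+ c.
Proof. exact: (raddfMn (mulmx A)). Qed.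
Lemma mulMnmx n p r (A : 'M[int]_(n, p)) (B : 'M[int]_(p, r)) c : (A *+ c) *m B = (A *m B) *+ c.
Proof. exact: (raddfMn (mulmxr B)). Qed.

Lemma poly_actMl n p r (A : 'M[int]_n) q (Y : 'M[int]_(r, p)) (X : 'M[int]_(p, n)) :
  poly_act A q (Y *m X) = Y *m poly_act A q X.
Proof.
elim: q => [|c q IH] /=; first by rewrite mulmx0.
by rewrite IH mulmxDr mulmxMn mulmxA.
Qed.

Lemma poly_actMr n p r (A : 'M[int]_n) (B : 'M[int]_p) (D : 'M[int]_(n, p)) q
    (X : 'M[int]_(r, n)) :
  A *m D = D *m B -> poly_act A q X *m D = poly_act B q (X *m D).
Proof.
move=> AD; elim: q => [|c q IH] /=; first by rewrite mul0mx.
by rewrite mulmxDl mulMnmx -mulmxA AD mulmxA IH.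
Qed.

(** D carries u q(A) to u q(B) B^N and thereby divisibility by m. *)
Lemma vanishes_unit n p (A : 'M[int]_n) (B : 'M[int]_p) q : shift_equivalent A B ->
  vanishes A (poly_act A q (const_mx 1 : 'rV_n)) ->
  vanishes B (poly_act B q (const_mx 1 : 'rV_p)).
Proof.
move=> [N [N' [D [D' [AD _ _ uD _]]]]] [a [Z XZ]].
exists (N + a)%N, (Z *m D); rewrite mxpowD mulmxA.
have BB : B *m B ^+ N = B ^+ N *m B := mxpowC B N.
rewrite (poly_actMr _ _ BB) -uD -(poly_actMr _ _ AD) -mulmxA.
by rewrite -(intertwine_pow a AD) mulmxA XZ mulMnmx.
Qed.

(** Intertwining gives D' q(A) D = q(B) B^(N + N'). *)
Lemma vanishes_id n p (A : 'M[int]_n) (B : 'M[int]_p) q : shift_equivalent A B ->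
  vanishes A (poly_act A q 1%:M) -> vanishes B (poly_act B q 1%:M).
Proof.
move=> [N [N' [D [D' [AD BD [DD' D'D] _ _]]]]] [a [Z XZ]].
exists (N + N' + a)%N, (D' *m Z *m D); rewrite mxpowD mulmxA.
have BB := mxpowC B (N + N').
rewrite (poly_actMr _ _ BB) mul1mx -D'D -{1}[D']mulmx1 -(poly_actMr _ _ AD) poly_actMl.
by rewrite -mulmxA -(intertwine_pow a AD) -!mulmxA (mulmxA _ _ D) XZ mulMnmx mulmxMn.
Qed.

(** Beyond the lag the powers are D D' A^a and D' D B^a, whose traces agree by cyclicity and
    intertwining. *)
Lemma trace_shift_equivalent n p (A : 'M[int]_n) (B : 'M[int]_p) : shift_equivalent A B ->
  exists l, forall a, \tr (A ^+ (l + a)) = \tr (B ^+ (l + a)).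
Proof.
move=> [N [N' [D [D' [AD BD [DD' D'D] _ _]]]]]; exists (N + N')%N => a.
rewrite (mxpowD A) (mxpowD B) -DD' -D'D -[in LHS]mulmxA [LHS]mxtrace_mulC.
by rewrite -[in LHS]mulmxA (intertwine_pow a AD) mulmxA.
Qed.
End EventualVanishing.

(** * Divisibility tests on lists of residues *)

Section ListMatrices.

Definition mat (M : bmatrix) : 'M[int]_3 := \matrix_(i, j) ((adj M i j : nat)%:Z).
Definition vec (x : seq nat) : 'rV[int]_3 := \row_j ((nth 0%N x j)%:Z).

Definition vec_step (m : nat) (M : bmatrix) (x : seq nat) : seq nat :=
  [seq (foldr addn 0 [seq if adj M i j then nth 0 x i else 0 | i <- iota 0 3] %% m)%N
  | j <- iota 0 3].

Definition vec_axpy (m c : nat) (x y : seq nat) : seq nat :=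
  [seq ((c * nth 0 x j + nth 0 y j) %% m)%N | j <- iota 0 3].

Definition vec_poly (m : nat) (M : bmatrix) (q x : seq nat) : seq nat :=
  foldr (fun c y => vec_axpy m c x (vec_step m M y)) [:: 0; 0; 0]%N q.

Section Modulus.
Variable m : nat.
Hypothesis m_gt1 : (1 < m)%N.

Definition eqv (X Y : 'rV[int]_3) := exists Z, X = Y + Z *+ m.

Lemma eqv_refl X : eqv X X. Proof. by exists 0; rewrite mul0rn addr0. Qed.
Lemma eqv_trans X Y W : eqv X Y -> eqv Y W -> eqv X W.
Proof. by move=> [Z ->] [Z' ->]; exists (Z' + Z); rewrite mulrnDl addrA. Qed.
Lemma eqv_mul X Y (A : 'M[int]_3) : eqv X Y -> eqv (X *m A) (Y *m A).
Proof. by move=> [Z ->]; exists (Z *m A); rewrite mulmxDl mulMnmx. Qed.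
Lemma eqvD X Y X' Y' : eqv X Y -> eqv X' Y' -> eqv (X + X') (Y + Y').
Proof. by move=> [Z ->] [Z' ->]; exists (Z + Z'); rewrite mulrnDl addrACA. Qed.

Lemma eqv_row (f : nat -> nat) :
  eqv (vec [seq (f j %% m)%N | j <- iota 0 3]) (\row_j (f j)%:Z).
Proof.
exists (\row_j (- (f j %/ m)%N%:Z)); apply/rowP => j.
rewrite !mxE mulmxnE mxE (nth_map 0%N) ?size_iota ?ltn_ord // nth_iota ?ltn_ord // add0n.
by rewrite {2}(divn_eq (f j) m) PoszD PoszM mulNrn -mulr_natr addrAC natz subrr add0r.
Qed.

Lemma vec_stepE M x : eqv (vec (vec_step m M x)) (vec x *m mat M).
Proof.
have -> : vec x *m mat M = \row_j (foldr addn 0%N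
    [seq if adj M i j then nth 0%N x i else 0%N | i <- iota 0 3])%:Z.
  apply/rowP => j; rewrite !mxE !big_ord_recl big_ord0 !mxE /= !PoszD.
  by do 3!case: (adj M _ j); rewrite ?mulr1 ?mulr0.
exact: (eqv_row (fun j => foldr addn 0%N
    [seq if adj M i j then nth 0%N x i else 0%N | i <- iota 0 3])).
Qed.

Lemma vec_axpyE c x y : eqv (vec (vec_axpy m c x y)) (vec x *+ c + vec y).
Proof.
have -> : vec x *+ c + vec y = \row_j (c * nth 0%N x j + nth 0%N y j)%N%:Z.
  apply/rowP => j; rewrite !mxE mulmxnE mxE PoszD PoszM.
  by rewrite -mulr_natr natz mulrC.
exact: (eqv_row (fun j => (c * nth 0 x j + nth 0 y j)%N)).
Qed.

Lemma vec0E : vec [:: 0; 0; 0]%N = 0.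
Proof. by apply/rowP => j; rewrite !mxE; case: j => [[|[|[|]]]]. Qed.

Lemma vec_polyE M q x : eqv (vec (vec_poly m M q x)) (poly_act (mat M) q (vec x)).
Proof.
elim: q => [|c q IH] /=; first by rewrite vec0E; apply: eqv_refl.
apply: eqv_trans (vec_axpyE _ _ _) _; apply: eqvD; first exact: eqv_refl.
exact: eqv_trans (vec_stepE _ _) (eqv_mul _ IH).
Qed.

Lemma iter_stepE M x a : eqv (vec (iter a (vec_step m M) x)) (vec x *m mat M ^+ a).
Proof.
elim: a => [|a IH]; first by rewrite expr0 mulmx1; apply: eqv_refl.
rewrite iterS -(addn1 a) mxpowD mulmxA expr1.
exact: eqv_trans (vec_stepE _ _) (eqv_mul _ IH).
Qed.

Lemma vec_step_eq0 M x : eqv (vec (vec_step m M x)) 0 -> vec_step m M x = [:: 0; 0; 0]%N.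
Proof.
move=> [Z xZ]; apply: (@eq_from_nth _ 0%N) => // j; rewrite size_map size_iota => j3.
have xm : (nth 0 (vec_step m M x) j < m)%N.
  by rewrite (nth_map 0%N) ?size_iota // ltn_mod ltnW.
have /rowP /(_ (Ordinal j3)) := xZ; rewrite !mxE mulmxnE /= add0r.
set z := Z _ _ => xz.
have -> : nth 0%N (vec_step m M x) j = 0%N.
  move: (nth _ _ _) xm xz => y ym; rewrite -mulr_natr natz => yz.
  by have [zn|zp] := lerP z 0; nia.
by case: j j3 {xm xz z} => [|[|[|]]].
Qed.

Lemma vanishes_iter M x : vanishes m (mat M) (vec x) <->
  exists a, iter a (vec_step m M) x = [:: 0; 0; 0]%N.
Proof.
split=> [[a [Z xZ]]|[a xa]].
  (* One further step produces reduced entries, for which congruence to 0 is equality; [x] itself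
     need not be reduced. *)
  exists a.+1; rewrite iterS; apply: vec_step_eq0.
  apply: eqv_trans (vec_stepE _ _) _.
  have := eqv_mul (mat M) (iter_stepE M x a); rewrite xZ mulMnmx => /eqv_trans; apply.
  by exists (Z *m mat M); rewrite add0r.
have [Z] := iter_stepE M x a; rewrite xa vec0E => E'.
exists a, (- Z); apply/eqP; rewrite mulNrn -addr_eq0; exact/eqP/esym.
Qed.

Lemma vanishes_eqv M X Y : eqv X Y -> vanishes m (mat M) X <-> vanishes m (mat M) Y.
Proof.
move=> [Z ->]; split=> [[a [W XW]]|[a [W YW]]]; exists a.
  exists (W - Z *m mat M ^+ a); rewrite mulrnBl -XW mulmxDl mulMnmx.
  by rewrite addrK.
by exists (W + Z *m mat M ^+ a); rewrite mulmxDl mulMnmx YW mulrnDl.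
Qed.

Definition reaches_zero (K : nat) M x := [:: 0; 0; 0]%N \in traject (vec_step m M) x K.

(** By [looping] the first K states contain the whole orbit, so an unsuccessful search refutes
    vanishing. *)
Lemma reaches_zeroP K M q x : looping (vec_step m M) (vec_poly m M q x) K ->
  reflect (vanishes m (mat M) (poly_act (mat M) q (vec x)))
          (reaches_zero K M (vec_poly m M q x)).
Proof.
move=> /loopingP loop; apply: (iffP idP).
  move=> /trajectP [a _ xa]; apply/(vanishes_eqv M (vec_polyE M q x))/vanishes_iter.
  by exists a.
move=> /(vanishes_eqv M (vec_polyE M q x))/vanishes_iter [a xa].
by rewrite /reaches_zero -xa.
Qed.
End Modulus.
End ListMatrices.

Lemma shift_equivalent_sym n m (A : 'M[int]_n) (B : 'M[int]_m) :
  shift_equivalent A B -> shift_equivalent B A.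
Proof.
move=> [N [N' [D [D' [AD BD [DD' D'D] uD uD']]]]].
by exists N', N, D', D; rewrite addnC; split.
Qed.

Lemma vanishes_rows m n p (A : 'M[int]_n) (X : 'M[int]_(p, n)) :
  (forall i, vanishes m A (row i X)) <-> vanishes m A X.
Proof.
split=> [/fin_all_exists [a] /fin_all_exists [Z XZ]|[a [Z XZ]] i]; last first.
  by exists a, (row i Z); rewrite -row_mul XZ; apply/rowP => j; rewrite !(mxE, mulmxnE).
pose b := (\max_i a i)%N; exists b, (\matrix_i (Z i *m A ^+ (b - a i))).
apply/row_matrixP => i; rewrite row_mul -(subnKC (leq_bigmax i : (a i <= b)%N)).
rewrite mxpowD mulmxA XZ mulMnmx subnKC ?leq_bigmax //.
by apply/rowP => j; rewrite !(mxE, mulmxnE).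
Qed.

Definition unit_vec i : seq nat := [seq (i == j : nat) | j <- iota 0 3].

Lemma vec_unit (i : 'I_3) : vec (unit_vec i) = delta_mx 0 i.
Proof.
apply/rowP => j; rewrite !mxE (nth_map 0%N) ?size_iota // nth_iota // add0n eqxx /=.
by rewrite -natz val_eqE eq_sym.
Qed.

Lemma vec_const : vec [:: 1; 1; 1]%N = const_mx 1.
Proof. by apply/rowP => j; rewrite !mxE; case: j => [[|[|[|]]]]. Qed.

(* A test [(m, K, q, b)] asks whether u q(A) (or q(A), when b holds) becomes
   divisible by m after multiplication by a power of A; K bounds the length of
   the orbits modulo m. *)
Definition test := (nat * nat * seq nat * bool)%type.

Definition test_vecs (b : bool) : seq (seq nat) :=
  if b then [seq unit_vec i | i <- iota 0 3] else [:: [:: 1; 1; 1]%N].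

Definition run_test M (t : test) : bool :=
  let: (m, K, q, b) := t in
  all (fun x => reaches_zero m K M (vec_poly m M q x)) (test_vecs b).

(** The bounds 8 and 27 in [tests] count all vectors modulo 2 and 3; the bound 63 for modulus 5 is
    smaller than 125 and is confirmed by [tests_loop]. *)
Definition test_loops M (t : test) : bool :=
  let: (m, K, q, b) := t in
  (1 < m)%N && all (fun x => looping (vec_step m M) (vec_poly m M q x) K) (test_vecs b).

Lemma run_testP M m K q b : test_loops M (m, K, q, b) ->
  run_test M (m, K, q, b) <->
  if b then vanishes m (mat M) (poly_act (mat M) q 1%:M)
  else vanishes m (mat M) (poly_act (mat M) q (const_mx 1 : 'rV_3)).
Proof.
move=> /andP[m1 /allP loops]; rewrite /run_test.
have reachP x : x \in test_vecs b ->
    reaches_zero m K M (vec_poly m M q x) <->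
    vanishes m (mat M) (poly_act (mat M) q (vec x)).
  by move=> /loops/(reaches_zeroP m1) H; split=> /H.
case: b loops reachP => _ reachP; last first.
  by rewrite /test_vecs /= andbT reachP ?mem_head // vec_const.
have rowE' i : row i (poly_act (mat M) q 1%:M) = poly_act (mat M) q (vec (unit_vec i)).
  by rewrite rowE -poly_actMl mulmx1 vec_unit.
have unit_in (i : 'I_3) : unit_vec i \in test_vecs true.
  by apply/map_f; rewrite mem_iota add0n ltn_ord.
split=> [/allP H|/vanishes_rows H].
  by apply/vanishes_rows => i; rewrite rowE'; apply/reachP/H; apply: unit_in.
apply/allP => x xin; apply/reachP => //; move: xin => /mapP [i i3 ->].
rewrite mem_iota add0n in i3.
by have := H (Ordinal i3); rewrite rowE'.
Qed.

Lemma run_test_shift_equivalent M M' t : shift_equivalent (mat M) (mat M') ->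
  test_loops M t -> test_loops M' t -> run_test M t = run_test M' t.
Proof.
move: t => [[[m K] q] b] se lM lM'.
have imp N N' : shift_equivalent (mat N) (mat N') -> test_loops N (m, K, q, b) ->
    test_loops N' (m, K, q, b) -> run_test N (m, K, q, b) -> run_test N' (m, K, q, b).
  move=> seN lN lN' /(run_testP lN) H; apply/(run_testP lN'); case: b H {lM lM' lN lN'} => H.
    exact: vanishes_id seN H.
  exact: vanishes_unit seN H.
by apply/idP/idP; apply: imp => //; apply: shift_equivalent_sym.
Qed.

(** * Parity of traces and separation *)

Definition diag_sum (s : seq (seq nat)) : nat :=
  foldr addn 0%N [seq nth 0%N (nth [::] s i) i | i <- iota 0 3].

(** The state holds the rows of a power of M modulo 2, beginning with M itself. A loop within K
    steps certifies parity [b] for the traces of all positive powers. *)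
Definition trace_parity (K : nat) M (b : bool) : bool :=
  let f := map (vec_step 2 M) in let s := f (test_vecs true) in
  looping f s K && all (fun s => odd (diag_sum s) == b) (traject f s K).

Lemma trace_parityP K M b : trace_parity K M b ->
  forall a, exists z, \tr (mat M ^+ a.+1) = (b : nat)%:Z + z *+ 2.
Proof.
move=> /andP[/loopingP loop /allP par] a; have := par _ (loop a).
set s := iter _ _ _; have sE i : nth [::] s i =
    if (i < 3)%N then iter a.+1 (vec_step 2 M) (unit_vec i) else [::].
  rewrite /s; elim: a {s} i => [|a IH] i.
    by rewrite /=; case: i => [|[|[|]]] //= i; rewrite nth_nil.
  rewrite iterS; have sz : size (iter a (map (vec_step 2 M)) (map (vec_step 2 M) (test_vecs true))) = 3%N.
    by elim: a {IH} => // a IHa; rewrite iterS size_map.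
  case: ltnP => i3; last by rewrite nth_default // size_map sz.
  by rewrite (nth_map [::]) ?sz // IH i3.
have entry (i : 'I_3) : exists z, (mat M ^+ a.+1) i i =
    (nth 0%N (nth [::] s i) i)%:Z + z *+ 2.
  rewrite sE ltn_ord.
  have [Z /rowP /(_ i)] := iter_stepE 2 M (unit_vec i) a.+1.
  rewrite vec_unit -rowE !mxE => ->.
  by exists (- Z 0 i); rewrite mulNrn mulr2n addrK.
move: s entry {sE} => s entry /eqP; rewrite /mxtrace !big_ord_recl big_ord0 /diag_sum.
have [z0 ->] := entry ord0; have [z1 ->] := entry (lift ord0 ord0).
have [z2 ->] := entry (lift ord0 (lift ord0 ord0)).
rewrite /= /bump /=; move: (nth _ _ 0%N) (nth _ _ 1%N) (nth _ _ 2%N) => x y z odd_s.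
exists ((x + (y + z))./2%:Z + z0 + z1 + z2).
have := odd_double_half (x + (y + (z + 0))); rewrite odd_s addn0.
by rewrite !mulr2n; lia.
Qed.

Definition fingerprint (ts : seq test) (K : nat) M : seq bool * (bool * bool) :=
  ([seq run_test M t | t <- ts], (trace_parity K M false, trace_parity K M true)).

(** Trace data separate only by opposite certificates: a pair of [false] flags says that no constant
    parity was found, which excludes nothing. *)
Definition separated (f f' : seq bool * (bool * bool)) : bool :=
  [|| f.1 != f'.1, f.2.1 && f'.2.2 | f.2.2 && f'.2.1].

Lemma separatedP ts K M M' : all (test_loops M) ts -> all (test_loops M') ts ->
  separated (fingerprint ts K M) (fingerprint ts K M') ->
  ~ shift_equivalent (mat M) (mat M').
Proof.
move=> /allP lM /allP lM' sep se; have [l trE] := trace_shift_equivalent se.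
have par b : trace_parity K M b -> trace_parity K M' (~~ b) -> False.
  move=> /trace_parityP /(_ l) [z zE] /trace_parityP /(_ l) [z' z'E].
  (* Parities are certified for positive exponents, hence l + 1 instead of l. *)
  by have := trE 1%N; rewrite addn1 zE z'E !mulr2n; case: b zE z'E => *; lia.
case/or3P: sep => [/eqP []|/andP[p q]|/andP[p q]].
- by apply/eq_in_map => t tin; apply: run_test_shift_equivalent; [|apply: lM|apply: lM'].
- exact: par p q.
- exact: par p q.
Qed.

(** * Classification of small graphs *)

Definition small_matrices : seq bmatrix := [seq [seq [seq x == 1 | x <- r] | r <- m] | m <-
  [:: [:: [:: 0; 1; 0]; [:: 0; 0; 1]; [:: 1; 0; 1]];
    [:: [:: 1; 1; 0]; [:: 0; 0; 1]; [:: 1; 0; 1]];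
    [:: [:: 1; 1; 0]; [:: 0; 1; 1]; [:: 1; 0; 1]];
    [:: [:: 0; 1; 0]; [:: 0; 0; 1]; [:: 1; 1; 0]];
    [:: [:: 1; 1; 0]; [:: 0; 0; 1]; [:: 1; 1; 0]];
    [:: [:: 1; 1; 0]; [:: 0; 0; 1]; [:: 1; 1; 1]];
    [:: [:: 1; 1; 0]; [:: 0; 1; 1]; [:: 1; 1; 0]];
    [:: [:: 1; 1; 0]; [:: 1; 0; 1]; [:: 1; 1; 1]];
    [:: [:: 1; 1; 0]; [:: 1; 1; 1]; [:: 1; 1; 1]];
    [:: [:: 0; 1; 1]; [:: 1; 0; 0]; [:: 1; 0; 0]];
    [:: [:: 0; 1; 1]; [:: 1; 0; 0]; [:: 1; 0; 1]];
    [:: [:: 1; 1; 1]; [:: 1; 0; 0]; [:: 1; 0; 1]];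
    [:: [:: 0; 0; 1]; [:: 1; 0; 0]; [:: 1; 0; 1]];
    [:: [:: 1; 0; 1]; [:: 1; 0; 0]; [:: 1; 0; 0]];
    [:: [:: 1; 0; 1]; [:: 1; 0; 0]; [:: 1; 0; 1]];
    [:: [:: 0; 1; 1]; [:: 0; 0; 1]; [:: 0; 1; 1]];
    [:: [:: 0; 1; 1]; [:: 0; 1; 1]; [:: 0; 1; 1]];
    [:: [:: 1; 1; 0]; [:: 0; 1; 1]; [:: 1; 1; 1]];
    [:: [:: 0; 1; 0]; [:: 0; 1; 1]; [:: 1; 1; 1]];
    [:: [:: 0; 1; 0]; [:: 1; 0; 1]; [:: 1; 1; 0]];
    [:: [:: 0; 1; 0]; [:: 1; 0; 1]; [:: 1; 1; 1]];
    [:: [:: 1; 1; 0]; [:: 1; 0; 1]; [:: 1; 1; 0]];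
    [:: [:: 0; 1; 0]; [:: 0; 1; 1]; [:: 1; 1; 0]];
    [:: [:: 1; 1; 0]; [:: 1; 1; 1]; [:: 1; 1; 0]];
    [:: [:: 0; 1; 0]; [:: 0; 0; 1]; [:: 1; 1; 1]];
    [:: [:: 0; 1; 0]; [:: 1; 1; 1]; [:: 1; 1; 1]];
    [:: [:: 1; 1; 1]; [:: 1; 1; 1]; [:: 1; 1; 1]];
    [:: [:: 1; 1; 1]; [:: 1; 0; 0]; [:: 1; 0; 0]];
    [:: [:: 0; 1; 0]; [:: 1; 1; 1]; [:: 1; 1; 0]];
    [:: [:: 1; 1; 1]; [:: 1; 1; 1]; [:: 1; 1; 0]];
    [:: [:: 1; 1; 1]; [:: 1; 0; 1]; [:: 1; 1; 0]];
    [:: [:: 0; 1; 1]; [:: 1; 0; 1]; [:: 1; 1; 0]];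
    [:: [:: 0; 1; 1]; [:: 1; 1; 0]; [:: 1; 0; 1]];
    [:: [:: 1; 1; 1]; [:: 1; 1; 0]; [:: 1; 0; 1]]]]%N.

(* [hom_a_b] maps L(E^a) to L(E^b) in the paper's numbering of the small graphs. *)
Definition hom_1_5_1_16 : hom_data :=
  ([:: [:: ([:: 2], [:: 2])];
     [:: ([:: 1], [:: 1])];
     [:: ([:: 0], [:: 0])]],
    [:: [:: [:: ([:: 2; 2], [:: 2])];
        [:: ([:: 2; 1], [:: 1])];
        [::]];
     [:: [::];
        [::];
        [:: ([:: 1; 2; 1], [:: 0; 1]); ([:: 1; 2; 2], [:: 0; 2])]];
     [:: [:: ([:: 0; 2], [:: 2])];
        [:: ([:: 0; 1], [:: 1])];
        [::]]]).

(** Rows 0 and 2 agree in both matrices of this pair, so w, the sum of the e_{2j} e_{0j}^* over j,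
    is an equivalence of degree 0 between the vertices 2 and 0. Both maps exchange 0 and 2 and send
    the edge from 1 to 2 to e_{12} w; other edges go to edges. The next pair likewise redirects one
    edge through two vertices with equal rows. *)
Definition hom_1_16_1_5 : hom_data :=
  ([:: [:: ([:: 2], [:: 2])];
     [:: ([:: 1], [:: 1])];
     [:: ([:: 0], [:: 0])]],
    [:: [:: [::];
        [:: ([:: 2; 1], [:: 1])];
        [:: ([:: 2; 0], [:: 0])]];
     [:: [::];
        [::];
        [:: ([:: 1; 2; 0], [:: 0; 0]); ([:: 1; 2; 1], [:: 0; 1])]];
     [:: [::];
        [:: ([:: 0; 1], [:: 1])];
        [:: ([:: 0; 0], [:: 0])]]]).

Definition hom_1_7_1_17 : hom_data :=
  ([:: [:: ([:: 1], [:: 1])];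
     [:: ([:: 2], [:: 2])];
     [:: ([:: 0], [:: 0])]],
    [:: [:: [:: ([:: 1; 1], [:: 1])];
        [:: ([:: 1; 2], [:: 2])];
        [::]];
     [:: [::];
        [:: ([:: 2; 2], [:: 2])];
        [:: ([:: 2; 1; 1], [:: 0; 1]); ([:: 2; 1; 2], [:: 0; 2])]];
     [:: [:: ([:: 0; 1], [:: 1])];
        [:: ([:: 0; 2], [:: 2])];
        [::]]]).

Definition hom_1_17_1_7 : hom_data :=
  ([:: [:: ([:: 2], [:: 2])];
     [:: ([:: 0], [:: 0])];
     [:: ([:: 1], [:: 1])]],
    [:: [:: [::];
        [:: ([:: 2; 0], [:: 0])];
        [:: ([:: 2; 1], [:: 1])]];
     [:: [::];
        [:: ([:: 0; 0], [:: 0])];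
        [:: ([:: 0; 1], [:: 1])]];
     [:: [::];
        [:: ([:: 1; 2; 0], [:: 0; 0]); ([:: 1; 2; 1], [:: 0; 1])];
        [:: ([:: 1; 1], [:: 1])]]]).

(** Vertex 2 of the target is cut along its outgoing edges: e_{21} e_{21}^* joins vertex 0, the
    other pieces form the image of 2. In the reverse map vertex 1 is cut, and e_{12} e_{12}^* joins
    vertex 2. *)
Definition hom_2_4_2_3 : hom_data :=
  ([:: [:: ([:: 1], [:: 1])];
     [:: ([:: 0], [:: 0]); ([:: 2; 1], [:: 2; 1])];
     [:: ([:: 2; 0], [:: 2; 0]); ([:: 2; 2], [:: 2; 2])]],
    [:: [:: [:: ([:: 1; 2; 0], [:: 1; 0]); ([:: 1; 2; 2], [:: 1; 2])];
        [:: ([:: 1; 0], [:: 0]); ([:: 1; 2; 1], [:: 2; 1])];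
        [::]];
     [:: [:: ([:: 0; 1], [:: 1])];
        [::];
        [:: ([:: 2; 1; 0], [:: 2; 0]); ([:: 2; 1; 2], [:: 2; 2])]];
     [:: [:: ([:: 2; 2; 0], [:: 1; 0]); ([:: 2; 2; 2], [:: 1; 2])];
        [:: ([:: 2; 0], [:: 0]); ([:: 2; 2; 1], [:: 2; 1])];
        [::]]]).

Definition hom_2_3_2_4 : hom_data :=
  ([:: [:: ([:: 1; 0], [:: 1; 0])];
     [:: ([:: 0], [:: 0])];
     [:: ([:: 1; 2], [:: 1; 2]); ([:: 2], [:: 2])]],
    [:: [:: [::];
        [:: ([:: 1; 0], [:: 0])];
        [::]];
     [:: [:: ([:: 0; 1; 0], [:: 1; 0])];
        [::];
        [:: ([:: 0; 0; 0], [:: 2; 0]); ([:: 0; 0; 1], [:: 2; 1]); ([:: 0; 1; 2], [:: 1; 2])]];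
     [:: [:: ([:: 2; 1; 0], [:: 1; 0])];
        [:: ([:: 1; 2; 0], [:: 0; 0]); ([:: 1; 2; 1], [:: 0; 1])];
        [:: ([:: 2; 0; 0], [:: 2; 0]); ([:: 2; 0; 1], [:: 2; 1]); ([:: 2; 1; 2], [:: 1; 2])]]]).

(** Vertex 1 of the target is cut: e_{12} e_{12}^* is the image of 1, while e_{10} e_{10}^* joins
    vertex 0. In the reverse map vertex 2 is cut, the piece through 0 being expanded by one more
    edge. *)
Definition hom_1_12_1_8 : hom_data :=
  ([:: [:: ([:: 2], [:: 2])];
     [:: ([:: 1; 2], [:: 1; 2])];
     [:: ([:: 0], [:: 0]); ([:: 1; 0], [:: 1; 0])]],
    [:: [:: [:: ([:: 2; 2], [:: 2])];
        [:: ([:: 2; 1; 2], [:: 1; 2])];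
        [:: ([:: 2; 0], [:: 0]); ([:: 2; 1; 0], [:: 1; 0])]];
     [:: [:: ([:: 1; 2], [:: 2])];
        [::];
        [::]];
     [:: [:: ([:: 0; 1; 2], [:: 2; 2]); ([:: 1; 0; 0], [:: 2; 0]); ([:: 1; 0; 1], [:: 2; 1])];
        [::];
        [:: ([:: 0; 0], [:: 0]); ([:: 0; 1; 0], [:: 1; 0])]]]).

Definition hom_1_8_1_12 : hom_data :=
  ([:: [:: ([:: 2; 0; 0], [:: 2; 0; 0]); ([:: 2; 2], [:: 2; 2])];
     [:: ([:: 1], [:: 1]); ([:: 2; 0; 1], [:: 2; 0; 1]); ([:: 2; 0; 2], [:: 2; 0; 2])];
     [:: ([:: 0], [:: 0])]],
    [:: [:: [:: ([:: 2; 2; 0; 0], [:: 2; 0; 0]); ([:: 2; 2; 2], [:: 2; 2])];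
        [:: ([:: 2; 0; 0], [:: 1; 0]); ([:: 2; 2; 0; 1], [:: 2; 0; 1]); ([:: 2; 2; 0; 2], [:: 2; 0; 2])];
        [::]];
     [:: [:: ([:: 2; 0; 1; 0], [:: 2; 0; 0]); ([:: 2; 0; 2], [:: 2; 2])];
        [::];
        [:: ([:: 1; 0], [:: 0])]];
     [:: [:: ([:: 0; 2; 0; 0], [:: 2; 0; 0]); ([:: 0; 2; 2], [:: 2; 2])];
        [:: ([:: 0; 1], [:: 1]); ([:: 0; 2; 0; 1], [:: 2; 0; 1]); ([:: 0; 2; 0; 2], [:: 2; 0; 2])];
        [:: ([:: 0; 0], [:: 0])]]]).

(** Serves pairs with equal matrices; entries without an edge are dropped by [img_edge]. *)
Definition id_hom : hom_data :=
  ([seq [:: ([:: i], [:: i])] | i <- iota 0 3],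
   [seq [seq [:: ([:: i; j], [:: j])] | j <- iota 0 3] | i <- iota 0 3]).

Definition isomorphisms : seq (hom_data * hom_data) :=
  [:: (id_hom, id_hom);
      (hom_1_5_1_16, hom_1_16_1_5); (hom_1_16_1_5, hom_1_5_1_16);
      (hom_1_7_1_17, hom_1_17_1_7); (hom_1_17_1_7, hom_1_7_1_17);
      (hom_2_4_2_3, hom_2_3_2_4); (hom_2_3_2_4, hom_2_4_2_3);
      (hom_1_12_1_8, hom_1_8_1_12); (hom_1_8_1_12, hom_1_12_1_8)].

(* Found by a greedy search. *)
Definition tests : seq test :=
  [:: (2, 8, [:: 0; 0; 1; 1], false); (2, 8, [:: 0; 1; 1; 1], false);
      (2, 8, [:: 1; 0; 1; 1], true); (3, 27, [:: 1; 0; 1; 2], false);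
      (3, 27, [:: 0; 1; 1; 2], false); (2, 8, [:: 0; 1; 1; 1], true);
      (3, 27, [:: 1; 1; 0; 2], false); (2, 8, [:: 0; 0; 1; 1], true);
      (3, 27, [:: 1; 2; 1; 1], false); (5, 63, [:: 0; 1; 3], false);
      (2, 8, [:: 0; 1; 0; 1], true); (3, 27, [:: 1; 2; 1; 2], false);
      (2, 8, [:: 1; 1; 0; 1], false); (3, 27, [:: 1; 0; 1; 2], true)]%N.

Lemma tests_loop : all (fun M => all (test_loops M) tests) small_matrices.
Proof. by vm_compute. Qed.

(** Evaluated once, so that comparing all pairs does not rerun the tests. A matrix whose powers
    modulo 2 do not loop within 16 steps would get neither parity flag. *)
Definition fingerprints := Eval vm_compute in
  [seq fingerprint tests 16 M | M <- small_matrices].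

Lemma fingerprintsE : [seq fingerprint tests 16 M | M <- small_matrices] = fingerprints.
Proof. by vm_compute. Qed.

(** The conditional in place of a disjunction keeps call-by-value evaluation from running
    [check_iso] on separated pairs. *)
Lemma separated_or_isomorphic :
  all (fun x => all (fun y => if separated x.2 y.2 then true else
    has (fun d => check_iso x.1 y.1 d.1 d.2) isomorphisms)
  (zip small_matrices fingerprints)) (zip small_matrices fingerprints).
Proof. by vm_compute. Qed.

Fixpoint all_bools (n : nat) (P : seq bool -> bool) : bool :=
  if n is n'.+1 then
    all_bools n' (fun s => P (true :: s)) && all_bools n' (fun s => P (false :: s))
  else P [::].

Lemma all_boolsP n (P : seq bool -> bool) : all_bools n P -> forall s, size s = n -> P s.
Proof.
elim: n P => [|n IH] P /=; first by move=> P0 [].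
by move=> /andP[/IH Pt /IH Pf] [|[] s] //= [sn]; [apply: Pt|apply: Pf].
Qed.

Definition hersat_ok M (H : seq bool) : bool :=
  let h i := nth false H i in
  [&& all (fun i => all (fun j => h i && adj M i j ==> h j) (iota 0 3)) (iota 0 3)
    & all (fun i => all (fun j => adj M i j ==> h j) (iota 0 3) ==> h i) (iota 0 3)]
  ==> (H == nseq 3 false) || (H == nseq 3 true).

(** A cycle lacks an exit exactly when each of its vertices emits a single edge, that is, when their
    rows each contain one [true]. *)
Definition exit_ok M (c : seq nat) : bool :=
  ~~ (cycle (adj M) c && all (fun i => count (adj M i) (iota 0 3) == 1%N) c).

(** All cyclic sequences of distinct vertices up to rotation. *)
Definition small_cycles : seq (seq nat) :=
  [:: [:: 0]; [:: 1]; [:: 2]; [:: 0; 1]; [:: 0; 2]; [:: 1; 2]; [:: 0; 1; 2];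
      [:: 0; 2; 1]]%N.

Definition small_matrix M : bool :=
  [&& all (fun i => has (adj M i) (iota 0 3)) (iota 0 3),
      all (exit_ok M) small_cycles & all_bools 3 (hersat_ok M)].

Definition relabel (s : seq nat) (M : bmatrix) : bmatrix :=
  [seq [seq adj M i j | j <- s] | i <- s].

Definition relabelings : seq (seq nat) :=
  [:: [:: 0; 1; 2]; [:: 0; 2; 1]; [:: 1; 0; 2]; [:: 1; 2; 0]; [:: 2; 0; 1];
      [:: 2; 1; 0]]%N.

Definition rows (b : seq bool) : bmatrix := [:: take 3 b; take 3 (drop 3 b); drop 6 b].

(** Exhaustion of the 512 matrices; the conditional restricts the search for a relabeling to those
    that pass. *)
Lemma classification : all_bools 9 (fun b => if small_matrix (rows b) then
  has (fun s => relabel s (rows b) \in small_matrices) relabelings else true).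
Proof. by vm_compute. Qed.

Lemma presented_adjm E M vt idx : @presentation E M vt idx -> adjm vt = mat M.
Proof.
move=> pr; apply/matrixP => i j; rewrite !mxE (pr_adj pr).
rewrite (eq_bigr (fun e => if (idx (src e) == i :> nat) && (idx (rng e) == j :> nat)
  then 1 else 0)) => [|e _]; last first.
  by rewrite !val_eqE !(can2_eq (pr_idxK pr) (pr_vtK pr)); case: andb.
case: existsP => [[e /andP[/eqP/val_inj ei /eqP/val_inj ej]]|no].
  rewrite (bigD1 e) //= -ei -ej !eqxx big1 ?addr0 // => f fe.
  by rewrite (edge_pred pr) (negPf fe).
by rewrite big1 // => e _; case: ifP => // eij; case: no; exists e.
Qed.

Lemma presented_relabel E M s : s \in relabelings -> presented E M ->
  presented E (relabel s M).
Proof.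
move=> sR [vt [idx pr]].
have [us sz sI] : [/\ uniq s, size s = 3%N & forall i : 'I_3, nat_of_ord i \in s].
  move: sR; rewrite !inE => /or4P[/eqP->|/eqP->|/eqP->|/or3P[/eqP->|/eqP->|/eqP->]];
    by split=> // -[[|[|[|]]]].
have s3 i : (i < 3)%N -> (nth 0%N s i < 3)%N.
  move: sR; rewrite !inE => /or4P[/eqP->|/eqP->|/eqP->|/or3P[/eqP->|/eqP->|/eqP->]];
    by case: i => [|[|[|]]].
have ix (i : 'I_3) : (index (nat_of_ord i) s < 3)%N.
  by have := sI i; rewrite -index_mem sz.
pose vt' (i : 'I_3) := vt (Ordinal (s3 i (ltn_ord i))).
pose idx' v := Ordinal (ix (idx v)).
have relE i j : adj (relabel s M) i j =
    [&& (i < 3)%N, (j < 3)%N & adj M (nth 0%N s i) (nth 0%N s j)].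
  rewrite /adj /relabel; case: ltnP => i3; last first.
    by rewrite [nth [::] _ i]nth_default ?nth_nil // size_map sz.
  rewrite (nth_map 0%N) ?sz //; case: ltnP => j3; last first.
    by rewrite nth_default // size_map sz.
  by rewrite (nth_map 0%N) ?sz.
have idxE v i : (i < 3)%N -> (idx' v == i :> nat) = (idx v == nth 0%N s i :> nat).
  move=> i3; apply/eqP/eqP => [/= <-|vi]; first by rewrite nth_index.
  by rewrite /= vi index_uniq // sz.
exists vt', idx'; split.
- move=> i; apply: val_inj; rewrite /= /vt' (pr_vtK pr) /=.
  by rewrite index_uniq // sz.
- move=> v; rewrite /vt' -[RHS](pr_idxK pr); congr (vt _); apply: val_inj => /=.
  by rewrite nth_index.
- exact: (pr_parallel pr).
- exact: (pr_sink pr).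
- move=> i j; rewrite relE; have [i3|i3] := ltnP i 3; last first.
    apply/esym/negbTE/existsPn => e; apply/negP => /andP[/eqP si _].
    by move: i3; rewrite -si leqNgt ltn_ord.
  have [j3|j3] := ltnP j 3; last first.
    apply/esym/negbTE/existsPn => e; apply/negP => /andP[_ /eqP rj].
    by move: j3; rewrite -rj leqNgt ltn_ord.
  rewrite (pr_adj pr); apply: eq_existsb => e.
  by rewrite !idxE.
Qed.

(** * Matrices of small graphs *)

Section SmallPresentation.
Variable E : graph.
Hypothesis small : small_graph E.

Lemma small_presented : exists2 b, size b = 9%N & presented E (rows b).
Proof.
have E3 := small_card small.
pose vt (i : 'I_3) := enum_val (cast_ord (esym E3) i).
pose idx v := cast_ord E3 (enum_rank v).
pose A i j := [exists e : edge E, (idx (src e) == i :> nat) && (idx (rng e) == j :> nat)].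
exists [:: A 0 0; A 0 1; A 0 2; A 1 0; A 1 1; A 1 2; A 2 0; A 2 1; A 2 2]%N => //.
exists vt, idx; split.
- by move=> i; rewrite /idx /vt enum_valK cast_ordKV.
- by move=> v; rewrite /idx /vt cast_ordK enum_rankK.
- exact: (small_no_parallel small).
- exact: (small_no_sink small).
- have big i j : (3 <= i)%N || (3 <= j)%N -> A i j = false.
    move=> ij; apply/negbTE/existsPn => e; apply/negP => /andP[/eqP si /eqP rj].
    by move: (ltn_ord (idx (src e))) (ltn_ord (idx (rng e))); rewrite si rj; lia.
  move=> i j; rewrite -/(A i j); move: A big => A big.
  case: i => [|[|[|i]]]; case: j => [|[|[|j]]] //;
    rewrite /adj /rows /= ?nth_nil ?big ?orbT //.
Qed.

Variables (M : bmatrix) (vt : 'I_3 -> vertex E) (idx : vertex E -> 'I_3).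
Hypothesis pr : presentation M vt idx.

Lemma adjP (v w : vertex E) : reflect (exists e, src e = v /\ rng e = w) (adj M (idx v) (idx w)).
Proof.
rewrite (pr_adj pr); apply: (iffP existsP) => [[e]|[e [<- <-]]]; last first.
  by exists e; rewrite !eqxx.
by rewrite !(idx_eq pr) => /andP[/eqP <- /eqP <-]; exists e.
Qed.

Lemma idx_vtE i (i3 : (i < 3)%N) : i = idx (vt (Ordinal i3)) :> nat.
Proof. by rewrite (pr_vtK pr). Qed.

Lemma small_hersat_ok H : size H = 3%N -> hersat_ok M H.
Proof.
move=> H3; apply/implyP => /andP[/allP her /allP sat].
have in3 (i : 'I_3) : nat_of_ord i \in iota 0 3 by rewrite mem_iota add0n ltn_ord.
pose S := [set v | nth false H (idx v)]%SET.
have herS : hereditary S.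
  move=> e; rewrite !inE => sH; have /allP /(_ _ (in3 (idx (rng e)))) := her _ (in3 (idx (src e))).
  by rewrite sH (adj_edge pr).
have satS : saturated S.
  move=> v _ vS; rewrite inE; have /implyP := sat _ (in3 (idx v)); apply.
  apply/allP => j; rewrite mem_iota add0n /= => j3; apply/implyP.
  rewrite (idx_vtE j3) => /adjP [e [ve je]].
  by have := vS _ ve; rewrite inE je.
have nthE b : (forall v, (v \in S) = b) -> H == nseq 3 b.
  move=> SE; apply/eqP/(@eq_from_nth _ false); rewrite ?size_nseq // H3 => i i3.
  by rewrite nth_nseq i3 -(SE (vt (Ordinal i3))) inE -(idx_vtE i3).
have [S0|ST] := small_hersat small herS satS.
  by rewrite nthE // => v; rewrite S0 inE.
by rewrite (nthE true) ?orbT // => v; rewrite ST inE.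
Qed.

(** A cycle of vertices lifts to a cycle of edges, which has an exit. Without parallel edges the
    exit ends at a second out-neighbour, against the count of 1. *)
Lemma small_exit_ok c : c != [::] -> uniq c -> {subset c <= iota 0 3} -> exit_ok M c.
Proof.
move=> c0 uc cI; apply/negP => /andP[cyc /allP out].
have c3 i : i \in c -> (i < 3)%N by move/cI; rewrite mem_iota.
have /choice [ed edP] : forall i : nat, exists e : edge E, i \in c ->
    idx (src e) = i :> nat /\ idx (rng e) = next c i :> nat.
  move=> i; case ic: (i \in c); last first.
    (* Off the cycle the choice is arbitrary, but some edge must be exhibited; the nonempty cycle
       supplies one. *)
    have [i0 i0c] : exists i0, i0 \in c by case: c c0 {uc cI cyc out c3 ic} => // a l _; exists a; rewrite mem_head.
    have := next_cycle cyc i0c; rewrite (pr_adj pr) => /existsP [e _].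
    by exists e.
  have := next_cycle cyc ic; rewrite (pr_adj pr) => /existsP [e /andP[/eqP ? /eqP ?]].
  by exists e.
have isc : is_cycle (map ed c).
  apply/and3P; split; first by case: c c0 {uc cI cyc out c3 edP}.
    rewrite cycle_map; apply: (sub_in_cycle (P := mem c)) (cycle_next uc); last first.
      by apply/allP.
    move=> x y xc yc /eqP xy /=; have [_ rx] := edP x xc; have [sy _] := edP y yc.
    by apply/eqP; apply: (can_inj (pr_idxK pr)); apply: val_inj; rewrite /= rx sy.
  rewrite -map_comp map_inj_in_uniq // => x y xc yc /= sxy.
  by have [<- _] := edP x xc; have [<- _] := edP y yc; rewrite sxy.
have [_ [f [/mapP [x xc ->] sf fe]]] := small_exit small isc.
have [sx rx] := edP x xc; have /eqP := out x xc.
have in3 (i : 'I_3) : nat_of_ord i \in iota 0 3 by rewrite mem_iota add0n ltn_ord.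
have two : {subset [:: nat_of_ord (idx (rng f)); nat_of_ord (idx (rng (ed x)))]
    <= [seq j <- iota 0 3 | adj M x j]}.
  move=> j; rewrite !inE => /orP[/eqP ->|/eqP ->]; rewrite mem_filter in3 andbT
    -[X in adj M X _]sx.
    by rewrite -sf (adj_edge pr).
  exact: (adj_edge pr).
have u2 : uniq [:: nat_of_ord (idx (rng f)); nat_of_ord (idx (rng (ed x)))].
  rewrite /= inE andbT (idx_eq pr); apply: contraNneq fe => rr; apply/eqP.
  by apply: (pr_parallel pr).
by have := uniq_leq_size u2 two; rewrite size_filter => /= le2 eq1; rewrite eq1 in le2.
Qed.

Lemma small_matrixP : small_matrix M.
Proof.
apply/and3P; split.
- apply/allP => i; rewrite mem_iota add0n => /andP[_ i3]; apply/hasP.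
  have := pr_sink pr (vt (Ordinal i3)); rewrite negb_forall => /existsP [e].
  rewrite negbK => /eqP sv; exists (idx (rng e) : nat); first by rewrite mem_iota add0n ltn_ord.
  by rewrite (idx_vtE i3) -sv (adj_edge pr).
- apply/allP => c cS; have : [&& c != [::], uniq c & all (mem (iota 0 3)) c].
    by move: c cS; apply/allP.
  by move=> /and3P[c0 uc /allP cI]; apply: small_exit_ok.
- have boolsP n (P : seq bool -> bool) : (forall s, size s = n -> P s) -> all_bools n P.
    elim: n P => [|n IH] P Ps /=; first exact: Ps.
    by apply/andP; split; apply: IH => s sn; apply: Ps; rewrite /= sn.
  by apply: boolsP => H; apply: small_hersat_ok.
Qed.
End SmallPresentation.

Lemma small_classification E : small_graph E ->
  exists2 M, M \in small_matrices & presented E M.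
Proof.
move=> small; have [b b9 prb] := small_presented small.
have [vt [idx pr]] := prb.
have := all_boolsP classification b9; rewrite (small_matrixP small pr) => /hasP [s sR sM].
by exists (relabel s (rows b)) => //; apply: presented_relabel.
Qed.

Theorem theorem1p2 (k : fieldType) (E F : graph)
    (hE : small_graph E) (hF : small_graph F) :
  graded_isomorphic (leavitt k E) (leavitt k F) <->
  exists phi : K0gr (leavitt k E) -> K0gr (leavitt k F),
    [/\ bijective phi, K0_linear phi, K0_order_preserving phi
      & K0_pointed phi].
Proof.
split=> [|[phi [phiB phiL phiO phi1]]]; first exact: graded_isomorphic_K0.
have [M MS prM] := small_classification hE; have [M' M'S prM'] := small_classification hF.
have zipE N : N \in small_matrices ->
    (N, fingerprint tests 16 N) \in zip small_matrices fingerprints.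
  rewrite -fingerprintsE -{2}[small_matrices]map_id zip_map => NS.
  exact: map_f.
(* A separated pair contradicts the shift equivalence obtained from [phi]; any other pair comes with
   checked mutually inverse maps. *)
have := allP (allP separated_or_isomorphic _ (zipE _ MS)) _ (zipE _ M'S).
case: ifP => [sep _|_ /hasP [d _ /(check_iso_graded k prM prM')]//].
have loops N : N \in small_matrices -> all (test_loops N) tests.
  exact: (allP tests_loop).
have [[vt [idx pr]] [vt' [idx' pr']]] := (prM, prM').
have [] := separatedP (loops _ MS) (loops _ M'S) sep.
rewrite -(presented_adjm pr) -(presented_adjm pr').
apply: (K0_shift_equivalent (pr_sink pr) (pr_sink pr') _ _ phiB phiL phiO phi1).
  by exists idx; [apply: (pr_vtK pr)|apply: (pr_idxK pr)].
by exists idx'; [apply: (pr_vtK pr')|apply: (pr_idxK pr')].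
Qed.
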